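(* If $A$ is an $\mathfrak h$-Hopf algebroid with antipode $S^A$, then the dual $\mathfrak h$-bialgebroid $A^*$ is an $\mathfrak h$-Hopf algebroid with the antipode $S^{A^*}(\phi)=S^{D_{\mathfrak h}}\circ\phi\circ S^A$.
   Context: Basics. $\mathfrak h^*$ is a finite-dimensional complex vector space, $M_{\mathfrak h^*}$ is the field of meromorphic functions on it, and $(T_\alpha f)(\lambda)=f(\lambda+\alpha)$ for $\alpha\in\mathfrak h^*$. An $\mathfrak h$-prealgebra is a complex vector space $A=\bigoplus_{\alpha,\beta\in\mathfrak h^*}A_{\alpha\beta}$ with two left actions (moment maps) $\mu_l,\mu_r:M_{\mathfrak h^*}\to\mathrm{End}_{\mathbb C}(A)$ preserving the bigrading and with commuting images; homomorphisms are linear maps preserving moment maps and bigrading. Right actions are defined by $\mu_l(f)a=a\mu_l(T_\alpha f)$, $\mu_r(f)a=a\mu_r(T_\beta f)$ for $a\in A_{\alpha\beta}$. $A\widetilde\otimes B$ is $\bigoplus_{\alpha\beta\gamma}A_{\alpha\gamma}\otimes_{\mathbb C}B_{\gamma\beta}$ modulo $\mu_r(f)a\otimes b=a\otimes\mu_l(f)b$, with bigrading $A_{\alpha\beta}\widetilde\otimes B_{\beta\gamma}\subseteq(A\widetilde\otimes B)_{\alpha\gamma}$ and moment maps $\mu_l(f)(a\otimes b)=\mu_l(f)a\otimes b$, $\mu_r(f)(a\otimes b)=a\otimes\mu_r(f)b$. $A\widehat\otimes B$ is $A\otimes_{\mathbb C}B$ modulo $a\mu_l(f)\otimes b=a\otimes\mu_l(f)b$,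 $a\mu_r(f)\otimes b=a\otimes\mu_r(f)b$, with bigrading $A_{\alpha\beta}\widehat\otimes B_{\gamma\delta}\subseteq(A\widehat\otimes B)_{\alpha+\gamma,\beta+\delta}$ and moment maps acting on the first factor. An $\mathfrak h$-algebra is an $\mathfrak h$-prealgebra that is a unital associative algebra with $A_{\alpha\beta}A_{\gamma\delta}\subseteq A_{\alpha+\gamma,\beta+\delta}$, where $\mu_l,\mu_r$ are viewed as algebra embeddings $M_{\mathfrak h^*}\to A_{00}$, $\mu_l(f)=\mu_l(f)1$ etc., and the relations $\mu_l(f)a=a\mu_l(T_\alpha f)$, $\mu_r(f)a=a\mu_r(T_\beta f)$ ($a\in A_{\alpha\beta}$, $f\in M_{\mathfrak h^*}$) hold in the algebra. $D_{\mathfrak h}$ is the algebra of difference operators $\sum_i f_iT_{\beta_i}$ (finite sums) on $M_{\mathfrak h^*}$; it is an $\mathfrak h$-algebra with $fT_{-\beta}\in(D_{\mathfrak h})_{\beta\beta}$ (so $(D_{\mathfrak h})_{\alpha\beta}=0$ for $\alpha\ne\beta$) and both moment maps $f\mapsto f=fT_0$. There are canonical isomorphisms $A\simeq A\widetilde\otimes D_{\mathfrak h}\simeq D_{\mathfrak h}\widetilde\otimes A$, $x\simeq x\otimes T_{-\beta}\simeq T_{-\alpha}\otimes x$, $x\in A_{\alpha\beta}$. An $\mathfrak h$-coalgebroid is an $\mathfrak h$-prealgebra with prealgebra homomorphisms $\Delta:A\to A\widetilde\otimes A$ and $\varepsilon:A\to D_{\mathfrak h}$ satisfying coassociativity and $(\varepsilon\otimes\mathrm{id})\Delta=(\mathrm{id}\otimes\varepsilon)\Delta=\mathrm{id}$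 under the canonical identifications. If $A,B$ are $\mathfrak h$-coalgebroids, so is $A\widehat\otimes B$, with $\Delta=\sigma_{23}\circ(\Delta^A\otimes\Delta^B)$ ($\sigma_{23}$ induced by $a\otimes b\otimes c\otimes d\mapsto a\otimes c\otimes b\otimes d$) and $\varepsilon(a\otimes b)=\varepsilon^A(a)\circ\varepsilon^B(b)$. An $\mathfrak h$-bialgebroid is an $\mathfrak h$-algebra and $\mathfrak h$-coalgebroid with $\Delta,\varepsilon$ $\mathfrak h$-algebra homomorphisms (product on $A\widetilde\otimes A$: $(a\otimes b)(c\otimes d)=ac\otimes bd$). An $\mathfrak h$-Hopf algebroid is an $\mathfrak h$-bialgebroid with a $\mathbb C$-linear map $S:A\to A$ (antipode) such that $S(\mu_r(f)a)=S(a)\mu_l(f)$, $S(a\mu_l(f))=\mu_r(f)S(a)$, and, with $m$ the multiplication, $m(\mathrm{id}\otimes S)\Delta(a)=\mu_l(\varepsilon(a)1)$ for all $a$, $m(S\otimes\mathrm{id})\Delta(a)=\mu_r(T_\alpha(\varepsilon(a)1))$ for $a\in A_{\alpha\beta}$, where $\varepsilon(a)1$ is the action of the difference operator on the function $1$. $D_{\mathfrak h}$ is an $\mathfrak h$-Hopf algebroid with antipode $S^{D_{\mathfrak h}}(fT_\alpha)=(T_{-\alpha}f)T_{-\alpha}$. Duals. Write $\langle a,\phi\rangle=\phi(a)$. For an $\mathfrak h$-coalgebroid $A$, $A'_{\alpha\beta}$ is the space of $\phi\in\mathrm{Hom}_{\mathbb C}(A,D_{\mathfrak h})$ with $\langle\mu_l(f)a,\phi\rangle=f\circ\langle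 a,\phi\rangle$, $\langle a\mu_r(f),\phi\rangle=\langle a,\phi\rangle\circ f$, and $\langle A_{\gamma\delta},\phi\rangle\subseteq(D_{\mathfrak h})_{\gamma+\beta,\delta+\alpha}$ for all $\gamma,\delta$. $A'=\bigoplus_{\alpha\beta}A'_{\alpha\beta}$ is an $\mathfrak h$-algebra (the dual $\mathfrak h$-algebra) with product $\langle a,\phi\psi\rangle=\sum_i\langle a_i',\phi\rangle T_{\beta_i}\langle a_i'',\psi\rangle$ for $\Delta(a)=\sum_ia_i'\otimes a_i''$, $a_i''\in A_{\beta_i\gamma}$, unit $\varepsilon$, and moment maps $\langle a,\mu_l(f)\rangle=f\circ\langle a,\varepsilon\rangle$, $\langle a,\mu_r(f)\rangle=\langle a,\varepsilon\rangle\circ f$. There is an $\mathfrak h$-algebra embedding $\iota:A'\widetilde\otimes A'\to(A\widehat\otimes A)'$, $\langle a\otimes b,\iota(\phi\otimes\psi)\rangle=\langle a,\phi\rangle T_\beta\langle b,\psi\rangle$ for $\phi\in A'_{\alpha\beta}$, $\psi\in A'_{\beta\gamma}$. For an $\mathfrak h$-bialgebroid $A$, define $m':A'\to(A\widehat\otimes A)'$ by $\langle x\otimes y,m'(\phi)\rangle=\langle xy,\phi\rangle$. The dual $\mathfrak h$-bialgebroid is $A^*=\{\phi\in A':m'(\phi)\in\mathrm{Im}(\iota)\}$, an $\mathfrak h$-subalgebra of $A'$, with coproduct $\Delta=\iota^{-1}\circ m'$ and counit $\varepsilon(\psi)=\langle1,\psi\rangle$. *)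

(* Defs.v *)
From HB Require Import structures.
From mathcomp Require Import all_boot all_order all_algebra.
From mathcomp Require Import complex.
From mathcomp Require Import all_classical.
From mathcomp Require Import reals topology normedtype.
From mathcomp Require Import freeg.

Set Implicit Arguments.
Unset Strict Implicit.
Unset Printing Implicit Defensive.

Import Order.TTheory GRing.Theory Num.Theory.
Import numFieldNormedType.Exports VectorInternalTheory.

Local Open Scope classical_set_scope.
Local Open Scope ring_scope.

Section Analytic.
Variables (C : numFieldType) (n : nat).
Implicit Types (f g h : 'rV[C]_n -> C) (p z w : 'rV[C]_n).
Implicit Types (k l m : {ffun 'I_n -> nat}) (a b : {ffun 'I_n -> nat} -> C).

Definition mindex (N : nat) : seq {ffun 'I_n -> nat} :=
  [seq [ffun i => val (k i)] | k : {ffun 'I_n -> 'I_N}].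

Definition monom z k : C := \prod_i z 0 i ^+ k i.

(* f is near p the sum of a power series in several variables; the bound B
   expresses absolute convergence on the closed polydisc of radius r. *)
Definition analytic_at f p : Prop :=
  exists (a : {ffun 'I_n -> nat} -> C) (r B : C),
    [/\ 0 < r,
        forall N, \sum_(k <- mindex N) `|a k| * monom (const_mx r) k <= B &
        forall z, (forall i, `|z 0 i - p 0 i| < r) ->
          \sum_(k <- mindex N) a k * monom (z - p) k @[N --> \oo] --> f z].

(* P holds on a relatively open dense part of the open set U. *)
Definition generically (U P : set 'rV[C]_n) : Prop :=
  exists W, [/\ open W, U `<=` closure W & U `&` W `<=` P].

(* A meromorphic function is represented by total functions that are locally a
   quotient of holomorphic functions away from a nowhere dense set; its values
   on that set are irrelevant, see [mero] below. *)
Definition meromorphic f : Prop := forall p, exists U g h,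
  [/\ open_nbhs p U, forall z, U z -> analytic_at g z,
      forall z, U z -> analytic_at h z &
      generically U [set z | h z != 0 /\ f z = g z / h z]].

End Analytic.

Section AnalyticTheory.
Variables (C : numFieldType) (n : nat).
Hypothesis mono_cauchy : forall (u : nat -> C) (B : C),
  (forall N, 0 <= u N) -> (forall N N', (N <= N')%N -> u N <= u N') ->
  (forall N, u N <= B) ->
  forall e, 0 < e -> exists N, forall N', (N <= N')%N -> u N' - u N <= e.
Implicit Types (f g h : 'rV[C]_n -> C) (p z w : 'rV[C]_n).
Implicit Types (k l m : {ffun 'I_n -> nat}) (a b : {ffun 'I_n -> nat} -> C).

Lemma mem_mindex N k : (k \in mindex n N) = [forall i, k i < N]%N.
Proof.
apply/mapP/forallP => [[x _ ->] i|kN].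
  by rewrite ffunE ltn_ord.
exists [ffun i => Ordinal (kN i)]; first by rewrite mem_enum.
by apply/ffunP => i; rewrite !ffunE.
Qed.

Lemma mindex_uniq N : uniq (mindex n N).
Proof.
rewrite map_inj_in_uniq ?enum_uniq // => x y _ _ /ffunP xy.
by apply/ffunP => i; apply: val_inj; have := xy i; rewrite !ffunE.
Qed.

Lemma mindexS N N' : (N <= N')%N -> {subset mindex n N <= mindex n N'}.
Proof.
move=> le k; rewrite !mem_mindex => /forallP kN; apply/forallP => i.
exact: leq_trans (kN i) le.
Qed.

Lemma big_usub (T : eqType) (M : nmodType) (s t : seq T) (F : T -> M) :
  uniq s -> uniq t -> {subset s <= t} ->
  (forall x, x \in t -> x \notin s -> F x = 0) ->
  \sum_(x <- t) F x = \sum_(x <- s) F x.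
Proof.
move=> us ut st F0.
rewrite (bigID (mem s)) /= [X in _ + X]big_seq_cond [X in _ + X]big1 ?addr0; last first.
  by move=> i /andP[it si]; exact: F0.
rewrite -big_filter; apply: perm_big; apply: uniq_perm => //.
  exact: filter_uniq.
move=> x; rewrite mem_filter; case xs: (x \in s) => //=.
by rewrite st.
Qed.

Lemma monomM z k l : monom z [ffun i => (k i + l i)%N] = monom z k * monom z l.
Proof.
rewrite /monom -big_split; apply: eq_bigr => i _.
by rewrite ffunE exprD.
Qed.

Lemma monom_ge0 (r : C) k : 0 <= r -> 0 <= monom (const_mx r) k.
Proof. by move=> r0; apply: prodr_ge0 => i _; rewrite mxE exprn_ge0. Qed.

Lemma monom_le (r : C) z k : (forall i, `|z 0 i| <= r) ->
  `|monom z k| <= monom (const_mx r) k.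
Proof.
move=> zr; rewrite normr_prod; apply: ler_prod => i _.
rewrite normr_ge0 normrX mxE /=.
apply: lerXn2r; rewrite ?nnegrE //.
exact: le_trans (zr i).
Qed.

Definition has_series f p a (r B : C) := 
    [/\ 0 < r,
        forall N, \sum_(k <- mindex n N) `|a k| * monom (const_mx r) k <= B &
        forall z, (forall i, `|z 0 i - p 0 i| < r) ->
          \sum_(k <- mindex n N) a k * monom (z - p) k @[N --> \oo] --> f z].

Lemma has_series_shrink f p a r r' B : 0 < r' -> r' <= r ->
  has_series f p a r B -> has_series f p a r' B.
Proof.
move=> r'0 r'r [r0 Bb cv]; split => //.
  move=> N; apply: le_trans (Bb N).
  apply: ler_sum => k _; apply: ler_wpM2l => //.
  rewrite -[leLHS]ger0_norm; last exact/monom_ge0/ltW.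
  by apply: monom_le => i; rewrite mxE gtr0_norm.
move=> z zp; apply: cv => i; exact: lt_le_trans r'r.
Qed.

Lemma has_series2 f g p : analytic_at f p -> analytic_at g p ->
  exists a b r B B', has_series f p a r B /\ has_series g p b r B'.
Proof.
move=> [a [r [B fa]]] [b [r' [B' gb]]].
have [r0 _ _] := fa; have [r'0 _ _] := gb.
have [le|lt] := real_leP (gtr0_real r0) (gtr0_real r'0).
  by exists a, b, r, B, B'; split => //; apply: (has_series_shrink r0 le gb).
by exists a, b, r', B, B'; split => //; apply: (has_series_shrink r'0 (ltW lt) fa).
Qed.

Lemma analytic_cst (c : C) p : analytic_at (fun=> c) p.
Proof.
pose z0 : {ffun 'I_n -> nat} := [ffun=> 0%N].
exists (fun k => if k == z0 then c else 0), 1, `|c|.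
have m0 z : monom z z0 = 1.
  by rewrite /monom big1 // => i _; rewrite ffunE expr0.
have z0in N : (0 < N)%N -> z0 \in mindex n N.
  by move=> N0; rewrite mem_mindex; apply/forallP => i; rewrite ffunE.
split => // [N|z _].
  have [zN|zN] := boolP (z0 \in mindex n N).
    rewrite (big_rem z0) //= eqxx m0 mulr1 big_seq big1 ?addr0 // => i.
    rewrite mem_rem_uniq ?mindex_uniq // inE => /andP[/negPf -> _].
    by rewrite normr0 mul0r.
  rewrite big_seq big1 // => i iN; case: eqP => [ei|]; last by rewrite normr0 mul0r.
  by rewrite -ei iN in zN.
apply: cvg_near_cst; exists 1%N => // N /= N0.
rewrite (big_rem z0) ?z0in //= eqxx m0 mulr1 big_seq big1 ?addr0 // => i.
by rewrite mem_rem_uniq ?mindex_uniq // inE => /andP[/negPf -> _]; rewrite mul0r.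
Qed.

Lemma analyticB f g p : analytic_at f p -> analytic_at g p ->
  analytic_at (fun z => f z - g z) p.
Proof.
move=> af ag; have [a [b [r [B [B' [[r0 fB fc] [_ gB gc]]]]]]] := has_series2 af ag.
exists (fun k => a k - b k), r, (B + B'); split => // [N|z zp].
  apply: le_trans (lerD (fB N) (gB N)); rewrite -big_split /=.
  apply: ler_sum => k _; rewrite -mulrDl ler_wpM2r ?ler_normB //.
  exact/monom_ge0/ltW.
rewrite [X in X @ _](_ : _ = fun N => \sum_(k <- mindex n N) a k * monom (z - p) k
   - \sum_(k <- mindex n N) b k * monom (z - p) k); last first.
  by apply/funext => N; rewrite -sumrB; apply: eq_bigr => k _; rewrite mulrBl.
by apply: cvgB; [exact: fc|exact: gc].
Qed.

Section Product.
Variables (a b : {ffun 'I_n -> nat} -> C).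

Let G N m := \sum_(k <- mindex n N) \sum_(l <- mindex n N)
  if [ffun i => (k i + l i)%N] == m then a k * b l else 0.

Let c m := G (\sum_i m i).+1 m.

Let GS N N' m : m \in mindex n N -> (N <= N')%N -> G N m = G N' m.
Proof.
rewrite mem_mindex => /forallP mN le; rewrite /G.
have aux k l : [ffun i => (k i + l i)%N] == m -> k \in mindex n N /\ l \in mindex n N.
  move=> /eqP e; rewrite !mem_mindex; split; apply/forallP => i;
    have := mN i; rewrite -e ffunE; apply: leq_ltn_trans; [exact: leq_addr|exact: leq_addl].
apply/esym; rewrite (big_usub (mindex_uniq N) (mindex_uniq N') (mindexS le)); last first.
  move=> k _ kN; apply: big1 => l _; case: ifP => // /aux[k1 _].
  by rewrite k1 in kN.
apply: eq_bigr => k _.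
rewrite (big_usub (mindex_uniq N) (mindex_uniq N') (mindexS le)) //.
by move=> l _ lN; case: ifP => // /aux[_ l1]; rewrite l1 in lN.
Qed.

Let cE N m : m \in mindex n N -> c m = G N m.
Proof.
move=> mN; rewrite /c.
have m1 : m \in mindex n (\sum_i m i).+1.
  rewrite mem_mindex; apply/forallP => i; rewrite ltnS (bigD1 i) //=.
  exact: leq_addr.
have [le|lt] := leqP N (\sum_i m i).+1; first by rewrite -(GS mN le).
by rewrite (GS m1 (ltnW lt)).
Qed.

Let csum N (F : {ffun 'I_n -> nat} -> C) :
  \sum_(m <- mindex n N) c m * F m =
  \sum_(k <- mindex n N) \sum_(l <- mindex n N)
    if [ffun i => (k i + l i)%N] \in mindex n N then a k * b l * F [ffun i => (k i + l i)%N]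
    else 0.
Proof.
rewrite big_seq (eq_bigr (fun m => \sum_(k <- mindex n N) \sum_(l <- mindex n N)
  if [ffun i => (k i + l i)%N] == m then a k * b l * F m else 0)); last first.
  move=> m mN; rewrite (cE mN) mulr_suml; apply: eq_bigr => k _.
  by rewrite mulr_suml; apply: eq_bigr => l _; case: ifP => //; rewrite mul0r.
rewrite -big_seq exchange_big; apply: eq_bigr => k _.
rewrite exchange_big; apply: eq_bigr => l _ /=.
set s := [ffun i => _]; case: ifP => sN.
  rewrite (big_rem s) //= eqxx big_seq big1 ?addr0 // => i.
  by rewrite mem_rem_uniq ?mindex_uniq // inE eq_sym => /andP[/negPf -> _].
rewrite big_seq big1 // => i; case: eqP => // <-.
by rewrite sN.
Qed.

Let cnorm N (F : {ffun 'I_n -> nat} -> C) : (forall m, 0 <= F m) ->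
  \sum_(m <- mindex n N) `|c m| * F m <=
  \sum_(k <- mindex n N) \sum_(l <- mindex n N)
    if [ffun i => (k i + l i)%N] \in mindex n N then `|a k| * `|b l| * F [ffun i => (k i + l i)%N]
    else 0.
Proof.
move=> F0.
apply: (@le_trans _ _ (\sum_(m <- mindex n N) \sum_(k <- mindex n N) \sum_(l <- mindex n N)
  if [ffun i => (k i + l i)%N] == m then `|a k| * `|b l| * F m else 0)).
  rewrite [leLHS]big_seq [leRHS]big_seq; apply: ler_sum => m mN; rewrite (cE mN).
  rewrite (le_trans (ler_wpM2r (F0 m) (ler_norm_sum _ _ _))) //.
  rewrite mulr_suml; apply: ler_sum => k _.
  rewrite (le_trans (ler_wpM2r (F0 m) (ler_norm_sum _ _ _))) //.
  rewrite mulr_suml; apply: ler_sum => l _.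
  by case: ifP => _; rewrite ?normr0 ?mul0r // normrM.
rewrite exchange_big; apply: ler_sum => k _.
rewrite exchange_big; apply: ler_sum => l _ /=.
set s := [ffun i => _]; case: ifP => sN.
  rewrite (big_rem s) //= eqxx big_seq big1 ?addr0 // => i.
  by rewrite mem_rem_uniq ?mindex_uniq // inE eq_sym => /andP[/negPf -> _].
rewrite big_seq big1 // => i; case: eqP => // <-.
by rewrite sN.
Qed.

Lemma has_seriesM f g p r B B' : has_series f p a r B -> has_series g p b r B' ->
  has_series (fun z => f z * g z) p c r (B * B').
Proof.
move=> [r0 fB fc] [_ gB gc].
pose F k := monom (const_mx r : 'rV[C]_n) k.
have F0 k : 0 <= F k by apply/monom_ge0/ltW.
pose SA N := \sum_(k <- mindex n N) `|a k| * F k.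
pose SB N := \sum_(k <- mindex n N) `|b k| * F k.
have tA k : 0 <= `|a k| * F k by rewrite mulr_ge0.
have tB k : 0 <= `|b k| * F k by rewrite mulr_ge0.
have SA0 N : 0 <= SA N by apply: sumr_ge0.
have SB0 N : 0 <= SB N by apply: sumr_ge0.
have restr (h : {ffun 'I_n -> nat} -> C) N N' : (N <= N')%N ->
  \sum_(k <- mindex n N) h k = \sum_(k <- mindex n N') if k \in mindex n N then h k else 0.
  move=> le; rewrite (big_usub (mindex_uniq N) (mindex_uniq N') (mindexS le)).
    by rewrite [LHS]big_seq [RHS]big_seq; apply: eq_bigr => k ->.
  by move=> x _ /negPf ->.
have mono (h : {ffun 'I_n -> nat} -> C) : (forall k, 0 <= h k) -> forall N N', (N <= N')%N ->
  \sum_(k <- mindex n N) h k <= \sum_(k <- mindex n N') h k.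
  move=> h0 N N' le; rewrite (restr h N N' le); apply: ler_sum => k _.
  by case: ifP => _.
have B0 : 0 <= B by apply: le_trans (SA0 0%N) (fB _).
have B'0 : 0 <= B' by apply: le_trans (SB0 0%N) (gB _).
split => //.
  move=> N; apply: le_trans (cnorm N F0) _.
  apply: (@le_trans _ _ (SA N * SB N)); last exact: (ler_pM (SA0 N) (SB0 N) (fB N) (gB N)).
  rewrite mulr_suml; apply: ler_sum => k _.
  rewrite mulr_sumr; apply: ler_sum => l _.
  case: ifP => _; last by rewrite mulr_ge0.
  by rewrite /F monomM mulrACA.
move=> z zp; have zr i : `|(z - p) 0 i| <= r by rewrite !mxE ltW.
have {}fc := fc _ zp; have {}gc := gc _ zp.
set w := z - p in fc gc zr *.
rewrite [X in X @ _](_ : _ = fun N =>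
   (\sum_(k <- mindex n N) a k * monom w k) * (\sum_(k <- mindex n N) b k * monom w k)
   - \sum_(k <- mindex n N) \sum_(l <- mindex n N)
    if [ffun i => (k i + l i)%N] \in mindex n N then 0 else (a k * monom w k) * (b l * monom w l)); last first.
  apply/funext => N; rewrite csum mulr_suml -sumrB; apply: eq_bigr => k _.
  rewrite mulr_sumr -sumrB; apply: eq_bigr => l _.
  by case: ifP => _; rewrite ?subr0 ?subrr // monomM mulrACA.
rewrite -[X in _ --> X]subr0; apply: cvgB; first exact: cvgM.
apply/cvgrPdist_le => e e0.
have e1 : 0 < e / (B + B' + 1) by rewrite divr_gt0 // ltr_wpDl // addr_ge0.
have [N1 hN1] := mono_cauchy SA0 (mono _ tA) fB e1.
have [N2 hN2] := mono_cauchy SB0 (mono _ tB) gB e1.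
pose h := maxn N1 N2.
exists (h + h)%N => // N /= hN.
have leh : (h <= N)%N by apply: leq_trans hN; apply: leq_addr.
rewrite sub0r normrN.
apply: (@le_trans _ _ (SA N * SB N - SA h * SB h)).
  rewrite (le_trans (ler_norm_sum _ _ _)) //.
  rewrite [SA h](restr _ _ _ leh) [SB h](restr _ _ _ leh) 2!mulr_suml -sumrB.
  apply: ler_sum => k _; rewrite (le_trans (ler_norm_sum _ _ _)) //.
  rewrite 2!mulr_sumr -sumrB; apply: ler_sum => l _.
  case: ifP => klN.
    rewrite normr0 subr_ge0; do 2 case: ifP => _; rewrite ?mulr0 ?mul0r //; exact: mulr_ge0.
  have -> : (if k \in mindex n h then `|a k| * F k else 0) *
            (if l \in mindex n h then `|b l| * F l else 0) = 0.
    case: ifP => kh; last by rewrite mul0r.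
    case: ifP => lh; last by rewrite mulr0.
    move: klN; rewrite mem_mindex; move=> /negP; case; apply/forallP => i.
    move: kh lh; rewrite !mem_mindex => /forallP/(_ i) ki /forallP/(_ i) li.
    rewrite ffunE; apply: leq_trans hN; rewrite -addSn; apply: leq_add => //.
    exact: ltnW.
  rewrite subr0 normrM; apply: ler_pM => //; rewrite normrM ler_wpM2l //; exact: monom_le.
have -> : SA N * SB N - SA h * SB h = (SA N - SA h) * SB N + SA h * (SB N - SB h).
  by rewrite mulrBl mulrBr addrA subrK.
have dA : SA N - SA h <= e / (B + B' + 1).
  apply: le_trans (hN1 N _); last by apply: leq_trans leh; exact: leq_maxl.
  by rewrite lerB // (mono _ tA) // leq_maxl.
have dB : SB N - SB h <= e / (B + B' + 1).
  apply: le_trans (hN2 N _); last by apply: leq_trans leh; exact: leq_maxr.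
  by rewrite lerB // (mono _ tB) // leq_maxr.
apply: (@le_trans _ _ (e / (B + B' + 1) * B' + B * (e / (B + B' + 1)))).
  apply: lerD.
    by apply: (ler_pM _ (SB0 N) dA (gB N)); rewrite subr_ge0; apply: (mono _ tA).
  by apply: (ler_pM (SA0 h) _ (fB h) dB); rewrite subr_ge0; apply: (mono _ tB).
rewrite [B * _]mulrC -mulrDr mulrAC ler_pdivrMr; last by rewrite ltr_wpDl // addr_ge0.
by rewrite ler_pM2l // [B' + B]addrC lerDl.
Qed.

End Product.

Lemma analyticM f g p : analytic_at f p -> analytic_at g p ->
  analytic_at (fun z => f z * g z) p.
Proof.
move=> af ag; have [a [b [r [B [B' [fa gb]]]]]] := has_series2 af ag.
by have h := has_seriesM fa gb; do 3 eexists; exact: h.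
Qed.

Lemma analytic_shift f p w :
  analytic_at f (p + w) -> analytic_at (fun z => f (z + w)) p.
Proof.
move=> [a [r [B [r0 aB ac]]]]; exists a, r, B; split => // z zp.
rewrite [X in X @ _](_ : _ = fun N => \sum_(k <- mindex n N) a k * monom ((z + w) - (p + w)) k).
  by apply: ac => i; rewrite !mxE opprD addrACA subrr addr0.
by apply/funext => N; rewrite opprD addrACA subrr addr0.
Qed.

Lemma genericallyI (U U' P Q S : set 'rV[C]_n) : open U -> open U' ->
  generically U P -> generically U' Q ->
  (forall z, P z -> Q z -> S z) -> generically (U `&` U') S.
Proof.
move=> oU oU' [W [oW dW WP]] [W' [oW' dW' WQ]] PQS.
exists (W `&` W'); split; first exact: openI.
  move=> z [Uz U'z] O Oz.
  have [O' [oO' O'z] O'O] : exists2 O', open_nbhs z O' & O' `<=` O.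
    by move: Oz; rewrite nbhsE => -[O' ? ?]; exists O'.
  have /(dW _ Uz)[y [Wy [Oy [Uy U'y]]]] : nbhs z (O' `&` (U `&` U')).
    by apply: open_nbhs_nbhs; split => //; apply: openI => //; apply: openI.
  have /(dW' _ U'y)[x [W'x [Wx Ox]]] : nbhs y (W `&` O').
    by apply: open_nbhs_nbhs; split => //; apply: openI.
  by exists x; split => //; apply: O'O.
by move=> z [[Uz U'z] [Wz W'z]]; apply: PQS; [exact: WP|exact: WQ].
Qed.

Lemma genericallyT (P : set 'rV[C]_n) : (forall z, P z) -> generically setT P.
Proof.
move=> PT; exists setT; split; [exact: openT|by rewrite closureT|].
by move=> z _; exact: PT.
Qed.

Lemma generically_ex (P : set 'rV[C]_n) : generically setT P -> exists z, P z.
Proof.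
move=> [W [_ dW WP]].
have /(dW (0 : 'rV[C]_n) Logic.I)[y [Wy _]] : nbhs (0 : 'rV[C]_n) setT by exact: filterT.
by exists y; apply: WP.
Qed.

Lemma generically_mono (P Q : set 'rV[C]_n) : (forall z, P z -> Q z) ->
  generically setT P -> generically setT Q.
Proof. by move=> PQ [W [oW dW WP]]; exists W; split=> // z /WP; exact: PQ. Qed.

Lemma genericallyTI (P Q S : set 'rV[C]_n) :
  generically setT P -> generically setT Q -> (forall z, P z -> Q z -> S z) ->
  generically setT S.
Proof.
move=> gP gQ PQS; rewrite -[setT]setIT.
exact: genericallyI openT openT gP gQ PQS.
Qed.

Lemma open_shift (U : set 'rV[C]_n) w : open U -> open [set z | U (z + w)].
Proof.
move=> oU; apply: (@open_comp _ _ (fun z => z + w)) => // z _.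
have := @cvgD C 'rV[C]_n _ (nbhs z) _ id (cst w) z w.
by apply; [exact: cvg_id|exact: cvg_cst].
Qed.

Lemma generically_shift (U P : set 'rV[C]_n) w : generically U P ->
  generically [set z | U (z + w)] [set z | P (z + w)].
Proof.
move=> [W [oW dW WP]]; exists [set z | W (z + w)]; split.
- exact: open_shift.
- move=> z /dW cz O /=; rewrite nbhsE => -[O' [oO' O'z] O'O].
  have /cz[y [Wy Oy]] : nbhs (z + w) [set y | O' (y - w)].
    by apply: open_nbhs_nbhs; split; [exact: (open_shift oO')|rewrite /= addrK].
  by exists (y - w); split; [rewrite /= subrK|exact: O'O].
- by move=> z /= Uz; apply: WP.
Qed.

Lemma meromorphic_cst (c : C) : meromorphic (fun _ : 'rV[C]_n => c).
Proof.
move=> p; exists setT, (fun=> c), (fun=> 1); split; rewrite ?openTE.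
- by split => //; exact: openT.
- by move=> z _; exact: analytic_cst.
- by move=> z _; exact: analytic_cst.
- exists setT; split; [exact: openT|by rewrite closureT|move=> z _ /=].
  by rewrite oner_neq0 divr1.
Qed.

Lemma meromorphicB f g : meromorphic f -> meromorphic g ->
  meromorphic (fun z => f z - g z).
Proof.
move=> mf mg p.
have [U [f1 [f2 [[oU Up] a1 a2 gf]]]] := mf p.
have [U' [g1 [g2 [[oU' Up'] b1 b2 gg]]]] := mg p.
exists (U `&` U'), (fun z => f1 z * g2 z - g1 z * f2 z), (fun z => f2 z * g2 z); split.
- by split => //; exact: openI.
- by move=> z [Uz U'z]; apply: analyticB; apply: analyticM; auto.
- by move=> z [Uz U'z]; apply: analyticM; auto.
- apply: genericallyI gf gg _ => // z /= [fz ->] [gz ->]; split.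
    by rewrite mulf_neq0.
  by rewrite -mulNr addf_div // mulNr.
Qed.

Lemma meromorphicM f g : meromorphic f -> meromorphic g ->
  meromorphic (fun z => f z * g z).
Proof.
move=> mf mg p.
have [U [f1 [f2 [[oU Up] a1 a2 gf]]]] := mf p.
have [U' [g1 [g2 [[oU' Up'] b1 b2 gg]]]] := mg p.
exists (U `&` U'), (fun z => f1 z * g1 z), (fun z => f2 z * g2 z); split.
- by split => //; exact: openI.
- by move=> z [Uz U'z]; apply: analyticM; auto.
- by move=> z [Uz U'z]; apply: analyticM; auto.
- apply: genericallyI gf gg _ => // z /= [fz ->] [gz ->]; split.
    by rewrite mulf_neq0.
  by rewrite mulf_div.
Qed.

Lemma meromorphic_shift f w : meromorphic f -> meromorphic (fun z => f (z + w)).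
Proof.
move=> mf p; have [U [g [h [[oU Up] ag ah gf]]]] := mf (p + w).
exists [set z | U (z + w)], (fun z => g (z + w)), (fun z => h (z + w)); split.
- by split => //; exact: open_shift.
- by move=> z Uz; apply/analytic_shift/ag.
- by move=> z Uz; apply/analytic_shift/ah.
- exact: generically_shift gf.
Qed.

End AnalyticTheory.

Lemma complex_mono_cauchy (R : realType) (u : nat -> R[i]) (B : R[i]) :
  (forall N, 0 <= u N) -> (forall N N', (N <= N')%N -> u N <= u N') ->
  (forall N, u N <= B) ->
  forall e, 0 < e -> exists N, forall N', (N <= N')%N -> u N' - u N <= e.
Proof.
move=> u0 um uB e e0.
have leRe (x y : R[i]) : x <= y -> complex.Re x <= complex.Re y.
  by rewrite lecE => /andP[].
have lec (x y : R[i]) : 0 <= x -> 0 <= y -> (complex.Re x <= complex.Re y) -> x <= y.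
  move: x y => [x x'] [y y']; rewrite !lecE /= => /andP[/eqP -> _] /andP[/eqP -> _] ->.
  by rewrite eqxx.
pose S := [set complex.Re (u N) | N in setT].
have hS : has_sup S.
  split; first by exists (complex.Re (u 0%N)), 0%N.
  by exists (complex.Re B) => _ [N _ <-]; apply: leRe.
have e0' : 0 < complex.Re e by move: e0; rewrite ltcE => /andP[].
have [_ [N _ <-] hN] := sup_adherent e0' hS.
exists N => N' le; apply: lec; [by rewrite subr_ge0 um|exact: ltW|].
rewrite raddfB /= lerBlDl; apply: le_trans (_ : _ <= sup S) _.
  by apply: ub_le_sup; [case: hS|exists N'].
by rewrite -lerBlDr ltW.
Qed.

Section Mero.
Variables (R : realType) (V : vectType R[i]).
Notation C := R[i].

(* Points of V are read in the coordinates given by [v2r]; neither analyticity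
   nor openness depends on the choice of coordinates. *)
Definition mero_pred : {pred V -> C} :=
  fun f => `[< meromorphic (f \o r2v) >].

Lemma mero_subring : subring_closed mero_pred.
Proof.
have mc := @complex_mono_cauchy R.
split=> [|f g /asboolP mf /asboolP mg|f g /asboolP mf /asboolP mg]; apply/asboolP.
- exact: (meromorphic_cst (1 : C)).
- exact: (meromorphicB mc mf mg).
- exact: (meromorphicM mc mf mg).
Qed.

HB.instance Definition _ :=
  GRing.isSubringClosed.Build (V -> C) mero_pred mero_subring.

Record merofun := Merofun { merofun_val :> V -> C; _ : merofun_val \in mero_pred }.
HB.instance Definition _ := [isSub for merofun_val].
HB.instance Definition _ := [Choice of merofun by <:].
HB.instance Definition _ := GRing.SubChoice_isSubComPzRing.Build (V -> C) mero_pred merofun mero_subring.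

Definition generic_zero : {pred merofun} :=
  fun f => `[< generically setT [set z | f (r2v z) = 0] >].

Fact merofun1_neq0 : (1 : merofun) != 0.
Proof.
apply/eqP => /(congr1 (fun f : merofun => f 0)).
by move/eqP; rewrite oner_eq0.
Qed.
HB.instance Definition _ := GRing.PzSemiRing_isNonZero.Build merofun merofun1_neq0.

Lemma generic_zero_ideal : idealr_closed generic_zero.
Proof.
split.
- by apply/asboolP; exact: genericallyT.
- by apply/negP => /asboolP/generically_ex[z] /eqP; rewrite oner_eq0.
- move=> a f g /asboolP gf /asboolP gg; apply/asboolP.
  apply: genericallyTI gf gg _ => z /= fz gz.
  change (a (r2v z) * f (r2v z) + g (r2v z) = 0).
  by rewrite fz gz mulr0 addr0.
Qed.
HB.instance Definition _ := isIdealr.Build merofun generic_zero generic_zero_ideal.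

(* The meromorphic functions on V: two representatives are identified when they
   agree on a dense open set. *)
Definition mero := {ideal_quot generic_zero}.
HB.instance Definition _ := Quotient.on mero.
HB.instance Definition _ := GRing.ComNzRing.on mero.

Definition tomero (f : merofun) : mero := \pi_mero%qT f.

Lemma tomeroK (x : mero) : tomero (repr x) = x.
Proof. exact: reprK. Qed.

Lemma tomeroP (f g : merofun) :
  tomero f = tomero g <-> generically setT [set z | f (r2v z) = g (r2v z)].
Proof.
have -> : (tomero f = tomero g) <-> (f - g \in generic_zero).
  rewrite Quotient.idealrBE.
  by split=> /eqP.
split.
  by move=> /asboolP; apply: generically_mono => z /= /eqP; rewrite subr_eq0 => /eqP.
move=> gfg; apply/asboolP; apply: generically_mono gfg => z /= /eqP.
by rewrite -subr_eq0 => /eqP.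
Qed.

Lemma tomeroD f g : tomero (f + g) = tomero f + tomero g.
Proof. exact: (rmorphD (\pi_mero)%qT). Qed.
Lemma tomeroM f g : tomero (f * g) = tomero f * tomero g.
Proof. exact: (rmorphM (\pi_mero)%qT). Qed.
Lemma tomero1 : tomero 1 = 1.
Proof. exact: (rmorph1 (\pi_mero)%qT). Qed.

Fact merocst_subproof (c : C) : (fun=> c) \in mero_pred.
Proof. by apply/asboolP; exact: (meromorphic_cst (c : C)). Qed.
Definition merocst (c : C) : mero := tomero (Merofun (merocst_subproof c)).

Lemma merocstD : {morph merocst : c d / c + d >-> c + d}.
Proof. by move=> c d; rewrite -tomeroD; congr tomero; apply: val_inj. Qed.
Lemma merocstM : {morph merocst : c d / c * d >-> c * d}.
Proof. by move=> c d; rewrite -tomeroM; congr tomero; apply: val_inj. Qed.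
Lemma merocst1 : merocst 1 = 1.
Proof. by rewrite -tomero1; congr tomero; apply: val_inj. Qed.

Fact mero_scaleA c d (x : mero) :
  merocst c * (merocst d * x) = merocst (c * d) * x.
Proof. by rewrite merocstM mulrA. Qed.
Fact mero_scale1 (x : mero) : merocst 1 * x = x.
Proof. by rewrite merocst1 mul1r. Qed.
Fact mero_scaleDr c (x y : mero) :
  merocst c * (x + y) = merocst c * x + merocst c * y.
Proof. exact: mulrDr. Qed.
Fact mero_scaleDl (x : mero) c d :
  merocst (c + d) * x = merocst c * x + merocst d * x.
Proof. by rewrite merocstD mulrDl. Qed.
HB.instance Definition _ := GRing.Zmodule_isLmodule.Build C mero
  mero_scaleA mero_scale1 mero_scaleDr mero_scaleDl.
Fact mero_scaleAl (c : C) (x y : mero) : c *: (x * y) = c *: x * y.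
Proof. exact: mulrA. Qed.
HB.instance Definition _ := GRing.Lmodule_isLalgebra.Build C mero mero_scaleAl.
Fact mero_scaleAr (c : C) (x y : mero) : c *: (x * y) = x * (c *: y).
Proof. exact: mulrCA. Qed.
HB.instance Definition _ := GRing.Lalgebra_isAlgebra.Build C mero mero_scaleAr.

Fact merofun_shift_subproof (al : V) (f : merofun) :
  (fun x => f (x + al)) \in mero_pred.
Proof.
apply/asboolP; have /asboolP mf := valP f.
rewrite [X in meromorphic X](_ : _ = fun z => (f \o r2v) (z + v2r al)).
  exact: meromorphic_shift.
by apply/funext => z /=; rewrite linearD /= v2rK.
Qed.
Definition merofun_shift al f : merofun := Merofun (merofun_shift_subproof al f).

(* (T_al f)(x) = f (x + al) *)
Definition shift (al : V) (f : mero) : mero := tomero (merofun_shift al (repr f)).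

Lemma shift_tomero al f : shift al (tomero f) = tomero (merofun_shift al f).
Proof.
apply/tomeroP => /=; have /tomeroP := tomeroK (tomero f).
move=> /(generically_shift (v2r al)); apply: generically_mono => z /=.
by rewrite linearD /= v2rK.
Qed.

Lemma shiftD al : {morph shift al : f g / f + g}.
Proof.
move=> f g; rewrite -(tomeroK f) -(tomeroK g) -tomeroD !shift_tomero -tomeroD.
by congr tomero; apply: val_inj.
Qed.
Lemma shiftM al : {morph shift al : f g / f * g}.
Proof.
move=> f g; rewrite -(tomeroK f) -(tomeroK g) -tomeroM !shift_tomero -tomeroM.
by congr tomero; apply: val_inj.
Qed.
Lemma shiftZ al c f : shift al (c *: f) = c *: shift al f.
Proof.
rewrite [LHS]shiftM; congr (_ * _); rewrite shift_tomero.
by congr tomero; apply: val_inj.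
Qed.
Lemma shift_shift al be f : shift al (shift be f) = shift (al + be) f.
Proof.
rewrite -(tomeroK f) !shift_tomero.
by congr tomero; apply: val_inj; apply/funext => x /=; rewrite addrA.
Qed.
Lemma shift0 f : shift 0 f = f.
Proof.
rewrite -{2}(tomeroK f).
by congr tomero; apply: val_inj; apply/funext => x /=; rewrite addr0.
Qed.

End Mero.

Section Span.
Variables (K : nzRingType) (U : lmodType K) (S : set U).

Definition spanned (u : U) : Prop :=
  exists s : seq (K * U),
    (forall p, p \in s -> S p.2) /\ u = \sum_(p <- s) p.1 *: p.2.

Definition lspan : {pred U} := fun u => `[< spanned u >].

Lemma lspan_submod : submod_closed lspan.
Proof.
split; first by apply/asboolP; exists [::]; split; [move=> p; rewrite in_nil|rewrite big_nil].
move=> c u v /asboolP[s [sS ->]] /asboolP[t [tS ->]]; apply/asboolP.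
exists ([seq (c * p.1, p.2) | p <- s] ++ t); split.
  move=> p; rewrite mem_cat => /orP[/mapP[q qs ->]|]; [exact: (sS q)|exact: tS].
rewrite big_cat big_map scaler_sumr; congr (_ + _).
by apply: eq_bigr => p _; rewrite scalerA.
Qed.
HB.instance Definition _ := GRing.isSubmodClosed.Build K U lspan lspan_submod.

(* The quotient of U by the submodule spanned by S. *)
Definition quotmod := @Quotient.quot U lspan.
HB.instance Definition _ := Quotient.on quotmod.
HB.instance Definition _ := GRing.Zmodule.on quotmod.

Definition toquot (u : U) : quotmod := \pi_quotmod%qT u.

Lemma toquotP u v : toquot u = toquot v <-> spanned (u - v).
Proof.
have -> : spanned (u - v) <-> (u - v \in lspan) by split => [/asboolP|/asboolP].
by rewrite Quotient.idealrBE; split=> /eqP.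
Qed.

Lemma toquotK (x : quotmod) : toquot (repr x) = x.
Proof. exact: reprK. Qed.

Lemma toquotD u v : toquot (u + v) = toquot u + toquot v.
Proof. exact: (raddfD (\pi_quotmod)%qT). Qed.

Definition quotscale c (x : quotmod) : quotmod := toquot (c *: repr x).

Lemma quotscaleE c u : quotscale c (toquot u) = toquot (c *: u).
Proof.
apply/toquotP; rewrite -scalerBr; apply/asboolP.
have /asboolP h : `[< spanned (repr (toquot u) - u) >].
  by apply/asboolP/toquotP; rewrite toquotK.
by apply: (@rpredZ _ _ lspan); apply/asboolP.
Qed.

Fact quotscaleA c d x : quotscale c (quotscale d x) = quotscale (c * d) x.
Proof. by rewrite -(toquotK x) !quotscaleE scalerA. Qed.
Fact quotscale1 x : quotscale 1 x = x.
Proof. by rewrite -{1}(toquotK x) quotscaleE scale1r toquotK. Qed.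
Fact quotscaleDr : right_distributive quotscale +%R.
Proof.
move=> c x y; rewrite -(toquotK x) -(toquotK y) -toquotD !quotscaleE.
by rewrite -toquotD scalerDr.
Qed.
Fact quotscaleDl x : {morph quotscale^~ x : c d / c + d}.
Proof. by move=> c d; rewrite /= -(toquotK x) !quotscaleE -toquotD scalerDl. Qed.
HB.instance Definition _ := GRing.Zmodule_isLmodule.Build K quotmod
  quotscaleA quotscale1 quotscaleDr quotscaleDl.

Lemma toquot_is_linear : linear toquot.
Proof. by move=> c u v; rewrite toquotD -quotscaleE. Qed.

End Span.

Section DiffOp.
Variables (R : realType) (V : vectType R[i]).
Notation C := R[i].
Notation M := (mero V).
Implicit Types (s t : seq (M * V)).

(* The difference operator sum_i f_i T_{be_i}. *)
Definition opsum s : M -> M := fun g => \sum_(p <- s) p.1 * shift p.2 g.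

Definition diffop_pred : {pred M -> M} := fun d => `[< exists s, d = opsum s >].

Lemma opsum_diffop s : opsum s \in diffop_pred.
Proof. by apply/asboolP; exists s. Qed.

Lemma diffop_submod : submod_closed diffop_pred.
Proof.
split.
  by apply/asboolP; exists [::]; apply/funext => g; rewrite /opsum big_nil.
move=> c u v /asboolP[s ->] /asboolP[t ->]; apply/asboolP.
exists ([seq (c *: p.1, p.2) | p <- s] ++ t); apply/funext => g.
rewrite /opsum big_cat big_map; congr (_ + _).
rewrite [LHS]scaler_sumr; apply: eq_bigr => p _.
by rewrite scalerAl.
Qed.
HB.instance Definition _ :=
  GRing.isSubmodClosed.Build C (M -> M) diffop_pred diffop_submod.

Lemma diffop_comp (d e : M -> M) :
  d \in diffop_pred -> e \in diffop_pred -> d \o e \in diffop_pred.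
Proof.
move=> /asboolP[s ->] /asboolP[t ->]; apply/asboolP.
exists [seq (p.1 * shift p.2 q.1, p.2 + q.2) | p <- s, q <- t].
apply/funext => g; rewrite /opsum /= big_allpairs_dep; apply: eq_bigr => p _.
have h0 : shift p.2 0 = 0 :> M.
  by apply: (addIr (shift p.2 0)); rewrite -shiftD !add0r.
rewrite (big_morph _ (shiftD p.2) h0) mulr_sumr; apply: eq_bigr => q _ /=.
by rewrite shiftM shift_shift mulrA.
Qed.

Record diffop := Diffop { dfun :> M -> M; _ : dfun \in diffop_pred }.
HB.instance Definition _ := [isSub for dfun].
HB.instance Definition _ := [Choice of diffop by <:].
HB.instance Definition _ := [SubChoice_isSubLmodule of diffop by <:].

Definition dsum s : diffop := Diffop (opsum_diffop s).
Definition dcomp (d e : diffop) : diffop := Diffop (diffop_comp (valP d) (valP e)).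
Definition dop (f : M) (be : V) : diffop := dsum [:: (f, be)].

(* S (sum_i f_i T_{be_i}) = sum_i (T_{- be_i} f_i) T_{- be_i}; the operators T_be
   are linearly independent over M, so that the set below is a singleton. *)
Definition antipodeD (d : diffop) : diffop :=
  xget 0 [set e | exists s, d = dsum s /\
                  e = dsum [seq (shift (- p.2) p.1, - p.2) | p <- s]].

End DiffOp.

Section Prealgebra.
Variables (R : realType) (V : vectType R[i]).
Notation C := R[i].
Notation M := (mero V).

(* The data of an h-prealgebra: [hdeg al be] is the homogeneous component
   A_{al be}; [hml] and [hmr] are the left and right moment maps. *)
Record hpre := Hpre {
  hpre_car :> lmodType C;
  hdeg : V -> V -> set hpre_car;
  hml : M -> hpre_car -> hpre_car;
  hmr : M -> hpre_car -> hpre_car }.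

Record is_action (T : lmodType C) (mu : M -> T -> T) : Prop := IsAction {
  action_linear : forall f, linear (mu f);
  action_add : forall f g a, mu (f + g) a = mu f a + mu g a;
  action_mul : forall f g a, mu (f * g) a = mu f (mu g a);
  action_cst : forall (c : C) a, mu c%:A a = c *: a }.

Record is_hprealgebra (A : hpre) : Prop := IsHPrealgebra {
  hdeg0 : forall al be, @hdeg A al be 0;
  hdeg_lin : forall al be (c : C) (a b : A),
    hdeg al be a -> hdeg al be b -> hdeg al be (c *: a + b);
  hdeg_sum : forall a : A, exists s : seq (V * V * A),
    (forall t, t \in s -> hdeg t.1.1 t.1.2 t.2) /\ a = \sum_(t <- s) t.2;
  hdeg_direct : forall (F : V * V -> A) (s : seq (V * V)), uniq s ->
    (forall i, hdeg i.1 i.2 (F i)) -> \sum_(i <- s) F i = 0 ->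
    forall i, i \in s -> F i = 0;
  hml_action : is_action (@hml A);
  hmr_action : is_action (@hmr A);
  hml_deg : forall f al be (a : A), hdeg al be a -> hdeg al be (hml f a);
  hmr_deg : forall f al be (a : A), hdeg al be a -> hdeg al be (hmr f a);
  hmlr_comm : forall f g (a : A), hml f (hmr g a) = hmr g (hml f a) }.

Record is_prehom (A B : hpre) (phi : A -> B) : Prop := IsPrehom {
  prehom_linear : linear phi;
  prehom_ml : forall f a, phi (hml f a) = hml f (phi a);
  prehom_mr : forall f a, phi (hmr f a) = hmr f (phi a);
  prehom_deg : forall al be a, hdeg al be a -> hdeg al be (phi a) }.

(* The component D_{al be} is {f T_{- be}} if al = be and 0 otherwise. *)
Definition Dh : hpre := @Hpre (diffop V)
  (fun al be d => d = 0 \/ (al = be /\ exists f, d = dop f (- be)))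
  (fun f d => dcomp (dop f 0) d) (fun f d => dcomp (dop f 0) d).

End Prealgebra.

Arguments hdeg {R V h} al be a.
Arguments hml {R V h} f a.
Arguments hmr {R V h} f a.

Section MatrixTensor.
Variables (R : realType) (V : vectType R[i]).
Notation C := R[i].
Notation M := (mero V).

Section Def.
Variables A B : hpre V.

(* The symbol (al, ga, be, a, b) stands for the tensor of a in A_{al ga} and
   b in B_{ga be}; it is discarded when a and b do not have these bidegrees. *)
Let key : choiceType := (V * V * V * A * B)%type.

Definition mtensor_ok (g : key) : Prop :=
  let: (al, ga, be, a, b) := g in hdeg al ga a /\ hdeg ga be b.

Inductive mtensor_rel : {freeg key / C} -> Prop :=
| mtensor_junk g : ~ mtensor_ok g -> mtensor_rel << g >>
| mtensor_addl al ga be a a' b :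
    hdeg al ga a -> hdeg al ga a' -> hdeg ga be b ->
    mtensor_rel (<< (al, ga, be, a + a', b) >>
                 - << (al, ga, be, a, b) >> - << (al, ga, be, a', b) >>)
| mtensor_addr al ga be a b b' :
    hdeg al ga a -> hdeg ga be b -> hdeg ga be b' ->
    mtensor_rel (<< (al, ga, be, a, b + b') >>
                 - << (al, ga, be, a, b) >> - << (al, ga, be, a, b') >>)
| mtensor_scalel c al ga be a b : hdeg al ga a -> hdeg ga be b ->
    mtensor_rel (<< (al, ga, be, c *: a, b) >> - c *: << (al, ga, be, a, b) >>)
| mtensor_scaler c al ga be a b : hdeg al ga a -> hdeg ga be b ->
    mtensor_rel (<< (al, ga, be, a, c *: b) >> - c *: << (al, ga, be, a, b) >>)
| mtensor_bal f al ga be a b : hdeg al ga a -> hdeg ga be b ->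
    mtensor_rel (<< (al, ga, be, hmr f a, b) >> - << (al, ga, be, a, hml f b) >>).

Definition mtensor : lmodType C := quotmod mtensor_rel.

Definition mtens al ga be a b : mtensor :=
  toquot mtensor_rel << (al, ga, be, a, b) >>.

(* The linear map on the tensor product given by F on homogeneous tensors;
   meaningful when F respects the defining relations. *)
Definition mtlift (Z : lmodType C) (F : V -> V -> V -> A -> B -> Z) (x : mtensor) : Z :=
  fglift (fun g : key => let: (al, ga, be, a, b) := g in
    if `[< mtensor_ok g >] then F al ga be a b else 0) (repr x).

End Def.

Definition tpre (A B : hpre V) : hpre V := @Hpre R V (mtensor A B)
  (fun al be x => exists s : seq (V * A * B),
     (forall t, t \in s -> hdeg al t.1.1 t.1.2 /\ hdeg t.1.1 be t.2) /\
     x = \sum_(t <- s) mtens al t.1.1 be t.1.2 t.2)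
  (fun f => mtlift (fun al ga be a b => mtens al ga be (hml f a) b))
  (fun f => mtlift (fun al ga be a b => mtens al ga be a (hmr f b))).

Definition tmap (A A' B B' : hpre V) (phi : A -> A') (psi : B -> B') :
    mtensor A B -> mtensor A' B' :=
  mtlift (fun al ga be a b => mtens al ga be (phi a) (psi b)).

Definition tassoc (A B E : hpre V) :
    mtensor (tpre A B) E -> mtensor A (tpre B E) :=
  mtlift (fun al ga be (x : tpre A B) e => mtlift (fun al' de ga' a b =>
    mtens al' de be a (mtens de ga' be b e : tpre B E)) x).

End MatrixTensor.

Section HopfAlgebroid.
Variables (R : realType) (V : vectType R[i]).
Notation C := R[i].
Notation M := (mero V).

Record hcoalg := Hcoalg {
  hcoalg_pre :> hpre V;
  hDelta : hcoalg_pre -> tpre hcoalg_pre hcoalg_pre;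
  heps : hcoalg_pre -> Dh V }.

Record is_hcoalgebroid (A : hcoalg) : Prop := IsHCoalgebroid {
  hcoalg_prealg : is_hprealgebra A;
  hDelta_hom : is_prehom (@hDelta A);
  heps_hom : is_prehom (@heps A);
  hDelta_coassoc : forall a : A,
    tassoc (tmap (@hDelta A) id (hDelta a)) = tmap id (@hDelta A) (hDelta a);
  heps_counitl : forall al be (a : A), hdeg al be a ->
    tmap (@heps A) id (hDelta a) = mtens al al be (dop 1 (- al) : Dh V) a;
  heps_counitr : forall al be (a : A), hdeg al be a ->
    tmap id (@heps A) (hDelta a) = mtens al be be a (dop 1 (- be) : Dh V) }.

Record halg := Halg {
  halg_car :> algType C;
  halg_deg : V -> V -> set halg_car;
  halg_ml : M -> halg_car -> halg_car;
  halg_mr : M -> halg_car -> halg_car }.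

Arguments halg_deg {h} al be a.
Arguments halg_ml {h} f a.
Arguments halg_mr {h} f a.

Definition halg_pre (A : halg) : hpre V :=
  Hpre (@halg_deg A) (@halg_ml A) (@halg_mr A).
Coercion halg_pre : halg >-> hpre.

(* In an h-algebra [halg_ml f 1] and [halg_mr f 1] are the elements mu_l(f)
   and mu_r(f). *)
Record is_halgebra (A : halg) : Prop := IsHAlgebra {
  halg_prealg : is_hprealgebra A;
  halg_deg1 : @halg_deg A 0 0 1;
  halg_degM : forall al be ga de (a b : A), halg_deg al be a ->
    halg_deg ga de b -> halg_deg (al + ga) (be + de) (a * b);
  halg_mlE : forall f (a : A), halg_ml f a = halg_ml f 1 * a;
  halg_mrE : forall f (a : A), halg_mr f a = halg_mr f 1 * a;
  halg_ml_inj : injective (fun f => @halg_ml A f 1);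
  halg_mr_inj : injective (fun f => @halg_mr A f 1);
  halg_mlr : forall f al be (a : A), halg_deg al be a ->
    halg_ml f a = a * halg_ml (shift al f) 1;
  halg_mrr : forall f al be (a : A), halg_deg al be a ->
    halg_mr f a = a * halg_mr (shift be f) 1 }.

Definition tmul (A B : halg) (x y : mtensor A B) : mtensor A B :=
  @mtlift R V A B _ (fun al ga be (a : A) (b : B) =>
    @mtlift R V A B _ (fun al' ga' be' (c : A) (d : B) =>
      @mtens R V A B (al + al') (ga + ga') (be + be') (a * c) (b * d)) y) x.

Record hbialg := Hbialg {
  hbialg_alg :> halg;
  hbialg_Delta : hbialg_alg -> tpre hbialg_alg hbialg_alg;
  hbialg_eps : hbialg_alg -> Dh V }.

Definition hbialg_coalg (A : hbialg) : hcoalg :=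
  @Hcoalg A (@hbialg_Delta A) (@hbialg_eps A).
Coercion hbialg_coalg : hbialg >-> hcoalg.

Record is_hbialgebroid (A : hbialg) : Prop := IsHBialgebroid {
  hbialg_halg : is_halgebra A;
  hbialg_hcoalg : is_hcoalgebroid A;
  hbialg_DeltaM : forall a b : A,
    hbialg_Delta (a * b) = tmul (hbialg_Delta a) (hbialg_Delta b);
  hbialg_Delta1 : hbialg_Delta (1 : A) = @mtens R V A A 0 0 0 1 1;
  hbialg_epsM : forall a b : A,
    hbialg_eps (a * b) = dcomp (hbialg_eps a) (hbialg_eps b);
  hbialg_eps1 : hbialg_eps (1 : A) = dop 1 0 }.

Record is_antipode (A : hbialg) (S : A -> A) : Prop := IsAntipode {
  antipode_linear : linear S;
  antipode_mr : forall f a, S (halg_mr f a) = S a * halg_ml f 1;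
  antipode_ml : forall f a, S (a * halg_ml f 1) = halg_mr f (S a);
  antipode_r : forall a : A,
    @mtlift R V A A A (fun _ _ _ (x y : A) => x * S y) (hbialg_Delta a)
    = halg_ml ((hbialg_eps a : diffop V) 1) 1;
  antipode_l : forall al be (a : A), halg_deg al be a ->
    @mtlift R V A A A (fun _ _ _ (x y : A) => S x * y) (hbialg_Delta a)
    = halg_mr (shift al ((hbialg_eps a : diffop V) 1)) 1 }.

Record is_hHopf_algebroid (A : hbialg) (S : A -> A) : Prop := IsHHopf {
  hHopf_bialg : is_hbialgebroid A;
  hHopf_antipode : is_antipode S }.

End HopfAlgebroid.

Section HatTensor.
Variables (R : realType) (V : vectType R[i]) (A B : hpre V).
Notation C := R[i].

Let key : choiceType := (A * B)%type.

(* For a in A_{al be} the right actions are a mu_l(f) = mu_l(T_{-al} f) a and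
   a mu_r(f) = mu_r(T_{-be} f) a. *)
Inductive htensor_rel : {freeg key / C} -> Prop :=
| htensor_addl a a' b :
    htensor_rel (<< (a + a', b) >> - << (a, b) >> - << (a', b) >>)
| htensor_addr a b b' :
    htensor_rel (<< (a, b + b') >> - << (a, b) >> - << (a, b') >>)
| htensor_scalel c a b : htensor_rel (<< (c *: a, b) >> - c *: << (a, b) >>)
| htensor_scaler c a b : htensor_rel (<< (a, c *: b) >> - c *: << (a, b) >>)
| htensor_ball f al be a b : hdeg al be a ->
    htensor_rel (<< (hml (shift (- al) f) a, b) >> - << (a, hml f b) >>)
| htensor_balr f al be a b : hdeg al be a ->
    htensor_rel (<< (hmr (shift (- be) f) a, b) >> - << (a, hmr f b) >>).

Definition htensor : lmodType C := quotmod htensor_rel.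

Definition htlift (Z : lmodType C) (F : A -> B -> Z) (x : htensor) : Z :=
  fglift (fun g : key => F g.1 g.2) (repr x).

End HatTensor.

Section Dual.
Variables (R : realType) (V : vectType R[i]).
Notation C := R[i].
Notation M := (mero V).

Section DualAlgebra.
Variable A : hcoalg V.
Implicit Types phi psi : A -> diffop V.

Record dual_deg (al be : V) phi : Prop := DualDeg {
  dual_linear : linear phi;
  dual_ml : forall f a, phi (hml f a) = dcomp (dop f 0) (phi a);
  dual_mr : forall f ga de a, hdeg ga de a ->
    phi (hmr (shift (- de) f) a) = dcomp (phi a) (dop f 0);
  dual_degP : forall ga de a, hdeg ga de a ->
    hdeg (ga + be) (de + al) (phi a : Dh V) }.

Definition dual_mul phi psi : A -> diffop V := fun a =>
  mtlift (fun al ga be x y => dcomp (dcomp (phi x) (dop 1 ga)) (psi y)) (hDelta a).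

(* The elements mu_l(f) and mu_r(f) of A'. *)
Definition dual_muml f : A -> diffop V := fun a => dcomp (dop f 0) (heps a).
Definition dual_mumr f : A -> diffop V := fun a => dcomp (heps a) (dop f 0).

(* A' sits inside all functions A -> D_h as the (direct) sum of the components
   [dual_deg al be]; tensor products only involve homogeneous elements, so that
   the ambient space may serve as carrier. *)
Definition dual_pre : hpre V := @Hpre R V (A -> diffop V) dual_deg
  (fun f => dual_mul (dual_muml f)) (fun f => dual_mul (dual_mumr f)).

Definition in_dual phi : Prop := exists s : seq (V * V * (A -> diffop V)),
  (forall t, t \in s -> dual_deg t.1.1 t.1.2 t.2) /\ phi = \sum_(t <- s) t.2.

Definition iota (x : mtensor dual_pre dual_pre) : htensor A A -> diffop V :=
  mtlift (fun al be ga (phi psi : dual_pre) =>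
    htlift (fun a b => dcomp (dcomp (phi a) (dop 1 be)) (psi b))) x.

End DualAlgebra.

Section DualBialgebroid.
Variable A : hbialg V.

(* iota and mdual take values in (A \hat\otimes A)', which is a space of functions
   on A \hat\otimes A. *)
Definition mdual (phi : A -> diffop V) : htensor A A -> diffop V :=
  @htlift R V A A _ (fun x y : A => phi (x * y)).

Definition in_Astar (phi : A -> diffop V) : Prop :=
  @in_dual A phi /\
  exists x : mtensor (dual_pre A) (dual_pre A), iota x = mdual phi.

(* B is the dual h-bialgebroid A^* of A: j identifies its elements with those of
   A^*, and its coproduct is characterized by iota \o Delta = mdual. *)
Record is_dual (B : hbialg V) (j : B -> A -> diffop V) : Prop := IsDual {
  is_dual_linear : linear j;
  is_dual_inj : injective j;
  is_dual_range : range j = in_Astar;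
  is_dual_deg : forall al be (b : B), halg_deg al be b <-> @dual_deg A al be (j b);
  is_dual_1 : j 1 = @heps R V A;
  is_dual_M : forall b c, j (b * c) = @dual_mul A (j b) (j c);
  is_dual_ml : forall f b, j (halg_ml f b) = @dual_mul A (@dual_muml A f) (j b);
  is_dual_mr : forall f b, j (halg_mr f b) = @dual_mul A (@dual_mumr A f) (j b);
  is_dual_Delta : forall b : B,
    iota (@tmap R V B (dual_pre A) B (dual_pre A) j j (hbialg_Delta b))
    = mdual (j b);
  is_dual_eps : forall b : B, hbialg_eps b = j b 1 }.

End DualBialgebroid.
End Dual.

(* Main.v *)
(* Functionals on A are separated by their values, so that every identity in A^* and
   in its tensor powers can be checked by evaluation at homogeneous elements of A.
   This rests on two facts: M is a field, because a meromorphic function vanishing on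
   a nonempty open set vanishes identically (identity theorem along real segments),
   and difference operators with distinct shifts are independent over M.

   An element phi of A' lies in A^* iff phi(ab) = sum_t p_t(a) T q_t(b) for a finite
   family of p_t, q_t in A'. Solving for them over M, one may take for the p_t and q_t
   combinations of translates phi(- b) and phi(a -), which lie in A^* themselves;
   therefore the coproduct of A^* takes its values in the tensor square of A^*.

   By uniqueness of convolution inverses the antipode S of A maps A_{al be} to
   A_{-be,-al} and reverses products. Hence phi |-> S^D o phi o S preserves A^*,
   splitting it by sum_t S(q_t) (x) S(p_t), and since S^D(d) = T_b d T_a for d of
   bidegree (a, b), the antipode axioms of A^* evaluated at a reduce to those of A. *)

Require Import Defs.
From HB Require Import structures.
From mathcomp Require Import all_boot all_order all_algebra.
From mathcomp Require Import complex reals.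
From mathcomp Require Import all_classical topology normedtype sequences freeg.
From mathcomp Require Import ring lra.
Import Defs.

Set Implicit Arguments.
Unset Strict Implicit.
Unset Printing Implicit Defensive.

Import Order.TTheory GRing.Theory Num.Theory.
Import numFieldNormedType.Exports VectorInternalTheory.

Local Open Scope classical_set_scope.
Local Open Scope ring_scope.
Local Open Scope complex_scope.

(** * Meromorphic functions form a field *)

Section Taylor.
Variables (C : numFieldType) (n : nat).
Implicit Types (f : 'rV[C]_n -> C) (p z w : 'rV[C]_n).

(** The coproduct of A^* is known only through the equation [iota x = mdual phi] over the tensor
    square of A', while the Hopf axioms concern the tensor square of A^*. Two things have to be
    supplied: uniqueness of x, which turns each axiom into an identity between values, and a
    solution whose factors all lie in A^*. Both come from the elimination argument of [slice], which
    divides by a nonzero coefficient; this is why meromorphic functions must be inverted.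

    A tensor is a class of formal sums and [mtlift] reads it on a chosen representative, so a map
    must be shown to respect the relations before its value on a given tensor can be computed. The
    relations of the matrix tensor product involve homogeneous elements only and the moment maps act
    through shifts, so bidegrees accompany every computation.

    The antipode axioms say nothing about the bidegree of S a or about S(ab). Both rules must be
    derived before S^D o phi o S can be recognized as an element of A^*. *)

Definition mdeg (k : {ffun 'I_n -> nat}) : nat := \sum_i k i.

Lemma monom_const (r : C) k : monom (const_mx r : 'rV_n) k = r ^+ mdeg k.
Proof.
rewrite /monom /mdeg -prodrXr; apply: eq_bigr => i _; by rewrite mxE.
Qed.

Lemma monomZ (s : C) w k : monom (s *: w) k = s ^+ mdeg k * monom w k.
Proof.
rewrite -monom_const /monom -big_split; apply: eq_bigr => i _.
by rewrite !mxE exprMn.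
Qed.

Lemma mdeg_mindex N k : (mdeg k < N)%N -> k \in mindex n N.
Proof.
move=> kN; rewrite mem_mindex; apply/forallP => i; apply: leq_ltn_trans kN.
by rewrite /mdeg (bigD1 i) //= leq_addr.
Qed.

(** [P j] collects the monomials of total degree j. When all |w_i| <= t < r, a monomial of degree d
    > m is at most r^d (t/r)^d <= r^d (t/r)^(m+1), and the sums of |a_k| r^d are bounded by B. *)
Lemma taylor f p : analytic_at f p ->
  exists (P : nat -> 'rV[C]_n -> C) (r B : C),
    [/\ 0 < r, 0 <= B, forall j s w, P j (s *: w) = s ^+ j * P j w &
        forall m w (t : C), 0 <= t -> t < r -> (forall i, `|w 0 i| <= t) ->
          `|f (p + w) - \sum_(j < m.+1) P j w| <= B * (t / r) ^+ m.+1].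
Proof.
move=> [a [r [B [r0 aB ac]]]].
(* The cube of side j+1 contains every multi-index of degree j, so larger cubes give the same
   sum. *)
pose P j w := \sum_(k <- mindex n j.+1 | mdeg k == j) a k * monom w k.
have PE j w N : (j < N)%N ->
    P j w = \sum_(k <- mindex n N | mdeg k == j) a k * monom w k.
  move=> jN; rewrite /P [RHS]big_mkcond [LHS]big_mkcond.
  rewrite (big_usub (mindex_uniq _ j.+1) (mindex_uniq _ N)) //.
    exact: mindexS.
  by move=> k _ kj; case: eqP => // kj'; rewrite mdeg_mindex ?kj' // in kj.
exists P, r, B; split => //.
- by apply: le_trans (aB 0%N); apply: sumr_ge0 => k _; rewrite mulr_ge0 ?monom_ge0 // ltW.
- move=> j s w; rewrite /P mulr_sumr; apply: eq_bigr => k /eqP kj.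
  by rewrite monomZ kj mulrCA.
move=> m w t t0 tr wt.
have tr1 : t / r <= 1 by rewrite ler_pdivrMr // mul1r ltW.
have tr0 : 0 <= t / r by rewrite divr_ge0 // ltW.
have est N : (m < N)%N -> `|\sum_(k <- mindex n N) a k * monom w k
    - \sum_(j < m.+1) P j w| <= B * (t / r) ^+ m.+1.
  move=> mN.
  have -> : \sum_(j < m.+1) P j w =
      \sum_(k <- mindex n N | (mdeg k < m.+1)%N) a k * monom w k.
    rewrite (eq_bigr (fun j : 'I_m.+1 => \sum_(k <- mindex n N)
        if mdeg k == j then a k * monom w k else 0)); last first.
      by move=> j _; rewrite (PE j w N) ?big_mkcond // (leq_trans (ltn_ord j)).
    rewrite exchange_big [RHS]big_mkcond; apply: eq_bigr => k _ /=.
    case: ltnP => km.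
      rewrite (bigD1 (Ordinal km)) //= eqxx big1 ?addr0 // => i ik.
      by case: eqP => // e; case/eqP: ik; apply: val_inj.
    by rewrite big1 // => i _; case: eqP => // e; move: (ltn_ord i); rewrite -e ltnNge km.
  rewrite [X in X - _](bigID (fun k => mdeg k < m.+1)%N) /= addrAC subrr add0r.
  apply: (@le_trans _ _ (\sum_(k <- mindex n N) `|a k| * monom (const_mx r : 'rV_n) k * (t / r) ^+ m.+1)); last first.
    by rewrite -mulr_suml ler_wpM2r ?exprn_ge0.
  rewrite (le_trans (ler_norm_sum _ _ _)) //.
  rewrite [leLHS]big_mkcond; apply: ler_sum => k _; case: ifP; last first.
    by move=> _; rewrite !mulr_ge0 ?exprn_ge0 // monom_ge0 ?ltW.
  rewrite -leqNgt => mk; rewrite normrM -mulrA ler_wpM2l //.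
  rewrite (le_trans (monom_le k wt)) // !monom_const.
  rewrite (_ : t = r * (t / r)); last by rewrite mulrC divfK // gt_eqF.
  rewrite exprMn ler_wpM2l ?exprn_ge0 ?(ltW r0) //.
  rewrite [r * _]mulrC divfK ?gt_eqF //.
  exact: ler_wiXn2l.
(* The estimate is uniform in N; a partial sum within e of the limit transfers it to f. *)
apply/ler_addgt0Pr => e e0.
have wr i : `|(p + w) 0 i - p 0 i| < r.
  by rewrite mxE addrAC subrr add0r; apply: le_lt_trans (wt i) tr.
have /cvgrPdist_le/(_ _ e0)[N0 _ hN0] := ac _ wr.
pose N := maxn N0 m.+1.
have := hN0 N (leq_maxl _ _); rewrite /= (_ : p + w - p = w); last by rewrite addrAC subrr add0r.
have := est N (leq_maxr _ _); set S := \sum_(k <- _) _ => h1 h2.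
rewrite -(subrKA S) addrC.
exact: le_trans (ler_normD _ _) (lerD h1 h2).
Qed.

(** The series has the two terms p_i and (z - p)_i. Coordinates serve below to tell translations
    apart. *)
Lemma analytic_coord i p : analytic_at (fun z => z 0 i) p.
Proof.
pose k0 : {ffun 'I_n -> nat} := [ffun=> 0%N].
pose k1 : {ffun 'I_n -> nat} := [ffun l => (l == i) : nat].
have k10 : k1 != k0 by apply/eqP => /ffunP/(_ i); rewrite !ffunE eqxx.
exists (fun k => if k == k0 then p 0 i else if k == k1 then 1 else 0).
have m0 z : monom z k0 = 1.
  by rewrite /monom big1 // => l _; rewrite ffunE expr0.
have m1 z : monom z k1 = z 0 i.
  rewrite /monom (bigD1 i) //= ffunE eqxx expr1 big1 ?mulr1 // => l /negPf li.
  by rewrite ffunE li.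
exists 1, (`|p 0 i| + 1).
have kin N : (1 < N)%N -> {subset [:: k0; k1] <= mindex n N}.
  move=> N1 k; rewrite !inE mem_mindex => /orP[]/eqP ->; apply/forallP => l; rewrite ffunE.
    exact: ltnW.
  by case: eqP => // _; apply: ltnW.
have u01 : uniq [:: k0; k1] by rewrite /= inE eq_sym k10.
split => // [N|z _].
  apply: (@le_trans _ _ (\sum_(k <- [:: k0; k1])
    `|if k == k0 then p 0 i else if k == k1 then 1 else 0| * monom (const_mx 1 : 'rV_n) k)).
    (* A cube of side N < 2 may miss one of the two indices, so the sum is bounded by the one over a
       cube of side at least 2. *)
    have le : (N <= maxn N 2)%N by exact: leq_maxl.
    have := big_usub u01 (mindex_uniq n (maxn N 2)) (kin _ (leq_maxr _ _)).
    move=> /(_ _ (fun k => `|if k == k0 then p 0 i else if k == k1 then 1 else 0| * monom (const_mx 1 : 'rV_n) k)) <-; last first.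
      move=> k _; rewrite !inE => /norP[/negPf -> /negPf ->]; by rewrite normr0 mul0r.
    rewrite [leRHS](bigID (mem (mindex n N))) /= -[leLHS]addr0; apply: lerD.
      rewrite -[leRHS]big_filter le_eqVlt; apply/orP; left; apply/eqP.
      apply: perm_big; apply: uniq_perm; rewrite ?filter_uniq ?mindex_uniq // => k.
      by rewrite mem_filter; case kN: (k \in mindex n N) => //=; rewrite (mindexS le kN).
    by apply: sumr_ge0 => k _; rewrite mulr_ge0 ?monom_ge0.
  by rewrite !big_cons big_nil eqxx (negPf k10) eqxx m0 m1 mxE normr1 !mulr1 addr0.
apply: cvg_near_cst; exists 2%N => // N /= N2.
rewrite (big_usub u01 (mindex_uniq n N) (kin _ N2)).
  rewrite !big_cons big_nil eqxx (negPf k10) eqxx m0 m1 !mxE addr0 mulr1 mul1r.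
  by rewrite addrC subrK.
by move=> k _; rewrite !inE => /norP[/negPf -> /negPf ->]; rewrite mul0r.
Qed.

End Taylor.

(** * Zeros along a real segment *)

Section RealSegment.
Variable R : realType.

(** Let s be the supremum of the t such that Q holds on [0, t). Then Q holds on [0, s), and the step
    at s pushes Q beyond s, which contradicts the choice of s unless 1 is already covered. *)
Lemma real_induction (Q : R -> Prop) (e : R) : 0 < e ->
  (forall u, 0 <= u -> u < e -> Q u) ->
  (forall t, e <= t -> t <= 1 -> (forall u, 0 <= u -> u < t -> Q u) ->
    exists2 d, 0 < d & forall u, t <= u -> u < t + d -> Q u) ->
  forall u, 0 <= u -> u <= 1 -> Q u.
Proof.
move=> e0 Qe step u u0 u1.
have [e1|e1] := ltP 1 e; first by apply: Qe => //; apply: le_lt_trans e1.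
pose T := [set t : R | 0 <= t <= 1 /\ forall v, 0 <= v -> v < t -> Q v].
have Te : T e by split; [rewrite (ltW e0) e1|].
have hT : has_sup T by split; [exists e|exists 1 => t [/andP[]]].
have es : e <= sup T by apply: ub_le_sup => //; case: hT.
have s1 : sup T <= 1 by apply: ge_sup; [exists e|move=> t [/andP[]]].
have Qs v : 0 <= v -> v < sup T -> Q v.
  move=> v0 vs; have d0 : 0 < sup T - v by rewrite subr_gt0.
  have [t [_ Qt]] := sup_adherent d0 hT.
  by rewrite subKr; exact: Qt.
have [d d0 Qd] := step _ es s1 Qs.
have Qsd v : 0 <= v -> v < sup T + d -> Q v.
  by move=> v0 vd; have [vs|sv] := ltP v (sup T); [exact: Qs|exact: Qd].
have [h|h] := ltP 1 (sup T + d); first by apply: Qsd => //; apply: le_lt_trans h.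
have : T (sup T + d).
  by split=> //; rewrite h andbT addr_ge0 ?(ltW d0) // (le_trans (ltW e0)).
by move=> /(ub_le_sup hT.2); rewrite -subr_ge0 opprD addrA subrr sub0r oppr_ge0 leNgt d0.
Qed.

Lemma normC_Re (x : R[i]) : `|x| = (complex.Re `|x|)%:C.
Proof. by rewrite RRe_real ?normr_real. Qed.

Lemma Re_norm_ge0 (x : R[i]) : 0 <= complex.Re `|x|.
Proof. by rewrite -lecR -normC_Re; exact: normr_ge0. Qed.

Lemma normC_real (s : R) : `|s%:C| = `|s|%:C.
Proof. by rewrite normc_def /= expr0n addr0 sqrtr_sqr. Qed.

(** What analyticity leaves on a real line: Taylor polynomials of all orders with a geometric
    remainder, the coefficients being common to all orders. The identity theorem uses nothing
    more. *)
Definition expands (phi : R -> R[i]) t := exists (c : nat -> R[i]) (d K : R),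
  [/\ 0 < d, 0 <= K & forall m s, `|s| < d ->
    `|phi (t + s) - \sum_(j < m.+1) c j * s%:C ^+ j| <= (K * (`|s| / d) ^+ m.+1)%:C].

(** If the coefficients below m vanish, a zero of phi at t + s gives |c_m| |s|^m <= K (|s|/d)^(m+1),
    hence |c_m| = O(|s|) for s tending to 0 from below. Once all coefficients vanish, the remainder
    bounds tend to 0 on both sides of t. *)
Lemma expands_zero phi t d' : 0 < d' -> expands phi t ->
  (forall s, - d' < s -> s < 0 -> phi (t + s) = 0) ->
  exists2 d, 0 < d & forall s, `|s| < d -> phi (t + s) = 0.
Proof.
move=> d'0 [c [d [K [d0 K0 est]]]] phi0.
have c0 m : c m = 0.
  elim/ltn_ind: m => m IH; apply/eqP; rewrite -normr_eq0 eq_le normr_ge0 andbT.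
  rewrite normC_Re (lecR _ 0).
  apply/ler_addgt0Pr => e e0; rewrite add0r.
  pose L := K / d ^+ m.+1.
  have L0 : 0 <= L by rewrite divr_ge0 // exprn_ge0 // ltW.
  (* The first two bounds keep s in the range of the expansion and in that of the zeros; the third
     gives L |s| <= e, with L + 1 in place of L because L may be 0. *)
  pose s := - Num.min (Num.min (d / 2) (d' / 2)) (e / (L + 1)).
  have L1 : 0 < L + 1 by rewrite ltr_wpDl.
  have sN : s < 0 by rewrite oppr_lt0 !lt_min !divr_gt0.
  have sd : `|s| < d.
    rewrite ltr0_norm // opprK !gt_min; apply/orP; left; apply/orP; left.
    by rewrite ltr_pdivrMr // ltr_pMr // (ltr_nat R 1 2).
  have sd' : - d' < s.
    rewrite ltrN2 !gt_min; apply/orP; left; apply/orP; right.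
    by rewrite ltr_pdivrMr // ltr_pMr // (ltr_nat R 1 2).
  have := est m s sd; rewrite (phi0 s) // sub0r normrN.
  rewrite big_ord_recr /= big1 ?add0r => [|j _]; last by rewrite IH ?mul0r // ltn_ord.
  rewrite normrM normrX normC_real -rmorphXn /= normC_Re -rmorphM /= lecR.
  have s0 : 0 < `|s| by rewrite normr_gt0 lt_eqF.
  rewrite expr_div_n [`|s| ^+ m.+1]exprS.
  have -> : K * (`|s| * `|s| ^+ m / d ^+ m.+1) = L * `|s| * `|s| ^+ m by rewrite /L; ring.
  rewrite ler_pM2r ?exprn_gt0 // => h; apply: le_trans h _.
  have : `|s| <= e / (L + 1) by rewrite ltr0_norm // opprK ge_min lexx orbT.
  rewrite ler_pdivlMr // mulrDr mulr1 mulrC => h; apply: le_trans h.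
  by rewrite lerDl ltW.
exists d => // s sd; apply/eqP; rewrite -normr_eq0 eq_le normr_ge0 andbT.
rewrite normC_Re (lecR _ 0); apply/ler_addgt0Pr => e e0; rewrite add0r.
have q1 : `| `|s| / d| < 1.
  by rewrite ger0_norm ?divr_ge0 ?(ltW d0) // ltr_pdivrMr // mul1r.
have K1 : 0 < K + 1 by rewrite ltr_wpDl.
have /cvgrPdist_le/(_ _ (divr_gt0 e0 K1))[N _ hN] := cvg_expr q1.
have := est N s sd; rewrite big1 ?subr0 => [|j _]; last by rewrite c0 mul0r.
rewrite normC_Re lecR => h; apply: le_trans h _.
have := hN N.+1 (leqnSn N); rewrite /= sub0r normrN ger0_norm ?exprn_ge0 ?divr_ge0 ?(ltW d0) //.
rewrite ler_pdivlMr // mulrDr mulr1 mulrC => h; apply: le_trans h.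
by rewrite lerDl exprn_ge0 // divr_ge0 // ltW.
Qed.

Lemma segment_zero phi e : 0 < e -> (forall t, 0 <= t -> t <= 1 -> expands phi t) ->
  (forall u, 0 <= u -> u < e -> phi u = 0) -> phi 1 = 0.
Proof.
move=> e0 ex phi0; apply: (real_induction (Q := fun u => phi u = 0) e0 phi0) => // t et t1 zt.
have t0 : 0 < t := lt_le_trans e0 et.
have [|d d0 zd] := expands_zero t0 (ex t (ltW t0) t1).
  by move=> s ts s0; apply: zt; [rewrite -lerBlDl sub0r ltW|rewrite gtrDl].
exists d => // u tu ud; rewrite -(subrKC t u); apply: zd.
by rewrite ger0_norm ?subr_ge0 // ltrBlDl.
Qed.

End RealSegment.

(** * The identity theorem on balls *)

Section Field.
Variable R : realType.
Notation C := R[i].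

Lemma gt0_complex (x : C) : 0 < x -> exists2 r : R, 0 < r & x = r%:C.
Proof.
move=> x0; exists (complex.Re x); last by rewrite RRe_real // gtr0_real.
by rewrite -ltcR RRe_real // gtr0_real.
Qed.

Section Coord.
Variable n : nat.
Let CF : numFieldType := C.
Implicit Types (g h : 'rV[CF]_n -> C) (p z w v : 'rV[CF]_n).

Lemma rV_bound v : exists2 L : R, 0 < L & forall i, `|v 0 i| <= L%:C.
Proof.
exists (1 + \sum_i complex.Re `|v 0 i|).
  by rewrite ltr_pwDl // sumr_ge0 // => i _; exact: Re_norm_ge0.
move=> i; rewrite normC_Re lecR (bigD1 i) //= addrCA lerDl addr_ge0 //.
by apply: sumr_ge0 => l _; exact: Re_norm_ge0.
Qed.

Lemma expands_line g p v t : analytic_at g (p + t%:C *: v) ->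
  expands (fun s => g (p + s%:C *: v)) t.
Proof.
move=> /taylor[P [r [B [r0 B0 PZ est]]]].
have [r' r'0 re] := gt0_complex r0.
have [L L0 vL] := rV_bound v.
have Be : B = (complex.Re B)%:C by rewrite RRe_real // ger0_real.
(* Moving by s along v changes each coordinate by at most |s| L, which rescales the radius. *)
exists (fun j => P j v), (r' / L), (complex.Re B); split.
- exact: divr_gt0.
- by rewrite -lecR -Be.
move=> m s sd.
have sLr : `|s| * L < r' by rewrite -ltr_pdivlMr.
have := est m (s%:C *: v) (`|s| * L)%:C; rewrite re.
have -> : p + t%:C *: v + s%:C *: v = p + (t + s)%:C *: v.
  by rewrite rmorphD scalerDl addrA.
rewrite (eq_bigr (fun j : 'I_m.+1 => P j v * s%:C ^+ j)) => [h|j _]; last by rewrite PZ mulrC.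
apply: le_trans (h _ _ _) _.
- by rewrite ler0c mulr_ge0 // ltW.
- by rewrite ltcR.
- by move=> i; rewrite mxE normrM normC_real rmorphM /= ler_wpM2l ?vL // ler0c.
rewrite {1}Be -fmorphV -rmorphM -rmorphXn -rmorphM lecR.
by rewrite invf_div mulrA.
Qed.

Lemma nbhs_line p v (U : set 'rV[CF]_n) : nbhs p U ->
  exists2 d : R, 0 < d & forall s : R, `|s| < d -> U (p + s%:C *: v).
Proof.
move=> /nbhs_ballP[r /= r0 rU]; have [r' r'0 re] := gt0_complex r0.
have [L L0 vL] := rV_bound v.
exists (r' / L); first exact: divr_gt0.
move=> s sd; apply: rU; rewrite re; split; first by rewrite ltcR.
move=> k l; rewrite ord1 -ball_normE /= !mxE opprD addrA subrr sub0r normrN.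
rewrite normrM normC_real; apply: (@le_lt_trans _ _ (`|s|%:C * L%:C)).
  by rewrite ler_wpM2l ?vL // ler0c.
by rewrite -rmorphM ltcR -ltr_pdivlMr.
Qed.

Lemma ballE p (r : R) z : 0 < r -> ball p r%:C z <-> forall i, `|p 0 i - z 0 i| < r%:C.
Proof.
move=> r0; split=> [[_ h] i|h]; first by have := h 0 i; rewrite -ball_normE.
split; first by rewrite ltcR.
by move=> k i; rewrite ord1 -ball_normE; exact: h.
Qed.

Lemma ball_segment p (r : R) z w (t : R) : 0 < r -> ball p r%:C z -> ball p r%:C w ->
  0 <= t -> t <= 1 -> ball p r%:C (z + t%:C *: (w - z)).
Proof.
move=> r0 /(ballE _ _ r0) hz /(ballE _ _ r0) hw t0 t1; apply/ballE => // i.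
have -> : p 0 i - (z + t%:C *: (w - z)) 0 i =
    (1 - t)%:C * (p 0 i - z 0 i) + t%:C * (p 0 i - w 0 i).
  by rewrite !mxE rmorphB rmorph1; ring.
have t1' : 0 <= 1 - t by rewrite subr_ge0.
apply: le_lt_trans (ler_normD _ _) _; rewrite !normrM !normC_real (ger0_norm t0) (ger0_norm t1').
move: (hz i) (hw i); rewrite [`|p 0 i - z 0 i|]normC_Re [`|p 0 i - w 0 i|]normC_Re.
rewrite -!rmorphM -rmorphD !ltcR; move: (complex.Re _) (complex.Re _) => a b ar br.
have [->|t1n] := eqVneq t 1; first by lra.
by have {}t1n : t < 1 by [rewrite lt_neqAle t1n]; nra.
Qed.

Lemma identity_theorem p (r : R) g e q : 0 < r ->
  (forall z, ball p r%:C z -> analytic_at g z) ->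
  ball p r%:C e -> nbhs e [set z | g z = 0] -> ball p r%:C q -> g q = 0.
Proof.
move=> r0 ag pe ze pq; have [d d0 dz] := nbhs_line (q - e) ze.
have := @segment_zero R (fun s => g (e + s%:C *: (q - e))) d d0.
rewrite rmorph1 scale1r subrKC; apply.
  by move=> t t0 t1; apply/expands_line/ag/ball_segment.
by move=> u u0 ud; apply: dz; rewrite ger0_norm.
Qed.

(** Taylor's estimate of order 0 reads |g z - g p| <= B t / r, so a zero close to p would make |g p|
    too small. *)
Lemma analytic_nonzero g p : analytic_at g p -> g p != 0 -> nbhs p [set z | g z != 0].
Proof.
move=> /taylor[P [r [B [r0 B0 PZ est]]]] gp.
have P0 w : P 0 w = P 0 0 by have := PZ 0 0 w; rewrite expr0 mul1r scale0r.
have gP : g p = P 0 0.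
  have := est 0 0 0 (lexx 0) r0; rewrite mul0r expr1 mulr0 addr0 big_ord1.
  move=> /(_ (fun i => _)); rewrite normr_le0 subr_eq0 => h; apply/eqP/h => i.
  by rewrite mxE normr0.
have [r' r'0 re] := gt0_complex r0.
have gp0 : 0 < complex.Re `|g p| by rewrite -ltcR -normC_Re normr_gt0.
have Be : B = (complex.Re B)%:C by rewrite RRe_real // ger0_real.
have B0' : 0 <= complex.Re B by rewrite -lecR -Be.
set b := complex.Re B in Be B0'; set a := complex.Re _ in gp0.
have b1 : 0 < b + 1 by rewrite ltr_wpDl.
(* The factor 1/2 keeps t below the radius; the other one gives b t / r' <= a b / (b + 1) < a. *)
pose t := r' * Num.min (1 / 2) (a / (b + 1)).
have t0 : 0 < t by rewrite mulr_gt0 // lt_min !divr_gt0.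
have tr : t < r'.
  by rewrite gtr_pMr // gt_min ltr_pdivrMr // mul1r (ltr_nat R 1 2).
apply/nbhs_ballP; exists t%:C; first by rewrite /= ltcR.
move=> z /(ballE _ _ t0) pz /=; apply/eqP => gz.
have := est 0 (z - p) t%:C; rewrite subrKC gz big_ord1 P0 -gP sub0r normrN normC_Re -/a re.
rewrite Be -fmorphV -rmorphM expr1 -rmorphM /= ltcR !lecR => h.
have {}h : a <= b * (t / r').
  apply: h; rewrite ?ltW // => i.
  by have := pz i; rewrite !mxE distrC => /ltW.
have : a <= b * (a / (b + 1)).
  apply: le_trans h _; rewrite /t mulrAC divff ?gt_eqF // !mul1r.
  by rewrite ler_wpM2l // ge_min lexx orbT.
rewrite mulrCA -[X in X <= _]mulr1 ler_pM2l // ler_pdivlMr // mul1r.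
by rewrite gerDl leNgt ltr01.
Qed.

(** If g vanishes near one point of the ball it vanishes on the whole ball; otherwise the open set
    of its nonzeros meets every neighbourhood. *)
Lemma analytic_dichotomy p (r : R) g : 0 < r ->
  (forall z, ball p r%:C z -> analytic_at g z) ->
  (forall z, ball p r%:C z -> g z = 0) \/ generically (ball p r%:C) [set z | g z != 0].
Proof.
move=> r0 ag.
have [h|] := pselect (exists2 e, ball p r%:C e & nbhs e [set z | g z = 0]).
  by left=> z pz; have [e pe ze] := h; exact: identity_theorem r0 ag pe ze pz.
move=> nz; right; exists (ball p r%:C `&` [set z | g z != 0]); split.
- rewrite openE => z [pz gz]; apply: filterI.
    exact: open_nbhs_nbhs (conj (ball_open _ _) pz).
  exact: analytic_nonzero (ag _ pz) gz.
- move=> z pz O Oz; apply: contrapT => nO; apply: nz; exists z => //.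
  have pz' : nbhs z (ball p r%:C) by apply: open_nbhs_nbhs (conj (ball_open _ _) pz).
  apply: filterS (filterI pz' Oz) => y [py Oy] /=.
  by apply/eqP; apply: contrapT => /negP gy; apply: nO; exists y.
- by move=> z [_ []].
Qed.

End Coord.
End Field.

(** * Inverting meromorphic functions *)

Section MeroField.
Variables (R : realType) (V : vectType R[i]).
Let CF : numFieldType := R[i].

Section Meromorphic.
Variables (n : nat) (phi : 'rV[CF]_n -> CF).
Hypothesis mphi : meromorphic phi.

Let zero_near p := exists U, open_nbhs p U /\ generically U [set z | phi z = 0].

Let quotient_near p := exists U g h, [/\ open_nbhs p U,
  forall z, U z -> analytic_at g z, forall z, U z -> analytic_at h z &
  generically U [set z | [/\ g z != 0, h z != 0 & phi z = g z / h z]]].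

(** On a small ball the numerator is identically zero or generically nonzero. *)
Lemma meromorphic_dichotomy p : zero_near p \/ quotient_near p.
Proof.
have [U [g [h [[oU Up] ag ah gf]]]] := mphi p.
have /nbhs_ballP[r0 /= r00 rU] : nbhs p U by exact: open_nbhs_nbhs.
have [r r1 re] := gt0_complex r00; rewrite {}re in rU.
have oB : open_nbhs p (ball p r%:C : set 'rV[CF]_n).
  by split; [apply: ball_open; rewrite ltcR|apply: ballxx; rewrite ltcR].
have UB : U `&` ball p r%:C = ball p r%:C by apply/setIidPr.
have gT (P : set 'rV[CF]_n) : (forall z, ball p r%:C z -> P z) -> generically (ball p r%:C) P.
  by move=> BP; exists setT; split; [exact: openT|rewrite closureT|move=> z [/BP]].
have [z0|nz] := analytic_dichotomy r1 (fun z Bz => ag z (rU z Bz)).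
  left; exists (ball p r%:C); split => //; rewrite -UB.
  by apply: genericallyI gf (gT _ z0) _; case: oB => // _ _ z /= [_ ->] ->; rewrite mul0r.
right; exists (ball p r%:C), g, h; split => //; try by move=> z /rU; auto.
by rewrite -UB; apply: genericallyI gf nz _; case: oB => // _ _ z /= [hz ->] gz.
Qed.

Lemma zero_quotient_near p q : zero_near p ->
  (forall U, open_nbhs q U -> U p -> generically U [set z | phi z <> 0] -> False).
Proof.
move=> [U [[oU Up] gU]] W [oW _] Wp gW.
have [Z [oZ dZ ZP]] := genericallyI oU oW gU gW (fun z (h0 : phi z = 0) (h : phi z <> 0) => h h0).
have /(_ (U `&` W))[] := dZ p (conj Up Wp).
  by apply: open_nbhs_nbhs; split => //; exact: openI.
by move=> z [Zz UWz]; apply: (ZP z).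
Qed.

(** The alternative propagates along the segment from p to q. At a limit parameter the quotient case
    is impossible: its neighbourhood reaches earlier points of the segment, near which the function
    is generically zero. *)
Lemma zero_near_everywhere p q : zero_near p -> zero_near q.
Proof.
move=> zp; have [U0 [oU0 gU0]] := zp.
have [e e0 he] := nbhs_line (q - p) (open_nbhs_nbhs oU0).
have := @real_induction R (fun t => zero_near (p + t%:C *: (q - p))) e e0 _ _ 1 ler01 (lexx 1).
rewrite rmorph1 scale1r subrKC; apply.
  move=> u u0 ue; exists U0; split => //; split; first by case: oU0.
  by apply: he; rewrite ger0_norm.
move=> t et t1 zt; pose x := p + t%:C *: (q - p).
have open_step U : open_nbhs x U -> generically U [set z | phi z = 0] ->
    exists2 d, 0 < d & forall u, t <= u -> u < t + d -> zero_near (p + u%:C *: (q - p)).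
  move=> oU gU; have [d d0 hd] := nbhs_line (q - p) (open_nbhs_nbhs oU).
  exists d => // u tu ud; exists U; split => //; split; first by case: oU.
  rewrite -{1}(subrKC t u) rmorphD scalerDl addrA; apply: hd.
  by rewrite ger0_norm ?subr_ge0 // ltrBlDl.
have [[U [oU gU]]|[U [g [h [oU ag ah gU]]]]] := meromorphic_dichotomy x.
  exact: open_step oU gU.
have [d d0 hd] := nbhs_line (q - p) (open_nbhs_nbhs oU).
have t0 : 0 < t := lt_le_trans e0 et.
(* An earlier parameter within d of t; the maximum keeps it on the segment. *)
pose u := Num.max 0 (t - d / 2).
have d2 : 0 < d / 2 by rewrite divr_gt0.
have ut : u < t by rewrite gt_max t0 gtrBl.
have u0 : 0 <= u by rewrite le_max lexx.
have Uu : U (p + u%:C *: (q - p)).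
  rewrite -{1}(subrKC t u) rmorphD scalerDl addrA; apply: hd.
  rewrite distrC ger0_norm ?subr_ge0 ?ltW // ltrBlDl -ltrBlDr lt_max; apply/orP; right.
  by rewrite ltrD2l ltrN2 ltr_pdivrMr // ltr_pMr // (ltr_nat R 1 2).
exfalso; apply: (zero_quotient_near (zt u u0 ut) oU Uu).
have [W [oW dW WP]] := gU; exists W; split => // z /WP /= [gz hz ->].
by apply/eqP; rewrite mulf_neq0 // invr_eq0.
Qed.

(** The dense open sets provided locally vary from point to point; the interior of the zero set is a
    witness that serves everywhere. *)
Lemma zero_near_generic p : zero_near p -> generically setT [set z | phi z = 0].
Proof.
move=> zp; exists ([set z | phi z = 0]^°); split.
- exact: open_interior.
- move=> z _ O; have [U [[oU Uz] [W [oW dW WP]]]] := zero_near_everywhere z zp.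
  move=> /(filterI (open_nbhs_nbhs (conj oU Uz)))/(dW z Uz)[y [Wy [Uy Oy]]].
  exists y; split => //; apply: filterS (open_nbhs_nbhs (conj (openI oU oW) (conj Uy Wy))).
  exact: WP.
- by move=> z [_] /interior_subset.
Qed.

(** By propagation the zero case then occurs at no point, so phi is locally a quotient with
    generically nonzero numerator and denominator, and these may be exchanged. *)
Lemma meromorphicV : ~ generically setT [set z | phi z = 0] ->
  meromorphic (fun z => (phi z)^-1) /\ generically setT [set z | phi z <> 0].
Proof.
move=> nz; have quo p : quotient_near p.
  by have [/zero_near_generic|] := meromorphic_dichotomy p.
split.
  move=> p; have [U [g [h [oU ag ah [W [oW dW WP]]]]]] := quo p.
  exists U, h, g; split => //; exists W; split => // z /WP /= [gz hz ->].
  by rewrite invf_div.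
exists ([set z | phi z <> 0]^°); split.
- exact: open_interior.
- move=> z _ O; have [U [g [h [[oU Uz] ag ah [W [oW dW WP]]]]]] := quo z.
  move=> /(filterI (open_nbhs_nbhs (conj oU Uz)))/(dW z Uz)[y [Wy [Uy Oy]]].
  exists y; split => //; apply: filterS (open_nbhs_nbhs (conj (openI oU oW) (conj Uy Wy))).
  by move=> t /WP[gt ht]; rewrite /= => ->; apply/eqP; rewrite mulf_neq0 // invr_eq0.
- by move=> z [_] /interior_subset.
Qed.

End Meromorphic.

Lemma mero_inverse (f : mero V) : f != 0 -> exists g : mero V, f * g = 1.
Proof.
rewrite -(tomeroK f); set F := repr f => F0.
have /asboolP mF := valP F.
have [|mV gn] := meromorphicV mF.
  move=> g0; case/eqP: F0; rewrite (_ : 0 = tomero 0); first by apply/tomeroP.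
  by apply: (addIr (tomero 0)); rewrite -tomeroD add0r addr0.
have mV' : (fun x : V => (F x)^-1) \in @mero_pred R V by apply/asboolP.
exists (tomero (Merofun mV')); rewrite -tomeroM -tomero1; apply/tomeroP.
by apply: generically_mono gn => z /= /eqP Fz; exact: divff.
Qed.

(** A coordinate not vanishing at [be]. A shift changes it by a constant only, so commutators with
    it detect translations. *)
Lemma mero_coord (be : V) : be != 0 -> exists (l : mero V) (c : V -> R[i]),
  [/\ c be != 0, forall x y, c (x - y) = c x - c y &
      forall ga, shift ga l = l + (c ga)%:A].
Proof.
move=> be0; have [i bei] : exists i, v2r be 0 i != 0.
  apply: contrapT => h; case/eqP: be0; apply: (can_inj v2rK); rewrite linear0.
  apply/rowP => i; rewrite mxE; apply/eqP; apply: contrapT => /negP hi; apply: h; by exists i.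
have ml : (fun x : V => v2r x 0 i) \in @mero_pred R V.
  apply/asboolP => p; exists setT, (fun z => z 0 i), (fun=> 1); split.
  - by split=> //; exact: openT.
  - by move=> z _; exact: analytic_coord.
  - by move=> z _; exact: analytic_cst.
  - exists setT; split; [exact: openT|by rewrite closureT|move=> z _ /=].
    by rewrite oner_neq0 divr1 r2vK.
exists (tomero (Merofun ml)), (fun ga => v2r ga 0 i); split => // [x y|ga].
  by rewrite linearB !mxE.
rewrite shift_tomero /GRing.scale /= /merocst -tomero1 -tomeroM -tomeroD.
congr tomero; apply: val_inj; apply/funext => x /=.
by rewrite linearD mxE; congr (_ + _); rewrite -[LHS]mulr1.
Qed.

End MeroField.

(** * The ring of difference operators *)

Lemma big_group (T K : eqType) (M : nmodType) (key : T -> K) (s : seq T) (F : T -> M) :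
  \sum_(t <- s) F t = \sum_(k <- undup (map key s)) \sum_(t <- s | key t == k) F t.
Proof.
under [RHS]eq_bigr do rewrite big_mkcond.
rewrite exchange_big /= [LHS]big_seq [RHS]big_seq; apply: eq_bigr => t ts.
have kt : key t \in undup (map key s) by rewrite mem_undup map_f.
rewrite (big_rem _ kt) /= eqxx big_seq big1 ?addr0 // => k.
by rewrite mem_rem_uniq ?undup_uniq // inE eq_sym => /andP[/negPf -> _].
Qed.

Section DiffOpRing.
Variables (R : realType) (V : vectType R[i]).
Notation C := R[i].
Notation M := (mero V).
Notation D := (diffop V).
Implicit Types (f g : M) (a b : V) (d e : D).

Lemma shift_zmod b : zmod_morphism (@Defs.shift R V b).
Proof.
move=> f g; apply: (addIr (shift b g)).
by rewrite -shiftD !subrK.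
Qed.
HB.instance Definition _ b := GRing.isZmodMorphism.Build M M (@Defs.shift R V b) (@shift_zmod b).

Lemma shift_monoid b : monoid_morphism (@Defs.shift R V b).
Proof.
split; last exact: shiftM.
rewrite -tomero1 shift_tomero; congr tomero; exact: val_inj.
Qed.
HB.instance Definition _ b := GRing.isMonoidMorphism.Build M M (@Defs.shift R V b) (@shift_monoid b).

Lemma shiftK a f : shift a (shift (- a) f) = f.
Proof. by rewrite shift_shift subrr shift0. Qed.

Lemma shiftNK a f : shift (- a) (shift a f) = f.
Proof. by rewrite shift_shift addNr shift0. Qed.

Lemma shift_inj b : injective (@Defs.shift R V b).
Proof. exact: can_inj (shiftNK b). Qed.

Lemma diffop_opsum d : exists s, d = dsum s.
Proof. by have /asboolP[s ds] := valP d; exists s; apply: val_inj. Qed.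

Lemma diffop_zmod d : zmod_morphism (dfun d).
Proof.
have [s ->] := diffop_opsum d; move=> f g; rewrite /= /opsum -sumrB.
by apply: eq_bigr => p _; rewrite raddfB mulrBr.
Qed.
HB.instance Definition _ d := GRing.isZmodMorphism.Build M M (dfun d) (diffop_zmod d).

Lemma diffopZ d (c : C) f : d (c *: f) = c *: d f.
Proof.
have [s ->] := diffop_opsum d; rewrite /= /opsum scaler_sumr.
by apply: eq_bigr => p _; rewrite shiftZ -scalerAr.
Qed.

Lemma diffopP d e : (forall f, d f = e f) -> d = e.
Proof. by move=> de; apply: val_inj; apply/funext. Qed.

Lemma dopE f b g : dop f b g = f * shift b g.
Proof. by rewrite /= /opsum big_seq1. Qed.

Fact dcompA : associative (@dcomp R V). Proof. by move=> x y z; exact: diffopP. Qed.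
Fact dcomp1l : left_id (dop 1 0) (@dcomp R V).
Proof. by move=> x; apply: diffopP => f; rewrite [LHS]dopE mul1r shift0. Qed.
Fact dcomp1r : right_id (dop 1 0) (@dcomp R V).
Proof. by move=> x; apply: diffopP => f; rewrite -[LHS]/(x (dop 1 0 f)) dopE mul1r shift0. Qed.
Fact dcompDl : left_distributive (@dcomp R V) +%R. Proof. by move=> x y z; exact: diffopP. Qed.
Fact dcompDr : right_distributive (@dcomp R V) +%R.
Proof. by move=> x y z; apply: diffopP => f; exact: raddfD. Qed.
Fact dop1_neq0 : dop 1 0 != 0 :> D.
Proof.
apply/eqP => /(congr1 (fun d => dfun d 1)); rewrite dopE mul1r rmorph1.
by move/eqP; rewrite oner_eq0.
Qed.
HB.instance Definition _ := GRing.Zmodule_isNzRing.Build D dcompA dcomp1l dcomp1r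
  dcompDl dcompDr dop1_neq0.
Fact diffop_scaleAl (c : C) d e : c *: (d * e) = c *: d * e.
Proof. by apply: diffopP. Qed.
HB.instance Definition _ := GRing.Lmodule_isLalgebra.Build C D diffop_scaleAl.
Fact diffop_scaleAr (c : C) d e : c *: (d * e) = d * (c *: e).
Proof. by apply: diffopP => f; rewrite /GRing.mul /= diffopZ. Qed.
HB.instance Definition _ := GRing.Lalgebra_isAlgebra.Build C D diffop_scaleAr.

Lemma dcompE d e : dcomp d e = d * e. Proof. by []. Qed.
Lemma dmulE d e f : (d * e) f = d (e f). Proof. by []. Qed.

Definition mop f : D := dop f 0.
Definition tau a : D := dop 1 a.

Lemma dopM f a g b : dop f a * dop g b = dop (f * shift a g) (a + b).
Proof. by apply: diffopP => h; rewrite dmulE !dopE shiftM shift_shift mulrA. Qed.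

Lemma dop_mop f a : dop f a = mop f * tau a.
Proof. by rewrite dopM shift0 mulr1 add0r. Qed.

Lemma mop_zmod : zmod_morphism mop.
Proof. by move=> f g; apply: diffopP => h; rewrite dopE mulrBl -!dopE. Qed.
HB.instance Definition _ := GRing.isZmodMorphism.Build M D mop mop_zmod.
Lemma mop_monoid : monoid_morphism mop.
Proof. by split=> // f g; rewrite [RHS]dopM shift0 addr0. Qed.
HB.instance Definition _ := GRing.isMonoidMorphism.Build M D mop mop_monoid.

Lemma dopB a f g : dop (f - g) a = dop f a - dop g a.
Proof. by rewrite !dop_mop raddfB mulrBl. Qed.

Lemma mopZ (c : C) f : mop (c *: f) = c *: mop f.
Proof. by apply: diffopP => h; rewrite dopE -scalerAl -dopE. Qed.

Lemma tau0 : tau 0 = 1. Proof. by []. Qed.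
Lemma tauD a b : tau (a + b) = tau a * tau b.
Proof. by rewrite dopM rmorph1 mulr1. Qed.
Lemma tauNK a : tau (- a) * tau a = 1. Proof. by rewrite -tauD addNr. Qed.
Lemma tauK a : tau a * tau (- a) = 1. Proof. by rewrite -tauD subrr. Qed.
Lemma tau_mop a f : tau a * mop f = mop (shift a f) * tau a.
Proof. by rewrite !dopM addr0 add0r shift0 mul1r mulr1. Qed.
Lemma mop_tau a f : mop f * tau a = tau a * mop (shift (- a) f).
Proof. by rewrite tau_mop shiftK. Qed.

Lemma dop_at1 f a : dop f a 1 = f.
Proof. by rewrite dopE rmorph1 mulr1. Qed.

Lemma dsumE s : dsum s = \sum_(p <- s) dop p.1 p.2 :> D.
Proof.
elim: s => [|p s IH]; first by rewrite big_nil; apply: diffopP => f; rewrite /= /opsum big_nil.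
by rewrite big_cons -IH; apply: diffopP => f; rewrite -[RHS]/(dop p.1 p.2 f + dsum s f) dopE /= /opsum big_cons.
Qed.

Lemma dop_indep (F : V -> M) (s : seq V) : uniq s ->
  \sum_(b <- s) dop (F b) b = 0 -> forall b, b \in s -> F b = 0.
Proof.
elim: s F => [//|b0 s IH] F /= /andP[b0s us] F0.
have Fs b : b \in s -> F b = 0.
  move=> bs; have bb0 : b - b0 != 0.
    by rewrite subr_eq0; apply: contra b0s => /eqP <-.
  (* Commutation with a coordinate function l kills the b0-term and multiplies
     each of the others by a constant. *)
  have [l [c [c0 cB cl]]] := mero_coord bb0.
  have : (c b0 - c b)%:A * F b = 0.
    move: b bs {bb0 c0}; apply: IH => //.
    have : mop (l + (c b0)%:A) * (\sum_(b <- b0 :: s) dop (F b) b)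
         - (\sum_(b <- b0 :: s) dop (F b) b) * mop l = 0.
      by rewrite F0 mulr0 mul0r subrr.
    rewrite mulr_sumr mulr_suml -sumrB big_cons.
    have term b : mop (l + (c b0)%:A) * dop (F b) b - dop (F b) b * mop l
        = dop ((c b0 - c b)%:A * F b) b.
      rewrite !dopM shift0 add0r addr0 cl -dopB scalerBl; congr dop; ring.
    by rewrite (eq_bigr _ (fun b _ => term b)) term subrr scale0r mul0r dop_mop raddf0 mul0r add0r.
  rewrite mulr_algl => /eqP; rewrite scaler_eq0 => /orP[|/eqP //].
  by rewrite -oppr_eq0 opprB -cB (negPf c0).
move=> b; rewrite inE => /orP[/eqP ->|]; last exact: Fs.
move: F0; rewrite big_cons big_seq big1 => [|d /Fs ->]; last by rewrite dop_mop raddf0 mul0r.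
by rewrite addr0 => /(congr1 (fun d => dfun d 1)); rewrite dop_at1.
Qed.

(** The principle by which an assignment on terms f T_b, additive in f, is well defined on
    operators: a presentation of 0 has total coefficient 0 at each shift. *)
Lemma dsum_eq0 (Z : zmodType) (G : V -> M -> Z) (s : seq (M * V)) :
  (forall b, zmod_morphism (G b)) -> dsum s = 0 -> \sum_(p <- s) G p.2 p.1 = 0.
Proof.
move=> Gm; pose G' b : {additive M -> Z} := HB.pack (G b) (GRing.isZmodMorphism.Build _ _ (G b) (Gm b)).
rewrite dsumE (big_group snd) /= => s0.
have co b : \sum_(p <- s | p.2 == b) dop p.1 p.2 = dop (\sum_(p <- s | p.2 == b) p.1) b.
  by rewrite dop_mop raddf_sum mulr_suml; apply: eq_bigr => p /eqP <-; rewrite -dop_mop.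
have h := dop_indep (F := fun b => \sum_(p <- s | p.2 == b) p.1)
  (undup_uniq _) (etrans (eq_bigr _ (fun b _ => esym (co b))) s0).
rewrite (big_group snd) big_seq big1 // => b /h {}h.
rewrite (eq_bigr (fun p => G' b p.1)) => [|p /eqP -> //].
by rewrite -raddf_sum h raddf0.
Qed.

(** [xget] picks some presentation t of the operator. Joining s to the negative of t presents 0, so
    the images of s and t agree. *)
Lemma antipodeD_dsum s :
  antipodeD (dsum s) = dsum [seq (shift (- p.2) p.1, - p.2) | p <- s] :> D.
Proof.
rewrite /antipodeD; case: xgetP => [e _ [t [st ->]]|]; last first.
  by move=> /(_ (dsum [seq (shift (- p.2) p.1, - p.2) | p <- s])); case; exists s.
pose G b f : D := dop (shift (- b) f) (- b).
have Gm b : zmod_morphism (G b) by move=> f g; rewrite /G raddfB dopB.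
pose s' := [seq (- p.1, p.2) | p <- t].
have : dsum (s ++ s') = 0.
  rewrite dsumE big_cat big_map /= -dsumE st dsumE -big_split big1 //= => p _.
  by rewrite !dop_mop raddfN mulNr subrr.
move=> /(dsum_eq0 Gm); rewrite big_cat big_map /= => /eqP.
rewrite [X in _ + X](eq_bigr (fun p => - G p.2 p.1)) => [|p _]; last first.
  by rewrite /G raddfN !dop_mop raddfN mulNr.
by rewrite sumrN subr_eq0 !dsumE !big_map => /eqP <-.
Qed.

Lemma antipodeD_linear : linear (@antipodeD R V).
Proof.
move=> c d e; have [s ->] := diffop_opsum d; have [t ->] := diffop_opsum e.
have -> : c *: dsum s + dsum t = dsum ([seq (c *: p.1, p.2) | p <- s] ++ t) :> D.
  rewrite !dsumE big_cat big_map scaler_sumr; congr (_ + _); apply: eq_bigr => p _.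
  by rewrite !dop_mop mopZ scalerAl.
rewrite !antipodeD_dsum !dsumE map_cat big_cat !big_map scaler_sumr; congr (_ + _).
by apply: eq_bigr => p _; rewrite !dop_mop shiftZ mopZ scalerAl.
Qed.
HB.instance Definition _ := GRing.isLinear.Build C D D _ (@antipodeD R V) antipodeD_linear.

Lemma antipodeD_dop f a : antipodeD (dop f a) = dop (shift (- a) f) (- a).
Proof.
have -> : dop f a = dsum [:: (f, a)] by [].
by rewrite antipodeD_dsum.
Qed.

Lemma antipodeDM d e : antipodeD (d * e) = antipodeD e * antipodeD d.
Proof.
have [s ->] := diffop_opsum d; have [t ->] := diffop_opsum e; rewrite !dsumE.
rewrite mulr_suml !raddf_sum mulr_sumr; apply: eq_bigr => p _ /=.
rewrite mulr_sumr !raddf_sum mulr_suml; apply: eq_bigr => q _ /=.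
rewrite dopM !antipodeD_dop dopM opprD addrC shiftM shift_shift; congr dop.
by rewrite mulrC shift_shift -addrA addNr addr0 addrC.
Qed.

Lemma antipodeD_mop f : antipodeD (mop f) = mop f.
Proof. by rewrite antipodeD_dop oppr0 shift0. Qed.

Lemma antipodeD_tau a : antipodeD (tau a) = tau (- a).
Proof. by rewrite antipodeD_dop rmorph1. Qed.

End DiffOpRing.

(** * Bidegrees of difference operators *)

Section DhDegree.
Variables (R : realType) (V : vectType R[i]).
Notation M := (mero V).
Notation D := (diffop V).
Implicit Types (f : M) (a b c e : V) (x y : D).

(** Keeps elements typed as operators, so that the ring structure on [diffop V] applies to them. *)
Definition dhdeg a b (x : D) : Prop := hdeg a b (x : Dh V).

Lemma dhdegP a b x : dhdeg a b x <-> x = 0 \/ (a = b /\ x = mop (x 1) * tau (- b)).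
Proof.
split=> [[|[-> [f ->]]]|[|[ab ->]]]; [by left| |by left|].
  by right; rewrite dop_at1 -dop_mop.
by right; split=> //; rewrite -dop_mop; exists (x 1).
Qed.

Lemma dhdegEl a b x : dhdeg a b x -> x = mop (x 1) * tau (- a).
Proof. by move=> /dhdegP[->|[-> //]]; rewrite raddf0 mul0r. Qed.

Lemma dhdegEr a b x : dhdeg a b x -> x = mop (x 1) * tau (- b).
Proof. by move=> /dhdegP[->|[//]]; rewrite raddf0 mul0r. Qed.

Lemma dhdeg_neq0 a b x : dhdeg a b x -> x <> 0 -> a = b.
Proof. by move=> /dhdegP[|[]]. Qed.

Lemma dhdeg0 a b : dhdeg a b 0. Proof. by left. Qed.

Lemma dhdeg_dop f a : dhdeg a a (dop f (- a)).
Proof. by right; split=> //; exists f. Qed.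

Lemma dhdeg_mop f : dhdeg 0 0 (mop f).
Proof. by right; split=> //; exists f; rewrite oppr0. Qed.

Lemma dhdeg_tau a : dhdeg (- a) (- a) (tau a : D).
Proof. by right; split=> //; exists 1; rewrite opprK. Qed.

Lemma dhdegM a b c e x y : dhdeg a b x -> dhdeg c e y -> dhdeg (a + c) (b + e) (x * y).
Proof.
move=> /dhdegP[->|[-> ->]]; first by rewrite mul0r; left.
move=> /dhdegP[->|[-> ->]]; first by rewrite mulr0; left.
rewrite -!dop_mop dopM -opprD; exact: dhdeg_dop.
Qed.

Lemma dhdegD a b x y : dhdeg a b x -> dhdeg a b y -> dhdeg a b (x + y).
Proof.
move=> /dhdegP[->|[-> ->]]; first by rewrite add0r.
move=> /dhdegP[->|[_ ->]]; rewrite -?dop_mop ?addr0; first exact: dhdeg_dop.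
by rewrite !dop_mop -mulrDl -raddfD -dop_mop; exact: dhdeg_dop.
Qed.

Lemma dhdegZ a b (k : R[i]) x : dhdeg a b x -> dhdeg a b (k *: x).
Proof.
move=> /dhdegP[->|[-> ->]]; first by rewrite scaler0; left.
by rewrite scalerAl -mopZ -dop_mop; exact: dhdeg_dop.
Qed.

Lemma dhdeg_sum a b (I : Type) (r : seq I) (P : pred I) (F : I -> D) :
  (forall i, P i -> dhdeg a b (F i)) -> dhdeg a b (\sum_(i <- r | P i) F i).
Proof. by move=> h; elim/big_ind: _ => //; [exact: dhdeg0|exact: dhdegD]. Qed.

Lemma dhdeg_mop_commute a b x f : dhdeg a b x -> x * mop f = mop (shift (- a) f) * x.
Proof.
move=> /dhdegEl ->; rewrite -mulrA tau_mop mulrA -rmorphM /= mulrC rmorphM -!mulrA.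
by [].
Qed.

Lemma dhdeg_mop_commuter a b x f : dhdeg a b x -> x * mop f = mop (shift (- b) f) * x.
Proof.
move=> h; have [->|x0] := pselect (x = 0); first by rewrite mul0r mulr0.
by rewrite (dhdeg_mop_commute _ h) (dhdeg_neq0 h x0).
Qed.

Lemma dhdeg00_commute x y : dhdeg 0 0 x -> dhdeg 0 0 y -> x * y = y * x.
Proof.
move=> /dhdegEl -> /dhdegEl ->.
by rewrite oppr0 tau0 !mulr1 -!rmorphM mulrC.
Qed.

(* Operators with different shifts are independent, and the shift determines the
   bidegree of a nonzero summand. *)
Lemma dhdeg_direct (k l : V) (F : V * V -> D) (s : seq (V * V)) : uniq s ->
  (forall i, i \in s -> dhdeg (k + i.2) (l + i.1) (F i)) -> \sum_(i <- s) F i = 0 ->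
  forall i, i \in s -> F i = 0.
Proof.
(* Indices whose two predicted degrees differ carry the value 0; any other index is determined by
   its second entry, that is, by the shift of its value. *)
move=> us dF; pose s' := [seq i <- s | k + i.2 == l + i.1].
have F0 i : i \in s -> i \notin s' -> F i = 0.
  move=> si; rewrite mem_filter si andbT => /eqP n; apply: contrapT => /(dhdeg_neq0 (dF i si)).
  exact: n.
rewrite (bigID (fun i : V * V => k + i.2 == l + i.1)) /= [X in _ + X]big_seq_cond.
rewrite [X in _ + X]big1 => [|i /andP[si ni]]; last by apply: F0 => //; rewrite mem_filter negb_and ni.
rewrite addr0 -big_filter -/s'.
pose G b := F (k + b - l, b) 1.
have s'E i : i \in s' -> i = (k + i.2 - l, i.2).
  by rewrite mem_filter => /andP[/eqP -> _]; rewrite [l + _]addrC addrK; case: i.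
rewrite (_ : \sum_(i <- s') F i = \sum_(b <- map snd s') dop (G b) (- (k + b))); last first.
  rewrite big_map; apply: eq_big_seq => i si.
  rewrite /G -(s'E i si) dop_mop; apply: (@dhdegEl _ (l + i.1)); apply: dF.
  by move: si; rewrite mem_filter => /andP[].
move=> S0 i si; have [si'|] := boolP (i \in s'); last exact: F0.
have di := dF i si; rewrite (dhdegEl di).
suff -> : F i 1 = 0 by rewrite raddf0 mul0r.
have u : uniq (map (fun b => - (k + b)) (map snd s')).
  rewrite map_inj_uniq => [|x y /oppr_inj/addrI //]; rewrite map_inj_in_uniq.
    exact: filter_uniq.
  by move=> x y /s'E -> /s'E -> /= ->.
have := @dop_indep R V (fun b => G (- b - k)) _ u; rewrite big_map.
rewrite (eq_bigr (fun b => dop (G b) (- (k + b)))) => [|b _]; last first.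
  by rewrite opprK [k + b]addrC addrK.
move=> /(_ S0 (- (k + i.2))); rewrite opprK [k + i.2]addrC addrK /G -(s'E i si'); apply.
by rewrite [i.2 + k]addrC; apply/mapP; exists i.2 => //; apply: map_f.
Qed.

End DhDegree.

(** * Matrix tensor products *)

Section LinearFunction.
Variables (K : pzRingType) (U W : lmodType K) (f : U -> W).
Hypothesis lf : linear f.
Let F : {linear U -> W} := HB.pack_for {linear U -> W} f (GRing.isLinear.Build _ _ _ _ f lf).

Lemma lin_sum (T : Type) (r : seq T) (Q : pred T) (x : T -> U) :
  f (\sum_(t <- r | Q t) x t) = \sum_(t <- r | Q t) f (x t).
Proof. exact: (raddf_sum F). Qed.
Lemma lin0 : f 0 = 0. Proof. exact: (raddf0 F). Qed.
Lemma linD x y : f (x + y) = f x + f y. Proof. exact: (raddfD F). Qed.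
Lemma linB x y : f (x - y) = f x - f y. Proof. exact: (raddfB F). Qed.
Lemma linZ c x : f (c *: x) = c *: f x. Proof. exact: (linearZ_LR F). Qed.

End LinearFunction.

Section FreeLift.
Variables (K : choiceType) (C : nzRingType) (Z : lmodType C).
Implicit Types (f : K -> Z) (u : {freeg K / C}) (S : set {freeg K / C}).

HB.instance Definition _ f :=
  GRing.isZmodMorphism.Build {freeg K / C} Z (fglift f) (lift_is_additive f).

Lemma fgliftE f u : fglift f u = \sum_(k <- dom u) coeff k u *: f k.
Proof.
rewrite -{1}[u]freeg_sumE raddf_sum.
by apply: eq_bigr => k _; rewrite [LHS]liftU.
Qed.

Lemma fglift_scalable f : scalable (fglift f).
Proof.
move=> c u; rewrite -[c *: u]/(fgscale c u) /fgscale raddf_sum fgliftE scaler_sumr.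
by apply: eq_bigr => k _; rewrite [LHS]liftU scalerA.
Qed.
HB.instance Definition _ f :=
  GRing.isScalable.Build C {freeg K / C} Z _ (fglift f) (@fglift_scalable f).

Lemma fgliftB f u v : fglift f (u - v) = fglift f u - fglift f v.
Proof. exact: raddfB. Qed.

(** The chosen representative differs from u by a combination of relations, which the lift kills. *)
Lemma fglift_toquot f S : (forall u, S u -> fglift f u = 0) ->
  forall u, fglift f (repr (toquot S u)) = fglift f u.
Proof.
move=> S0 u; have /toquotP[s [sS]] := toquotK (toquot S u).
move/(congr1 (fglift f)); rewrite raddfB raddf_sum big_seq big1 => [/eqP|p ps].
  by rewrite subr_eq0 => /eqP.
by rewrite [LHS]fglift_scalable S0 ?scaler0 //; exact: sS.
Qed.

End FreeLift.

HB.instance Definition _ (K : nzRingType) (U : lmodType K) (S : set U) :=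
  GRing.isLinear.Build K U (quotmod S) _ (toquot S) (@toquot_is_linear K U S).

Lemma toquotZ (K : nzRingType) (U : lmodType K) (S : set U) c u :
  toquot S (c *: u) = c *: toquot S u.
Proof. exact: linearZ. Qed.

Section Tensor.
Variables (R : realType) (V : vectType R[i]).
Notation C := R[i].
Notation M := (mero V).

(* The properties of an h-prealgebra that only concern homogeneous elements. Unlike
   [is_hprealgebra] they hold for [dual_pre A], whose carrier consists of all
   functions A -> D_h. *)
Record wpre (P : hpre V) : Prop := Wpre {
  wdeg0 : forall al be, @hdeg R V P al be 0;
  wdeg_lin : forall al be (c : C) (p q : P),
    hdeg al be p -> hdeg al be q -> hdeg al be (c *: p + q);
  wml_deg : forall f al be (p : P), hdeg al be p -> hdeg al be (hml f p);
  wmr_deg : forall f al be (p : P), hdeg al be p -> hdeg al be (hmr f p);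
  wml_lin : forall f al be (c : C) (p q : P), hdeg al be p -> hdeg al be q ->
    hml f (c *: p + q) = c *: hml f p + hml f q;
  wmr_lin : forall f al be (c : C) (p q : P), hdeg al be p -> hdeg al be q ->
    hmr f (c *: p + q) = c *: hmr f p + hmr f q;
  wmlD : forall f g al be (p : P), hdeg al be p -> hml (f + g) p = hml f p + hml g p;
  wmrD : forall f g al be (p : P), hdeg al be p -> hmr (f + g) p = hmr f p + hmr g p;
  wmlM : forall f g al be (p : P), hdeg al be p -> hml (f * g) p = hml f (hml g p);
  wmrM : forall f g al be (p : P), hdeg al be p -> hmr (f * g) p = hmr f (hmr g p);
  wml_cst : forall (c : C) al be (p : P), hdeg al be p -> hml c%:A p = c *: p;
  wmr_cst : forall (c : C) al be (p : P), hdeg al be p -> hmr c%:A p = c *: p;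
  wcomm : forall f g al be (p : P), hdeg al be p -> hml f (hmr g p) = hmr g (hml f p) }.

Lemma hprealgebra_wpre (P : hpre V) : is_hprealgebra P -> wpre P.
Proof.
move=> [h0 hl _ _ [l1 l2 l3 l4] [r1 r2 r3 r4] hld hrd hc].
by split=> // *; [exact: l1|exact: r1].
Qed.

Section WpreTheory.
Variables (P : hpre V) (wP : wpre P).
Implicit Types (p q : P).

Lemma wdegD al be p q : hdeg al be p -> hdeg al be q -> hdeg al be (p + q).
Proof. by move=> dp dq; rewrite -[p]scale1r; exact: wdeg_lin. Qed.

Lemma wdegZ al be c p : hdeg al be p -> hdeg al be (c *: p).
Proof. by move=> dp; rewrite -[_ *: _]addr0; apply: wdeg_lin => //; exact: wdeg0. Qed.

Lemma wdegN al be p : hdeg al be p -> hdeg al be (- p).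
Proof. by rewrite -scaleN1r; exact: wdegZ. Qed.

Lemma wdeg_sum al be (I : eqType) (r : seq I) (Q : pred I) (F : I -> P) :
  (forall i, i \in r -> Q i -> hdeg al be (F i)) -> hdeg al be (\sum_(i <- r | Q i) F i).
Proof.
move=> h; rewrite big_seq_cond; elim/big_ind: _; [exact: wdeg0|exact: wdegD|].
by move=> i /andP[ir Qi]; exact: h.
Qed.

Lemma wmlDr f al be p q : hdeg al be p -> hdeg al be q -> hml f (p + q) = hml f p + hml f q.
Proof. by move=> dp dq; have := wml_lin wP f 1 dp dq; rewrite !scale1r. Qed.

Lemma wmrDr f al be p q : hdeg al be p -> hdeg al be q -> hmr f (p + q) = hmr f p + hmr f q.
Proof. by move=> dp dq; have := wmr_lin wP f 1 dp dq; rewrite !scale1r. Qed.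

Lemma wml0r f : @hml R V P f 0 = 0.
Proof.
have := wml_lin wP f (-1) (wdeg0 wP 0 0) (wdeg0 wP 0 0).
by rewrite scaler0 addr0 scaleN1r addNr.
Qed.

Lemma wml1 al be p : hdeg al be p -> hml 1 p = p.
Proof. by move=> dp; rewrite -[1]scale1r (wml_cst wP _ dp) scale1r. Qed.

Lemma wmr1 al be p : hdeg al be p -> hmr 1 p = p.
Proof. by move=> dp; rewrite -[1]scale1r (wmr_cst wP _ dp) scale1r. Qed.

Lemma wml0 al be p : hdeg al be p -> hml 0 p = 0.
Proof. by move=> dp; rewrite -(scale0r (1 : M)) (wml_cst wP _ dp) scale0r. Qed.

Lemma wmr0 al be p : hdeg al be p -> hmr 0 p = 0.
Proof. by move=> dp; rewrite -(scale0r (1 : M)) (wmr_cst wP _ dp) scale0r. Qed.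

End WpreTheory.

Section Lift.
Variables (A B : hpre V) (wA : wpre A) (wB : wpre B).
Notation key := (V * V * V * A * B)%type.

Definition tapp (Z : Type) (F : V -> V -> V -> A -> B -> Z) (t : key) : Z :=
  let: (al, ga, be, a, b) := t in F al ga be a b.

(** One list, read off the representative of x, serves every Z and F. Identities that are linear in
    F thus follow without checking that F respects the relations. *)
Lemma mtlift_expand (x : mtensor A B) : exists L : seq (C * key),
  (forall t, t \in L -> mtensor_ok t.2) /\
  forall (Z : lmodType C) (F : V -> V -> V -> A -> B -> Z),
    mtlift F x = \sum_(t <- L) t.1 *: tapp F t.2.
Proof.
exists [seq (coeff k (repr x), k) | k <- dom (repr x) & `[< mtensor_ok k >] ]; split.
  by move=> t /mapP[k]; rewrite mem_filter => /andP[/asboolP kok _] -> .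
move=> Z F; rewrite /mtlift fgliftE [RHS]big_map big_filter [RHS]big_mkcond.
apply: eq_bigr => k _ /=; case: k => [[[[al ga] be] a] b].
by case: ifP => // _; rewrite scaler0.
Qed.

Lemma eq_mtlift (Z : lmodType C) (F G : V -> V -> V -> A -> B -> Z) :
  (forall al ga be a b, hdeg al ga a -> hdeg ga be b -> F al ga be a b = G al ga be a b) ->
  forall x, mtlift F x = mtlift G x.
Proof.
move=> FG x; have [L [Lok Le]] := mtlift_expand x; rewrite !Le.
apply: eq_big_seq => -[c [[[[al ga] be] a] b]] /Lok [/= da db].
by rewrite FG.
Qed.

Record balanced (Z : lmodType C) (F : V -> V -> V -> A -> B -> Z) : Prop := Balanced {
  bal_l : forall al ga be c a a' b, hdeg al ga a -> hdeg al ga a' -> hdeg ga be b ->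
    F al ga be (c *: a + a') b = c *: F al ga be a b + F al ga be a' b;
  bal_r : forall al ga be c a b b', hdeg al ga a -> hdeg ga be b -> hdeg ga be b' ->
    F al ga be a (c *: b + b') = c *: F al ga be a b + F al ga be a b';
  bal_m : forall f al ga be a b, hdeg al ga a -> hdeg ga be b ->
    F al ga be (hmr f a) b = F al ga be a (hml f b) }.

Section Balanced.
Variables (Z : lmodType C) (F : V -> V -> V -> A -> B -> Z) (bF : balanced F).

Lemma bal_0l al ga be b : hdeg ga be b -> F al ga be 0 b = 0.
Proof.
move=> db; have := bal_l bF (-1) (wdeg0 wA al ga) (wdeg0 wA al ga) db.
by rewrite scaler0 addr0 scaleN1r addNr.
Qed.

Lemma bal_0r al ga be a : hdeg al ga a -> F al ga be a 0 = 0.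
Proof.
move=> da; have := bal_r bF (-1) da (wdeg0 wB ga be) (wdeg0 wB ga be).
by rewrite scaler0 addr0 scaleN1r addNr.
Qed.

Lemma bal_Zl al ga be c a b : hdeg al ga a -> hdeg ga be b ->
  F al ga be (c *: a) b = c *: F al ga be a b.
Proof.
move=> da db; rewrite -[c *: a]addr0 (bal_l bF c da (wdeg0 wA _ _) db).
by rewrite bal_0l // addr0.
Qed.

Lemma bal_Zr al ga be c a b : hdeg al ga a -> hdeg ga be b ->
  F al ga be a (c *: b) = c *: F al ga be a b.
Proof.
move=> da db; rewrite -[c *: b]addr0 (bal_r bF c da db (wdeg0 wB _ _)).
by rewrite bal_0r // addr0.
Qed.

Lemma bal_Dl al ga be a a' b : hdeg al ga a -> hdeg al ga a' -> hdeg ga be b ->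
  F al ga be (a + a') b = F al ga be a b + F al ga be a' b.
Proof. by move=> da da' db; have := bal_l bF 1 da da' db; rewrite !scale1r. Qed.

Lemma bal_Dr al ga be a b b' : hdeg al ga a -> hdeg ga be b -> hdeg ga be b' ->
  F al ga be a (b + b') = F al ga be a b + F al ga be a b'.
Proof. by move=> da db db'; have := bal_r bF 1 da db db'; rewrite !scale1r. Qed.

Lemma mtlift_rel u : @mtensor_rel R V A B u -> fglift (fun g : key =>
    let: (al, ga, be, a, b) := g in
    if `[< mtensor_ok g >] then F al ga be a b else 0) u = 0.
Proof.
set f := (fun g : key => _).
have fE al ga be a b : hdeg al ga a -> hdeg ga be b -> f (al, ga, be, a, b) = F al ga be a b.
  by move=> da db; rewrite /f asboolT.
have GE k : fglift f << k >> = f k by rewrite liftU scale1r.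
case=> [g|al ga be a a' b da da' db|al ga be a b b' da db db'|c al ga be a b da db|
  c al ga be a b da db|h al ga be a b da db]; rewrite ?fgliftB ?fglift_scalable ?GE.
- by rewrite /f; case: g => [[[[al ga] be] a] b] nok; rewrite asboolF.
- have dd := wdegD wA da da'.
  by rewrite !fE // (bal_Dl da da' db) addrAC addrK subrr.
- have dd := wdegD wB db db'.
  by rewrite !fE // (bal_Dr da db db') addrAC addrK subrr.
- by have dd := wdegZ wA c da; rewrite !fE // bal_Zl // subrr.
- by have dd := wdegZ wB c db; rewrite !fE // bal_Zr // subrr.
- have dd := wmr_deg wA h da; have dd' := wml_deg wB h db.
  by rewrite !fE // (bal_m bF) // subrr.
Qed.

Lemma mtlift_mtens al ga be a b : hdeg al ga a -> hdeg ga be b ->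
  mtlift F (mtens al ga be a b) = F al ga be a b.
Proof.
move=> da db; rewrite /mtlift /mtens (fglift_toquot mtlift_rel) liftU scale1r.
by rewrite asboolT.
Qed.

Lemma mtlift_linear : linear (mtlift F).
Proof.
move=> c x y; rewrite -(toquotK x) -(toquotK y) -toquot_is_linear.
by rewrite /mtlift !(fglift_toquot mtlift_rel) linearP.
Qed.

Lemma mtlift_sum (I : Type) (r : seq I) (Q : pred I) (x : I -> mtensor A B) :
  mtlift F (\sum_(i <- r | Q i) x i) = \sum_(i <- r | Q i) mtlift F (x i).
Proof. exact: lin_sum mtlift_linear _ _ _ _. Qed.

End Balanced.

Notation mt t := (tapp (@mtens R V A B) t).

Lemma mtens_junk al ga be a b : ~ (hdeg al ga a /\ hdeg ga be b) ->
  mtens al ga be a b = 0 :> mtensor A B.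
Proof.
move=> nok; rewrite /mtens; rewrite -[0](raddf0 (toquot (@mtensor_rel R V A B))); apply/toquotP; rewrite subr0; exists [:: (1, << (al, ga, be, a, b) >>)].
split; last by rewrite big_seq1 scale1r.
move=> p; rewrite inE => /eqP -> /=; exact: mtensor_junk.
Qed.

Lemma toquot_rel1 (u v : {freeg key / C}) : @mtensor_rel R V A B (u - v) ->
  toquot (@mtensor_rel R V A B) u = toquot _ v.
Proof.
move=> h; apply/toquotP; exists [:: (1, u - v)]; split; last by rewrite big_seq1 scale1r.
by move=> p; rewrite inE => /eqP ->.
Qed.

Lemma mtens_balanced : balanced (@mtens R V A B).
Proof.
split=> [al ga be c a a' b da da' db|al ga be c a b b' da db db'|f al ga be a b da db].
- rewrite /mtens -toquotZ -(toquot_rel1 (mtensor_scalel c da db)) -toquotD.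
  apply: toquot_rel1; rewrite opprD addrA; apply: mtensor_addl => //; exact: wdegZ.
- rewrite /mtens -toquotZ -(toquot_rel1 (mtensor_scaler c da db)) -toquotD.
  apply: toquot_rel1; rewrite opprD addrA; apply: mtensor_addr => //; exact: wdegZ.
- by apply: toquot_rel1; exact: mtensor_bal.
Qed.

Lemma mtensor_sum (x : mtensor A B) : exists s : seq key,
  (forall t, t \in s -> mtensor_ok t) /\ x = \sum_(t <- s) mt t.
Proof.
(* Coefficients are absorbed by the first factor; ill-formed symbols represent 0 and are dropped. *)
exists [seq (k.1.1.1.1, k.1.1.1.2, k.1.1.2, coeff k (repr x) *: k.1.2, k.2)
         | k <- dom (repr x) & `[< mtensor_ok k >] ]; split.
  move=> t /mapP[[[[[al ga] be] a] b]]; rewrite mem_filter => /andP[/asboolP [da db] _] -> /=.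
  by split=> //; exact: wdegZ.
rewrite big_map big_filter -[LHS]toquotK -{1}[repr x]freeg_sumE.
rewrite raddf_sum (bigID (fun k => `[< mtensor_ok k >])) /= [X in _ + X]big1 ?addr0.
  apply: eq_bigr => -[[[[al ga] be] a] b] /asboolP[da db] /=.
  rewrite (bal_Zl mtens_balanced) // /mtens -toquotZ /=; congr toquot.
  by apply/eqP/freeg_eqP => k; rewrite coeffZ !coeffU mul1r.
move=> k /asboolP nok; have -> : << coeff k (repr x) *g k >> = coeff k (repr x) *: << k >>.
  by apply/eqP/freeg_eqP => l; rewrite coeffZ !coeffU mul1r.
rewrite toquotZ; case: k nok => [[[[al ga] be] a] b] nok.
by rewrite [toquot _ _](mtens_junk nok) scaler0.
Qed.

End Lift.
End Tensor.

Ltac vring := apply: v2r_inj; apply/rowP => ?;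
  rewrite !(linearD, linearN, linear0) !mxE; ring.

(** * Tensor products as prealgebras *)

Section TensorPre.
Variables (R : realType) (V : vectType R[i]).
Notation C := R[i].

(** The counterpart of [wpre] for maps: only homogeneous elements are concerned, so that maps into
    [dual_pre] are covered. *)
Record whom (A A' : hpre V) (phi : A -> A') : Prop := Whom {
  hom_lin : forall al be (c : C) (a b : A), hdeg al be a -> hdeg al be b ->
    phi (c *: a + b) = c *: phi a + phi b;
  hom_deg : forall al be (a : A), hdeg al be a -> hdeg al be (phi a);
  hom_ml : forall f al be (a : A), hdeg al be a -> phi (hml f a) = hml f (phi a);
  hom_mr : forall f al be (a : A), hdeg al be a -> phi (hmr f a) = hmr f (phi a) }.

Lemma prehom_whom (A A' : hpre V) (phi : A -> A') : is_prehom phi -> whom phi.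
Proof. by move=> [lin ml mr deg]; split=> *; by [exact: lin | exact: deg | exact: ml | exact: mr]. Qed.

Lemma whom_id (A : hpre V) : whom (@id A). Proof. by []. Qed.

Section Two.
Variables (A B : hpre V) (wA : wpre A) (wB : wpre B).
Implicit Types (x : tpre A B) (F : V -> V -> V -> A -> B).

Lemma mtlift_mtens_sum (Z : lmodType C) (F : V -> V -> V -> A -> B -> Z) (T : eqType)
    (s : seq T) (al ga be : T -> V) (a : T -> A) (b : T -> B) : balanced F ->
  (forall t, t \in s -> hdeg (al t) (ga t) (a t) /\ hdeg (ga t) (be t) (b t)) ->
  mtlift F (\sum_(t <- s) mtens (al t) (ga t) (be t) (a t) (b t)) =
  \sum_(t <- s) F (al t) (ga t) (be t) (a t) (b t).
Proof.
move=> bF ok; rewrite (mtlift_sum wA wB bF) big_seq [RHS]big_seq.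
by apply: eq_bigr => t /ok[da db]; rewrite (mtlift_mtens wA wB bF).
Qed.

Lemma tml_balanced f : balanced (fun al ga be (a : A) (b : B) => mtens al ga be (hml f a) b).
Proof.
have bm := mtens_balanced wA wB.
split=> [al ga be c a a' b da da' db|al ga be c a b b' da db db'|g al ga be a b da db].
- rewrite (wml_lin wA _ _ da da') (bal_l bm) //; exact: wml_deg.
- rewrite (bal_r bm) //; exact: wml_deg.
- rewrite (wcomm wA _ _ da) (bal_m bm) //; exact: wml_deg.
Qed.

Lemma tmr_balanced f : balanced (fun al ga be (a : A) (b : B) => mtens al ga be a (hmr f b)).
Proof.
have bm := mtens_balanced wA wB.
split=> [al ga be c a a' b da da' db|al ga be c a b b' da db db'|g al ga be a b da db].
- rewrite (bal_l bm) //; exact: wmr_deg.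
- rewrite (wmr_lin wB _ _ db db') (bal_r bm) //; exact: wmr_deg.
- rewrite -(wcomm wB _ _ db) (bal_m bm) //; exact: wmr_deg.
Qed.

Lemma tml_mtens f al ga be (a : A) (b : B) : hdeg al ga a -> hdeg ga be b ->
  hml f (mtens al ga be a b : tpre A B) = mtens al ga be (hml f a) b.
Proof. by move=> da db; rewrite [LHS](mtlift_mtens wA wB (tml_balanced f)). Qed.

Lemma tmr_mtens f al ga be (a : A) (b : B) : hdeg al ga a -> hdeg ga be b ->
  hmr f (mtens al ga be a b : tpre A B) = mtens al ga be a (hmr f b).
Proof. by move=> da db; rewrite [LHS](mtlift_mtens wA wB (tmr_balanced f)). Qed.

Lemma tml_linear f : linear (@hml R V (tpre A B) f).
Proof. exact: mtlift_linear (tml_balanced f). Qed.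

Lemma tmr_linear f : linear (@hmr R V (tpre A B) f).
Proof. exact: mtlift_linear (tmr_balanced f). Qed.

Lemma tdeg_mtens al ga be (a : A) (b : B) : hdeg al ga a -> hdeg ga be b ->
  hdeg al be (mtens al ga be a b : tpre A B).
Proof.
move=> da db; exists [:: (ga, a, b)]; rewrite big_seq1; split=> // t.
by rewrite inE => /eqP ->.
Qed.

Lemma mtensor_ext (Z : lmodType C) (F G : mtensor A B -> Z) : linear F -> linear G ->
  (forall al ga be a b, hdeg al ga a -> hdeg ga be b ->
    F (mtens al ga be a b) = G (mtens al ga be a b)) -> forall x, F x = G x.
Proof.
move=> Fl Gl FG x; have [s [ok ->]] := mtensor_sum wA wB x.
rewrite (lin_sum Fl) (lin_sum Gl) big_seq [RHS]big_seq.
by apply: eq_bigr => -[[[[al ga] be] a] b] /ok[da db]; exact: FG.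
Qed.

Local Notation TL := (@hml R V (tpre A B)).
Local Notation TR := (@hmr R V (tpre A B)).

Lemma wpre_tpre : wpre (tpre A B).
Proof.
have bm := mtens_balanced wA wB.
have lin_comp (Z1 Z2 Z3 : lmodType C) (f : Z2 -> Z3) (g : Z1 -> Z2) :
  linear f -> linear g -> linear (fun z => f (g z)) by move=> fl gl c u v; rewrite gl fl.
have lin_add (Z1 Z2 : lmodType C) (f g : Z1 -> Z2) :
    linear f -> linear g -> linear (fun z => f z + g z).
  by move=> fl gl c u v; rewrite fl gl scalerDr addrACA.
have lin_scale (Z1 : lmodType C) (c : C) : linear (fun z : Z1 => c *: z).
  by move=> d u v; rewrite scalerDr !scalerA mulrC.
split=> [al be|al be c p q [s [sok ->]] [t [tok ->]]|f al be p [s [sok ->]]|f al be p [s [sok ->]]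
  |f al be c p q _ _|f al be c p q _ _|f g al be p _|f g al be p _|f g al be p _|f g al be p _
  |c al be p _|c al be p _|f g al be p _].
- by exists [::]; rewrite big_nil.
- exists ([seq (u.1.1, c *: u.1.2, u.2) | u <- s] ++ t); split.
    move=> u; rewrite mem_cat => /orP[/mapP[v /sok[da db] ->]|/tok //] /=.
    by split=> //; exact: wdegZ.
  rewrite big_cat big_map scaler_sumr; congr (_ + _); rewrite big_seq [RHS]big_seq.
  by apply: eq_bigr => u /sok[da db]; rewrite (bal_Zl wA bm).
- exists [seq (u.1.1, hml f u.1.2, u.2) | u <- s]; split.
    by move=> u /mapP[v /sok[da db] ->] /=; split=> //; exact: wml_deg.
  by rewrite [LHS](mtlift_mtens_sum (tml_balanced f) sok) big_map.
- exists [seq (u.1.1, u.1.2, hmr f u.2) | u <- s]; split.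
    by move=> u /mapP[v /sok[da db] ->] /=; split=> //; exact: wmr_deg.
  by rewrite [LHS](mtlift_mtens_sum (tmr_balanced f) sok) big_map.
- exact: tml_linear.
- exact: tmr_linear.
- apply: (@mtensor_ext (tpre A B) (TL (f + g)) (fun p => TL f p + TL g p)).
  + exact: tml_linear.
  + by apply: lin_add; exact: tml_linear.
  + move=> al' ga' be' a b da db; rewrite !tml_mtens // (wmlD wA _ _ da).
    by rewrite (bal_Dl bm) //; exact: wml_deg.
- apply: (@mtensor_ext (tpre A B) (TR (f + g)) (fun p => TR f p + TR g p)).
  + exact: tmr_linear.
  + by apply: lin_add; exact: tmr_linear.
  + move=> al' ga' be' a b da db; rewrite !tmr_mtens // (wmrD wB _ _ db).
    by rewrite (bal_Dr bm) //; exact: wmr_deg.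
- apply: (@mtensor_ext (tpre A B) (TL (f * g)) (fun p => TL f (TL g p))).
  + exact: tml_linear.
  + by apply: (@lin_comp (tpre A B) (tpre A B)); exact: tml_linear.
  + move=> al' ga' be' a b da db; have dg := wml_deg wA g da.
    by rewrite !tml_mtens // (wmlM wA _ _ da).
- apply: (@mtensor_ext (tpre A B) (TR (f * g)) (fun p => TR f (TR g p))).
  + exact: tmr_linear.
  + by apply: (@lin_comp (tpre A B) (tpre A B)); exact: tmr_linear.
  + move=> al' ga' be' a b da db; have dg := wmr_deg wB g db.
    by rewrite !tmr_mtens // (wmrM wB _ _ db).
- apply: (@mtensor_ext (tpre A B) (TL c%:A) (fun p => c *: p)) => //.
    exact: tml_linear.
  by move=> al' ga' be' a b da db; rewrite tml_mtens // (wml_cst wA _ da) (bal_Zl wA bm).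
- apply: (@mtensor_ext (tpre A B) (TR c%:A) (fun p => c *: p)) => //.
    exact: tmr_linear.
  by move=> al' ga' be' a b da db; rewrite tmr_mtens // (wmr_cst wB _ db) (bal_Zr wB bm).
- apply: (@mtensor_ext (tpre A B) (fun p => TL f (TR g p)) (fun p => TR g (TL f p))).
  + by apply: (@lin_comp (tpre A B) (tpre A B)); [exact: tml_linear|exact: tmr_linear].
  + by apply: (@lin_comp (tpre A B) (tpre A B)); [exact: tmr_linear|exact: tml_linear].
  + move=> al' ga' be' a b da db; have dg := wmr_deg wB g db; have df := wml_deg wA f da.
    by rewrite !(tml_mtens, tmr_mtens).
Qed.

End Two.

Section Map.
Variables (A A' B B' : hpre V).
Hypotheses (wA : wpre A) (wA' : wpre A') (wB : wpre B) (wB' : wpre B').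
Variables (phi : A -> A') (psi : B -> B').
Hypotheses (hphi : whom phi) (hpsi : whom psi).

Lemma balanced_comp (Z : lmodType C) (F : V -> V -> V -> A' -> B' -> Z) : balanced F ->
  balanced (fun al ga be a b => F al ga be (phi a) (psi b)).
Proof.
move=> bF.
split=> [al ga be c a a' b da da' db|al ga be c a b b' da db db'|f al ga be a b da db].
- rewrite (hom_lin hphi _ da da') (bal_l bF) //; [exact: hom_deg hphi _ _ _ da|
    exact: hom_deg hphi _ _ _ da'|exact: hom_deg hpsi _ _ _ db].
- rewrite (hom_lin hpsi _ db db') (bal_r bF) //; [exact: hom_deg hphi _ _ _ da|
    exact: hom_deg hpsi _ _ _ db|exact: hom_deg hpsi _ _ _ db'].
- rewrite (hom_mr hphi _ da) (hom_ml hpsi _ db) (bal_m bF) //;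
    [exact: hom_deg hphi _ _ _ da|exact: hom_deg hpsi _ _ _ db].
Qed.

Lemma tmap_linear : linear (tmap phi psi).
Proof. exact: (mtlift_linear wA wB (balanced_comp (mtens_balanced wA' wB'))). Qed.

Lemma tmap_mtens al ga be (a : A) (b : B) : hdeg al ga a -> hdeg ga be b ->
  tmap phi psi (mtens al ga be a b) = mtens al ga be (phi a) (psi b).
Proof.
by move=> da db; rewrite [LHS](mtlift_mtens wA wB (balanced_comp (mtens_balanced wA' wB'))).
Qed.

Lemma mtlift_tmap (Z : lmodType C) (F : V -> V -> V -> A' -> B' -> Z) : balanced F ->
  forall x, mtlift F (tmap phi psi x) =
    mtlift (fun al ga be a b => F al ga be (phi a) (psi b)) x.
Proof.
move=> bF; apply: (mtensor_ext wA wB (F := fun x => mtlift F (tmap phi psi x))).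
- by move=> c x y; rewrite tmap_linear (mtlift_linear wA' wB' bF).
- exact: mtlift_linear (balanced_comp bF).
- move=> al ga be a b da db; rewrite tmap_mtens //.
  rewrite (mtlift_mtens wA' wB' bF) ?(mtlift_mtens wA wB (balanced_comp bF)) //.
    exact: hom_deg hphi _ _ _ da.
  exact: hom_deg hpsi _ _ _ db.
Qed.

End Map.

Section Three.
Variables (A B E : hpre V) (wA : wpre A) (wB : wpre B) (wE : wpre E).

Let wBE := wpre_tpre wB wE.
Let wAB := wpre_tpre wA wB.

Lemma tassoc_inner be (e : E) : balanced (fun al' de ga' (a : A) (b : B) =>
    mtens al' de be a (mtens de ga' be b e : tpre B E)).
Proof.
have bm := mtens_balanced wA wBE; have bm' := mtens_balanced wB wE.
(* When e is not homogeneous of bidegree (ga', be), the inner symbol is zero. *)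
have z al' de ga' (a : A) (b : B) : hdeg al' de a -> ~ hdeg ga' be e ->
    mtens al' de be a (mtens de ga' be b e : tpre B E) = 0.
  move=> da ne; have -> : mtens de ga' be b e = 0 :> tpre B E by apply: mtens_junk => -[].
  exact: (bal_0r wBE bm).
split=> [al' de ga' c a a' b da da' db|al' de ga' c a b b' da db db'|f al' de ga' a b da db];
  (have [de'|ne] := pselect (hdeg ga' be e); last first).
- by rewrite !z ?scaler0 ?addr0 //; apply: wdeg_lin.
- by rewrite (bal_l bm) //; exact: tdeg_mtens.
- by rewrite !z ?scaler0 ?addr0.
- rewrite (bal_l bm') // (bal_r bm) //; exact: tdeg_mtens.
- by rewrite !z //; exact: wmr_deg.
- rewrite (bal_m bm) //; last exact: tdeg_mtens.
  by rewrite (tml_mtens wB wE).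
Qed.

Lemma tassoc_balanced : balanced (fun al ga be (x : tpre A B) (e : E) =>
  mtlift (fun al' de ga' a b => mtens al' de be a (mtens de ga' be b e : tpre B E)) x).
Proof.
have bm := mtens_balanced wA wBE; have bm' := mtens_balanced wB wE.
split=> [al ga be c x x' e _ _ _|al ga be c x e e' [s [sok ->]] de de'|f al ga be x e [s [sok ->]] de].
- exact: mtlift_linear (tassoc_inner be e) _ _ _.
- rewrite !(mtlift_mtens_sum wA wB (tassoc_inner _ _) sok) scaler_sumr -big_split /=.
  apply: eq_big_seq => t /sok[da db].
  by rewrite (bal_r bm') // (bal_r bm) //; exact: tdeg_mtens.
- rewrite [hmr f _](mtlift_mtens_sum wA wB (tmr_balanced wA wB f) sok).
  rewrite (mtlift_mtens_sum wA wB (tassoc_inner _ _) sok).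
  rewrite (mtlift_mtens_sum wA wB (tassoc_inner _ _)) => [|t /sok[da db]]; last first.
    by split=> //; exact: wmr_deg.
  apply: eq_big_seq => t /sok[da db].
  by rewrite (bal_m bm').
Qed.

Lemma tassoc_linear : linear (@tassoc R V A B E).
Proof. exact: (mtlift_linear wAB wE tassoc_balanced). Qed.

End Three.
End TensorPre.

(** * Separating evaluations *)

Section Slice.
Variables (R : realType) (V : vectType R[i]).
Notation M := (mero V).

Record msub (P : zmodType) (act : M -> P -> P) (N : set P) : Prop := Msub {
  msub0 : N 0;
  msubD : forall p q, N p -> N q -> N (p + q);
  msub_act : forall f p, N p -> N (act f p) }.

(** A vector space over M carried by a subset of P. For the dual, the moment maps satisfy these laws
    on each bidegree and not on the ambient space of functions. *)
Record mmod (P : zmodType) (act : M -> P -> P) (N : set P) : Prop := Mmod {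
  mmod_sub : msub act N;
  actDr : forall f p q, N p -> N q -> act f (p + q) = act f p + act f q;
  actDl : forall f g p, N p -> act (f + g) p = act f p + act g p;
  actM : forall f g p, N p -> act (f * g) p = act f (act g p);
  act1 : forall p, N p -> act 1 p = p }.

Section MmodTheory.
Variables (P : zmodType) (act : M -> P -> P) (D : set P) (mD : mmod act D).

Lemma act0 p : D p -> act 0 p = 0.
Proof.
by move=> Dp; apply: (addIr (act 0 p)); rewrite -(actDl mD) // !add0r.
Qed.

Lemma actN1 p : D p -> act (-1) p = - p.
Proof.
move=> Dp; apply/eqP; rewrite -addr_eq0 -{2}(act1 mD Dp) -(actDl mD) //.
by rewrite addNr act0.
Qed.

Lemma act0r f : act f 0 = 0.
Proof.
have D0 := msub0 (mmod_sub mD).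
by apply: (addIr (act f 0)); rewrite -(actDr mD) // !add0r.
Qed.

Lemma msubB N p q : msub act N -> N `<=` D -> N p -> N q -> N (p - q).
Proof.
move=> sN ND Np Nq; apply: (msubD sN) => //; rewrite -actN1; last exact: ND.
exact: (msub_act sN).
Qed.

Lemma msub_sum N (I : eqType) (r : seq I) (Q : pred I) (F : I -> P) : msub act N ->
  (forall i, i \in r -> Q i -> N (F i)) -> N (\sum_(i <- r | Q i) F i).
Proof.
move=> sN h; rewrite big_seq_cond; elim/big_ind: _; [exact: msub0 sN|exact: msubD sN|].
by move=> i /andP[ir Qi]; exact: h.
Qed.

Lemma act_sum f (I : eqType) (r : seq I) (F : I -> P) :
  (forall i, i \in r -> D (F i)) ->
  act f (\sum_(i <- r) F i) = \sum_(i <- r) act f (F i).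
Proof.
elim: r => [|i r IH] h; first by rewrite !big_nil act0r.
rewrite !big_cons (actDr mD) ?IH //; first by move=> k kr; apply: h; rewrite inE kr orbT.
- by apply: h; rewrite inE eqxx.
- apply: (msub_sum (mmod_sub mD)) => k kr _; apply: h; by rewrite inE kr orbT.
Qed.

End MmodTheory.

(* If all the slices (phi_i (x) id) x of a tensor x = sum_t p_t (x) q_t lie in N2, then
   x is a sum of tensors with second factor in N2: when phi_i p_1 <> 0, the slice
   by phi_i expresses q_1 through an element of N2 and the other q_t, which shortens
   the sum. *)
Lemma slice (P Q Z : zmodType) (aP : M -> P -> P) (aQ : M -> Q -> Q)
    (DP : set P) (DQ : set Q) (T : P -> Q -> Z)
    (I : Type) (phi : I -> P -> M) (N1 : set P) (N2 : set Q) (s : seq (P * Q)) :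
  mmod aP DP -> mmod aQ DQ ->
  (forall p p' q, DP p -> DP p' -> DQ q -> T (p + p') q = T p q + T p' q) ->
  (forall p q q', DP p -> DQ q -> DQ q' -> T p (q + q') = T p q + T p q') ->
  (forall f p q, DP p -> DQ q -> T (aP f p) q = T p (aQ f q)) ->
  (forall i p p', DP p -> DP p' -> phi i (p + p') = phi i p + phi i p') ->
  (forall i f p, DP p -> phi i (aP f p) = f * phi i p) ->
  (forall p, DP p -> (forall i, phi i p = 0) -> p = 0) ->
  msub aP N1 -> N1 `<=` DP -> msub aQ N2 -> N2 `<=` DQ ->
  (forall t, t \in s -> N1 t.1 /\ DQ t.2) ->
  (forall i, N2 (\sum_(t <- s) aQ (phi i t.1) t.2)) ->
  exists s' : seq (P * Q), (forall t, t \in s' -> N1 t.1 /\ N2 t.2) /\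
    \sum_(t <- s) T t.1 t.2 = \sum_(t <- s') T t.1 t.2.
Proof.
move=> mP mQ TDl TDr Tb phiD phiM phi0 sN1 N1D sN2 N2D.
have sP := mmod_sub mP; have sQ := mmod_sub mQ.
have T0 q : DQ q -> T 0 q = 0.
  move=> Dq; have := TDl 0 0 q (msub0 sP) (msub0 sP) Dq; rewrite addr0 => /eqP.
  by rewrite -subr_eq subrr => /eqP.
have T0r p : DP p -> T p 0 = 0.
  move=> Dp; have := TDr p 0 0 Dp (msub0 sQ) (msub0 sQ); rewrite addr0 => /eqP.
  by rewrite -subr_eq subrr => /eqP.
have Tsum p (K : eqType) (r : seq K) (F : K -> Q) : DP p ->
    (forall i, i \in r -> DQ (F i)) -> T p (\sum_(i <- r) F i) = \sum_(i <- r) T p (F i).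
  move=> Dp; elim: r => [|i r IH] h; first by rewrite !big_nil T0r.
  have h' k : k \in r -> DQ (F k) by move=> kr; apply: h; rewrite inE kr orbT.
  rewrite !big_cons TDr ?IH //; first by apply: h; rewrite inE eqxx.
  by apply: (msub_sum sQ) => k kr _; exact: h'.
move: {2}(size s) (erefl (size s)) => n; elim: n s => [|n IH] s sn sN sl.
  by exists [::]; rewrite (size0nil sn) !big_nil.
(* If every coefficient vanishes, so do the first factors, and the empty sum represents the
   tensor. *)
have [h|nz] := pselect (forall t, t \in s -> forall i, phi i t.1 = 0).
  exists [::]; split=> //; rewrite big_nil big_seq big1 // => t ts.
  have [N1t Dt] := sN t ts; rewrite (phi0 t.1) ?T0 //; last exact: h.
  exact: N1D.
have [t0 t0s [i0 u0]] : exists2 t, t \in s & exists i, phi i t.1 <> 0.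
  apply: contrapT => h; apply: nz => t ts i; apply: contrapT => hi.
  by apply: h; exists t => //; exists i.
have [w wu] := mero_inverse (introN eqP u0); rewrite mulrC in wu.
pose r := rem t0 s; have ps := perm_to_rem t0s.
have rs t : t \in r -> t \in s by exact: mem_rem.
have [N10 D0] := sN _ t0s; have DP0 := N1D _ N10.
pose u (t : P * Q) := phi i0 t.1; pose nu := \sum_(t <- s) aQ (u t) t.2.
have Nnu : N2 nu := sl i0.
have Nw : N2 (aQ w nu) := msub_act sN2 w Nnu.
have DP' t : t \in s -> DP t.1 by move=> /sN[/N1D].
have DQ' t : t \in s -> DQ t.2 by move=> /sN[].
have Dact f t : t \in s -> DQ (aQ f t.2) by move=> /DQ' ?; exact: (msub_act sQ).
have wnu : aQ w nu = t0.2 + \sum_(t <- r) aQ (w * u t) t.2.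
  rewrite /nu (act_sum mQ) => [|t ts]; last exact: Dact.
  rewrite (perm_big _ ps) big_cons -(actM mQ) // wu (act1 mQ) //; congr (_ + _).
  by apply: eq_big_seq => t /rs ts; rewrite (actM mQ) //; exact: DQ'.
(* Solving [wnu] for the second factor of t0 and moving the coefficients across the tensor sign
   changes the first factors of the other terms into these. *)
pose v (t : P * Q) := (t.1 + aP (- (w * u t)) t0.1, t.2).
have Nv t : t \in s -> N1 (v t).1.
  by move=> ts; apply: (msubD sN1); [have [] := sN t ts|exact: (msub_act sN1)].
have Da f : DP (aP f t0.1) by exact: (msub_act sP).
have [|||s' [s'N e]] := IH [seq v t | t <- r].
- by rewrite size_map (size_rem t0s) sn.
- by move=> _ /mapP[t /rs ts ->]; split; [exact: (Nv t)|exact: (DQ' t)].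
(* The slices of the shortened family differ from the old ones by multiples of [aQ w nu], hence stay
   in N2. *)
- move=> i; rewrite big_map.
  have -> : \sum_(t <- r) aQ (phi i (v t).1) (v t).2 =
      \sum_(t <- s) aQ (phi i t.1) t.2 - aQ (phi i t0.1) (aQ w nu).
    rewrite (perm_big _ ps) big_cons wnu (actDr mQ) //; last first.
      by apply: (msub_sum sQ) => t /rs ts _; exact: Dact.
    rewrite (act_sum mQ) => [|t /rs ts]; last exact: Dact.
    rewrite opprD addrACA subrr add0r -sumrB.
    apply: eq_big_seq => t /rs ts /=.
    have Dt := DQ' t ts.
    rewrite phiD ?phiM //; last exact: DP'.
    rewrite (actDl mQ) //; congr (_ + _).
    have <- := actN1 mQ (msub_act sQ (phi i t0.1) (Dact (w * u t) t ts)).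
    rewrite -!(actM mQ) //; try by exact: (msub_act sQ).
    by congr (aQ _ _); ring.
  apply: (msubB mQ sN2 N2D) => //; exact: (msub_act sN2).
exists ((t0.1, aQ w nu) :: s'); split.
  by move=> t; rewrite inE => /orP[/eqP -> //|/s'N].
rewrite big_cons -e big_map (perm_big _ ps) big_cons wnu TDr //; last first.
  by apply: (msub_sum sQ) => t /rs ts _; exact: Dact.
rewrite -addrA; congr (_ + _); rewrite Tsum // => [|t /rs ts]; last exact: Dact.
rewrite -big_split /=; apply: eq_big_seq => t /rs ts.
have Dt := DQ' t ts; rewrite TDl //; last exact: DP'.
rewrite -Tb // [X in _ = X]addrCA -TDl // -(actDl mP) // subrr (act0 mP) //.
by rewrite T0 // addr0.
Qed.

End Slice.

(** * Prealgebras separated by evaluations *)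

Section Evaluations.
Variables (R : realType) (V : vectType R[i]).
Notation M := (mero V).
Notation D := (diffop V).

(* A family of evaluations ev_i : P -> D_h separating the homogeneous elements; an index
   i of degree (k i, l i) plays the role of an element of the coalgebroid on which the
   elements of P are functionals. *)
Record separated (P : hpre V) (I : Type) (k l : I -> V) (ev : I -> P -> D) : Prop :=
  Separated {
  sep_wpre : wpre P;
  ev_linear : forall i, linear (ev i);
  ev_deg : forall i al be (p : P), hdeg al be p -> dhdeg (k i + be) (l i + al) (ev i p);
  ev_ml : forall i f al be (p : P), hdeg al be p -> ev i (hml f p) = mop f * ev i p;
  ev_mr : forall i f al be (p : P), hdeg al be p ->
    ev i (hmr f p) = mop (shift (- k i) f) * ev i p;
  ev_sep : forall al be (p : P), hdeg al be p -> (forall i, ev i p = 0) -> p = 0 }.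

Lemma mmod_ml (P : hpre V) (wP : wpre P) al be : mmod (@hml R V P) (hdeg al be).
Proof.
split=> [|f p q dp dq|f g p dp|f g p dp|p dp].
- split=> [|p q|f p]; [exact: wdeg0|exact: wdegD|exact: wml_deg].
- exact: wmlDr dp dq.
- exact: wmlD dp.
- exact: wmlM dp.
- exact: wml1 dp.
Qed.

Lemma mmod_mr (P : hpre V) (wP : wpre P) al be : mmod (@hmr R V P) (hdeg al be).
Proof.
split=> [|f p q dp dq|f g p dp|f g p dp|p dp].
- split=> [|p q|f p]; [exact: wdeg0|exact: wdegD|exact: wmr_deg].
- exact: wmrDr dp dq.
- exact: wmrD dp.
- exact: wmrM dp.
- exact: wmr1 dp.
Qed.

Section OnePre.
Variables (P : hpre V) (I : Type) (k l : I -> V) (ev : I -> P -> D).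
Hypothesis sP : separated k l ev.

Lemma ev_sum i (T : Type) (r : seq T) (Q : pred T) (F : T -> P) :
  ev i (\sum_(t <- r | Q t) F t) = \sum_(t <- r | Q t) ev i (F t).
Proof. exact: (lin_sum (ev_linear sP i)). Qed.

Lemma ev0 i : ev i 0 = 0. Proof. exact: (lin0 (ev_linear sP i)). Qed.
Lemma evD i p q : ev i (p + q) = ev i p + ev i q. Proof. exact: (linD (ev_linear sP i)). Qed.

Lemma separated_direct (F : V * V -> P) (s : seq (V * V)) : uniq s ->
  (forall i, i \in s -> hdeg i.1 i.2 (F i)) -> \sum_(i <- s) F i = 0 ->
  forall i, i \in s -> F i = 0.
Proof.
move=> us dF F0 t ts; apply: (ev_sep sP (dF t ts)) => i.
apply: (@dhdeg_direct R V (k i) (l i) (fun t => ev i (F t)) s us _ _ t ts).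
  by move=> j js; exact: ev_deg sP _ _ _ _ (dF j js).
by rewrite -ev_sum F0 ev0.
Qed.

(* The coefficient of ev i p, transported so that the slice by i of p (x) q is
   the multiple of q by it. *)
Definition lcoef i p : M := shift (k i) (ev i p 1).

Lemma lcoefD i p q : lcoef i (p + q) = lcoef i p + lcoef i q.
Proof. by rewrite /lcoef evD shiftD. Qed.

Lemma lcoef_mr i f al be p : hdeg al be p -> lcoef i (hmr f p) = f * lcoef i p.
Proof.
by move=> dp; rewrite /lcoef (ev_mr sP _ _ dp) dmulE dopE shift0 shiftM shiftK.
Qed.

Lemma lcoef_sep al be p : hdeg al be p -> (forall i, lcoef i p = 0) -> p = 0.
Proof.
move=> dp p0; apply: (ev_sep sP dp) => i.
rewrite (dhdegEl (ev_deg sP i dp)) (_ : ev i p 1 = 0) ?raddf0 ?mul0r //.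
by apply: (@shift_inj R V (k i)); rewrite -/(lcoef i p) p0 raddf0.
Qed.

Lemma ev_lcoef i al be p : hdeg al be p ->
  ev i p = tau (- k i) * mop (lcoef i p) * tau (- be).
Proof.
move=> dp; rewrite [LHS](dhdegEl (ev_deg sP i dp)) tau_mop /lcoef shiftNK -mulrA -tauD.
by rewrite opprD.
Qed.

End OnePre.

Lemma rcoef_ml (Q : hpre V) (J : Type) (k l : J -> V) (ev : J -> Q -> D) :
  separated k l ev -> forall j f al be q, hdeg al be q ->
  ev j (hml f q) 1 = f * ev j q 1.
Proof. by move=> sQ j f al be q dq; rewrite (ev_ml sQ _ _ dq) dmulE dopE shift0. Qed.

Section TwoPre.
Variables (P Q : hpre V) (I J : Type) (k l : I -> V) (k' l' : J -> V).
Variables (ev : I -> P -> D) (ev' : J -> Q -> D).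
Hypotheses (sP : separated k l ev) (sQ : separated k' l' ev').

Let wP := sep_wpre sP.
Let wQ := sep_wpre sQ.

(** The formula of [iota]. The translation by the middle degree makes the expression balanced over
    M. *)
Definition evt (ij : I * J) : mtensor P Q -> D :=
  mtlift (fun al ga be p q => ev ij.1 p * tau ga * ev' ij.2 q).

(** The shift by [ga] cancels the one due to the bidegree of p, so that only the degree of the index
    remains. *)
Lemma ev_tau_mop i f al ga p : hdeg al ga p ->
  ev i p * tau ga * mop f = mop (shift (- k i) f) * (ev i p * tau ga).
Proof.
move=> dp; rewrite -mulrA tau_mop mulrA (dhdeg_mop_commute _ (ev_deg sP i dp)).
by rewrite shift_shift opprD -addrA addNr addr0 mulrA.
Qed.

Lemma evt_balanced i j : balanced (fun (al ga be : V) p q => ev i p * tau ga * ev' j q).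
Proof.
split=> [al ga be c a a' b da da' db|al ga be c a b b' da db db'|f al ga be a b da db].
- by rewrite (ev_linear sP) !mulrDl !scalerAl.
- by rewrite (ev_linear sQ) mulrDr scalerAr.
- by rewrite (ev_mr sP _ _ da) (ev_ml sQ _ _ db) [RHS]mulrA (ev_tau_mop i f da) -!mulrA.
Qed.

Lemma evt_mtens i j al ga be p q : hdeg al ga p -> hdeg ga be q ->
  evt (i, j) (mtens al ga be p q) = ev i p * tau ga * ev' j q.
Proof. by move=> dp dq; rewrite /evt (mtlift_mtens wP wQ (evt_balanced i j)). Qed.

Lemma evt_mtens_sum i j (T : eqType) (s : seq T) (al ga be : T -> V) (p : T -> P) (q : T -> Q) :
  (forall t, t \in s -> hdeg (al t) (ga t) (p t) /\ hdeg (ga t) (be t) (q t)) ->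
  evt (i, j) (\sum_(t <- s) mtens (al t) (ga t) (be t) (p t) (q t)) =
  \sum_(t <- s) ev i (p t) * tau (ga t) * ev' j (q t).
Proof. by move=> ok; rewrite /evt (mtlift_mtens_sum wP wQ (evt_balanced i j) ok). Qed.

Lemma evt_deg i j al ga be p q : hdeg al ga p -> hdeg ga be q ->
  dhdeg (k i + k' j + be) (l i + l' j + al) (ev i p * tau ga * ev' j q).
Proof.
move=> dp dq.
have := dhdegM (dhdegM (ev_deg sP i dp) (dhdeg_tau ga)) (ev_deg sQ j dq).
congr dhdeg; vring.
Qed.

Lemma slice_left al ga be (N1 : set P) (N2 : set Q) (s : seq (P * Q)) :
  msub (@hmr R V P) N1 -> N1 `<=` hdeg al ga -> msub (@hml R V Q) N2 -> N2 `<=` hdeg ga be ->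
  (forall t, t \in s -> N1 t.1 /\ hdeg ga be t.2) ->
  (forall i, N2 (\sum_(t <- s) hml (lcoef k ev i t.1) t.2)) ->
  exists s' : seq (P * Q), (forall t, t \in s' -> N1 t.1 /\ N2 t.2) /\
    \sum_(t <- s) mtens al ga be t.1 t.2 = \sum_(t <- s') mtens al ga be t.1 t.2.
Proof.
have bm := mtens_balanced wP wQ.
apply: (slice (T := mtens al ga be) (mmod_mr wP al ga) (mmod_ml wQ ga be)).
- by move=> p p' q dp dp' dq; rewrite (bal_Dl bm).
- by move=> p q q' dp dq dq'; rewrite (bal_Dr bm).
- by move=> f p q dp dq; rewrite (bal_m bm).
- by move=> i p p' dp dp'; exact: (lcoefD sP).
- by move=> i f p dp; exact: (lcoef_mr sP i f dp).
- by move=> p; exact: (lcoef_sep sP).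
Qed.

(** [slice] with the factors exchanged. The coefficient [ev' j q 1] needs no transport, since the
    left moment map of Q becomes left multiplication of the value. *)
Lemma slice_right al ga be (N1 : set P) (N2 : set Q) (s : seq (P * Q)) :
  msub (@hmr R V P) N1 -> N1 `<=` hdeg al ga -> msub (@hml R V Q) N2 -> N2 `<=` hdeg ga be ->
  (forall t, t \in s -> hdeg al ga t.1 /\ N2 t.2) ->
  (forall j, N1 (\sum_(t <- s) hmr (ev' j t.2 1) t.1)) ->
  exists s' : seq (P * Q), (forall t, t \in s' -> N1 t.1 /\ N2 t.2) /\
    \sum_(t <- s) mtens al ga be t.1 t.2 = \sum_(t <- s') mtens al ga be t.1 t.2.
Proof.
have bm := mtens_balanced wP wQ => sN1 N1D sN2 N2D sN sl.
have [||||||||||||s' [s'N e]] := @slice R V Q P (mtensor P Q) (@hml R V Q) (@hmr R V P)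
  (hdeg ga be) (hdeg al ga) (fun q p => mtens al ga be p q) J (fun j q => ev' j q 1) N2 N1
  [seq (t.2, t.1) | t <- s] (mmod_ml wQ ga be) (mmod_mr wP al ga) => //.
- by move=> q q' p dq dq' dp; rewrite (bal_Dr bm).
- by move=> q p p' dq dp dp'; rewrite (bal_Dl bm).
- by move=> f q p dq dp; rewrite (bal_m bm).
- by move=> j q q' dq dq'; rewrite (evD sQ).
- by move=> j f q dq; exact: (rcoef_ml sQ j f dq).
- move=> q dq q0; apply: (ev_sep sQ dq) => j.
  by rewrite (dhdegEl (ev_deg sQ j dq)) q0 raddf0 mul0r.
- by move=> _ /mapP[t /sN[dp Nq] ->].
- by move=> j; rewrite big_map.
exists [seq (t.2, t.1) | t <- s']; split; first by move=> _ /mapP[t /s'N[Nq Np] ->].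
by rewrite !big_map in e *.
Qed.

(* An element of the kernel of all evaluations: its components of middle degree g have
   vanishing slices by every i, because ev i p = 0 unless k i + g = l i + al. *)
Lemma evt_sep al be (x : tpre P Q) : hdeg al be x -> (forall ij, evt ij x = 0) -> x = 0.
Proof.
move=> [s [sok ->]] ev0s; rewrite (big_group (fun t => t.1.1)) /=.
rewrite big1 // => g _; rewrite -big_filter.
pose sg := [seq (t.1.2, t.2) | t <- s & t.1.1 == g].
have sgok t : t \in sg -> hdeg al g t.1 /\ hdeg g be t.2.
  move=> /mapP[u]; rewrite mem_filter => /andP[/eqP <- /sok[dp dq]] ->.
  by split.
(* With N2 reduced to 0, vanishing slices allow the tensor to be rewritten with all second factors
   equal to 0. *)
have [||||||s' [s'N e]] := @slice_left al g be (hdeg al g) [set 0] sg.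
- exact: mmod_sub (mmod_mr wP al g).
- by [].
- split=> // [p q -> ->|f p ->]; rewrite ?addr0 //; exact: wml0r.
- by move=> q ->; exact: wdeg0.
- exact: sgok.
- move=> i /=; have dsum : hdeg g be (\sum_(t <- sg) hml (lcoef k ev i t.1) t.2).
    by apply: (wdeg_sum wQ) => t /sgok[_ dq] _; exact: wml_deg.
  apply: (ev_sep sQ dsum) => j; rewrite (ev_sum sQ).
  suff h : tau (- k i) * \sum_(t <- sg) ev' j (hml (lcoef k ev i t.1) t.2) = 0.
    by rewrite -[LHS]mul1r -(tauK (k i)) -mulrA h mulr0.
  have := ev0s (i, j); rewrite (evt_mtens_sum i j (al := fun=> al) (be := fun=> be) sok).
  rewrite (bigID (fun t => t.1.1 == g)) /=; have [kl|kl] := eqVneq (k i + g) (l i + al); last first.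
    move=> _; rewrite big_seq big1 ?mulr0 // => t /sgok[dp dq].
    rewrite (_ : lcoef _ _ _ _ = 0) ?(wml0 wQ dq) ?(ev0 sQ) //.
    rewrite /lcoef (_ : ev i t.1 = 0) ?raddf0 //.
    by apply: contrapT => /(dhdeg_neq0 (ev_deg sP i dp)); apply/eqP.
  rewrite [X in _ + X]big_seq_cond [X in _ + X]big1 ?addr0 => [|t /andP[/sok[dp dq] tg]]; last first.
    rewrite (_ : ev i t.1.2 = 0) ?mul0r //.
    apply: contrapT => /(dhdeg_neq0 (ev_deg sP i dp)); rewrite -kl => /addrI tg'.
    by rewrite tg' eqxx in tg.
  move=> h; rewrite -[RHS]h -[RHS]big_filter mulr_sumr big_map.
  apply: eq_big_seq => t; rewrite mem_filter => /andP[_ /sok[dp dq]] /=.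
  by rewrite (ev_ml sQ _ _ dq) (ev_lcoef sP i dp) -!mulrA (mulrA (tau _) (tau _)) tauNK mul1r.
transitivity (\sum_(t <- sg) mtens al g be t.1 t.2).
  rewrite big_map; apply: eq_big_seq => t.
  by rewrite mem_filter => /andP[/eqP -> _].
rewrite e big_seq big1 // => t /s'N[dp ->].
exact: (bal_0r wQ (mtens_balanced wP wQ)).
Qed.

(** Separation passes to tensor products and so to triple ones, where coassociativity is tested. *)
Lemma separated_tpre : @separated (tpre P Q) (I * J) (fun ij => k ij.1 + k' ij.2)
  (fun ij => l ij.1 + l' ij.2) evt.
Proof.
have lin ij : linear (evt ij) := mtlift_linear wP wQ (evt_balanced ij.1 ij.2).
split=> [|//|[i j] al be x|[i j] f al be x [s [sok ->]]|[i j] f al be x [s [sok ->]]|].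
- exact: wpre_tpre.
- move=> [s [sok ->]]; rewrite (evt_mtens_sum i j sok) big_seq; apply: dhdeg_sum => t /sok[dp dq].
  exact: evt_deg.
- rewrite [hml f _](mtlift_mtens_sum wP wQ (tml_balanced wP wQ f) sok).
  rewrite !evt_mtens_sum // => [|t /sok[dp dq]]; last by split=> //; exact: wml_deg.
  rewrite mulr_sumr; apply: eq_big_seq => t /sok[dp dq].
  by rewrite (ev_ml sP _ _ dp) !mulrA.
- rewrite [hmr f _](mtlift_mtens_sum wP wQ (tmr_balanced wP wQ f) sok).
  rewrite !evt_mtens_sum // => [|t /sok[dp dq]]; last by split=> //; exact: wmr_deg.
  rewrite mulr_sumr; apply: eq_big_seq => t /sok[dp dq] /=.
  by rewrite (ev_mr sQ _ _ dq) [LHS]mulrA (ev_tau_mop i _ dp) shift_shift opprD !mulrA.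
- exact: evt_sep.
Qed.

End TwoPre.
End Evaluations.

(** * The dual algebra *)

Section Conv.
Variables (R : realType) (V : vectType R[i]).
Notation C := R[i].
Notation D := (diffop V).

(** The part of [dual_deg] that does not depend on the bidegree of phi; it therefore survives sums
    of functionals of different bidegrees. *)
Record dualfun (P : hpre V) (phi : P -> D) : Prop := Dualfun {
  df_lin : linear phi;
  df_ml : forall f al be (p : P), hdeg al be p -> phi (hml f p) = mop f * phi p;
  df_mr : forall f al be (p : P), hdeg al be p -> phi (hmr f p) = phi p * mop (shift be f) }.

(** Convolution before composition with a coproduct. Two distinct prealgebras are allowed so that it
    can be iterated and applied to [Dh]. *)
Definition mconv (P Q : hpre V) (phi : P -> D) (psi : Q -> D) (x : mtensor P Q) : D :=
  mtlift (fun al ga be p q => phi p * tau ga * psi q) x.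

Lemma mconv_linl (P Q : hpre V) (c : C) (phi phi' : P -> D) (psi : Q -> D) x :
  mconv (c *: phi + phi') psi x = c *: mconv phi psi x + mconv phi' psi x.
Proof.
have [L [_ Le]] := mtlift_expand x; rewrite /mconv !Le scaler_sumr -big_split /=.
apply: eq_bigr => -[d [[[[al ga] be] p] q]] _ /=.
by rewrite !mulrDl -!scalerAl scalerDr !scalerA [d * c]mulrC.
Qed.

Lemma mconv_linr (P Q : hpre V) (c : C) (phi : P -> D) (psi psi' : Q -> D) x :
  mconv phi (c *: psi + psi') x = c *: mconv phi psi x + mconv phi psi' x.
Proof.
have [L [_ Le]] := mtlift_expand x; rewrite /mconv !Le scaler_sumr -big_split /=.
apply: eq_bigr => -[d [[[[al ga] be] p] q]] _ /=.
by rewrite !mulrDr -!scalerAr scalerDr !scalerA [d * c]mulrC.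
Qed.

Lemma mconv_mull (P Q : hpre V) d (phi : P -> D) (psi : Q -> D) x :
  mconv (fun p => d * phi p) psi x = d * mconv phi psi x.
Proof.
have [L [_ Le]] := mtlift_expand x; rewrite /mconv !Le mulr_sumr.
by apply: eq_bigr => -[e [[[[al ga] be] p] q]] _ /=; rewrite -scalerAr !mulrA.
Qed.

Lemma mconv_mulr (P Q : hpre V) d (phi : P -> D) (psi : Q -> D) x :
  mconv phi (fun q => psi q * d) x = mconv phi psi x * d.
Proof.
have [L [_ Le]] := mtlift_expand x; rewrite /mconv !Le mulr_suml.
by apply: eq_bigr => -[e [[[[al ga] be] p] q]] _ /=; rewrite -scalerAl !mulrA.
Qed.

Lemma dualfun_lin (P : hpre V) (c : C) (phi psi : P -> D) :
  dualfun phi -> dualfun psi -> dualfun (c *: phi + psi).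
Proof.
move=> [l1 ml1 mr1] [l2 ml2 mr2].
have E p : (c *: phi + psi) p = c *: phi p + psi p by [].
split=> [d p q|f al be p dp|f al be p dp]; rewrite !E.
- by rewrite l1 l2 !scalerDr !scalerA [c * d]mulrC addrACA.
- by rewrite (ml1 _ _ _ _ dp) (ml2 _ _ _ _ dp) mulrDr scalerAr.
- by rewrite (mr1 _ _ _ _ dp) (mr2 _ _ _ _ dp) mulrDl scalerAl.
Qed.

Lemma dualfun0 (P : hpre V) : dualfun (0 : P -> D).
Proof.
have E p : (0 : P -> D) p = 0 by [].
by split=> [d p q|f al be p dp|f al be p dp]; rewrite !E ?scaler0 ?addr0 ?mulr0 ?mul0r.
Qed.

Lemma dualfun_comp (P Q : hpre V) (phi : Q -> D) (h : P -> Q) : is_prehom h ->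
  dualfun phi -> dualfun (phi \o h).
Proof.
move=> [hl hml hmr hd] [l ml mr]; split=> [d p q|f al be p dp|f al be p dp] /=.
- by rewrite hl l.
- by rewrite hml (ml _ al be) //; exact: hd.
- by rewrite hmr (mr _ al be) //; exact: hd.
Qed.

Lemma dhdeg_Dh : wpre (Dh V).
Proof.
split=> [al be|al be c p q dp dq|f al be p dp|f al be p dp|f al be c p q _ _|f al be c p q _ _
  |f g al be p _|f g al be p _|f g al be p _|f g al be p _|c al be p _|c al be p _|f g al be p _];
  rewrite ?/(hml _ _) ?/(hmr _ _) /= ?dcompE -?/(mop _).
- exact: dhdeg0.
- exact: (@dhdegD R V al be _ _ (@dhdegZ R V al be c _ dp) dq).
- by have := dhdegM (dhdeg_mop f) dp; rewrite !add0r.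
- by have := dhdegM (dhdeg_mop f) dp; rewrite !add0r.
- by rewrite mulrDr scalerAr.
- by rewrite mulrDr scalerAr.
- by rewrite raddfD mulrDl.
- by rewrite raddfD mulrDl.
- by rewrite rmorphM mulrA.
- by rewrite rmorphM mulrA.
- by rewrite mopZ rmorph1 -scalerAl mul1r.
- by rewrite mopZ rmorph1 -scalerAl mul1r.
- by rewrite !mulrA -!rmorphM mulrC.
Qed.

(** The counit of a coalgebroid is this functional pulled back along [heps]. *)
Lemma dualfun_Dh : dualfun (id : Dh V -> D).
Proof.
split=> // f al be p dp; rewrite /hmr /= dcompE -/(mop f).
by rewrite (dhdeg_mop_commuter _ dp) shiftNK.
Qed.

Section Two.
Variables (P Q : hpre V) (wP : wpre P) (wQ : wpre Q) (phi : P -> D) (psi : Q -> D).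
Hypotheses (dphi : dualfun phi) (dpsi : dualfun psi).

Lemma mconv_balanced : balanced (fun (al ga be : V) p q => phi p * tau ga * psi q).
Proof.
split=> [al ga be c a a' b da da' db|al ga be c a b b' da db db'|f al ga be a b da db].
- by rewrite (df_lin dphi) !mulrDl !scalerAl.
- by rewrite (df_lin dpsi) mulrDr scalerAr.
- by rewrite (df_mr dphi _ da) (df_ml dpsi _ db) -2!mulrA (mulrA (mop _)) -tau_mop !mulrA.
Qed.

Lemma mconv_mtens al ga be p q : hdeg al ga p -> hdeg ga be q ->
  mconv phi psi (mtens al ga be p q) = phi p * tau ga * psi q.
Proof. by move=> dp dq; rewrite /mconv (mtlift_mtens wP wQ mconv_balanced). Qed.

Lemma mconv_mtens_sum (T : eqType) (s : seq T) (al ga be : T -> V) (p : T -> P) (q : T -> Q) :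
  (forall t, t \in s -> hdeg (al t) (ga t) (p t) /\ hdeg (ga t) (be t) (q t)) ->
  mconv phi psi (\sum_(t <- s) mtens (al t) (ga t) (be t) (p t) (q t)) =
  \sum_(t <- s) phi (p t) * tau (ga t) * psi (q t).
Proof. by move=> ok; rewrite /mconv (mtlift_mtens_sum wP wQ mconv_balanced ok). Qed.

Lemma mconv_dualfun : @dualfun (tpre P Q) (mconv phi psi).
Proof.
split=> [|f al be x [s [sok ->]]|f al be x [s [sok ->]]].
- exact: (mtlift_linear wP wQ mconv_balanced).
- rewrite [hml f _](mtlift_mtens_sum wP wQ (tml_balanced wP wQ f) sok).
  rewrite !mconv_mtens_sum // => [|t /sok[dp dq]]; last by split=> //; exact: wml_deg.
  rewrite mulr_sumr; apply: eq_big_seq => t /sok[dp dq].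
  by rewrite (df_ml dphi _ dp) !mulrA.
- rewrite [hmr f _](mtlift_mtens_sum wP wQ (tmr_balanced wP wQ f) sok).
  rewrite !mconv_mtens_sum // => [|t /sok[dp dq]]; last by split=> //; exact: wmr_deg.
  rewrite mulr_suml; apply: eq_big_seq => t /sok[dp dq].
  by rewrite (df_mr dpsi _ dq) !mulrA.
Qed.

End Two.

Lemma mconv_tassoc (P Q E : hpre V) (wP : wpre P) (wQ : wpre Q) (wE : wpre E)
    (phi : P -> D) (psi : Q -> D) (chi : E -> D) :
  dualfun phi -> dualfun psi -> dualfun chi -> forall x : mtensor (tpre P Q) E,
  mconv (phi : P -> D) (mconv psi chi : tpre Q E -> D) (tassoc x) =
  mconv (mconv phi psi : tpre P Q -> D) chi x.
Proof.
move=> dphi dpsi dchi; have wPQ := wpre_tpre wP wQ; have wQE := wpre_tpre wQ wE.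
have d1 := mconv_dualfun wP wQ dphi dpsi; have d2 := mconv_dualfun wQ wE dpsi dchi.
have l1 := df_lin (mconv_dualfun wP wQE dphi d2).
have l2 := df_lin (mconv_dualfun wPQ wE d1 dchi).
apply: (@mtensor_ext _ _ _ _ wPQ wE _
  (fun x => mconv phi (mconv psi chi : tpre Q E -> D) (tassoc x))
  (mconv (mconv phi psi : tpre P Q -> D) chi)).
- by move=> c x y; rewrite (tassoc_linear wP wQ wE) l1.
- exact: l2.
move=> al ga be x e [s [sok ->]] de.
have ok' t : t \in s -> hdeg al t.1.1 t.1.2 /\
    hdeg t.1.1 be (mtens t.1.1 ga be t.2 e : tpre Q E).
  by move=> /sok[dp dq]; split=> //; exact: tdeg_mtens.
have -> : tassoc (mtens al ga be (\sum_(t <- s) mtens al t.1.1 ga t.1.2 t.2 : tpre P Q) e)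
  = \sum_(t <- s) mtens al t.1.1 be t.1.2 (mtens t.1.1 ga be t.2 e : tpre Q E).
  have bm := mtens_balanced wPQ wE.
  rewrite /tassoc (mtlift_mtens wPQ wE (tassoc_balanced wP wQ wE)) //; last by exists s.
  by rewrite (mtlift_mtens_sum wP wQ (tassoc_inner wP wQ wE _ _) sok).
rewrite (mconv_mtens_sum wP wQE dphi d2 ok') (mconv_mtens wPQ wE d1 dchi) //; last by exists s.
rewrite (mconv_mtens_sum wP wQ dphi dpsi sok) !mulr_suml.
apply: eq_big_seq => t /sok[dp dq].
by rewrite (mconv_mtens wQ wE dpsi dchi) // !mulrA.
Qed.

End Conv.

Section DualAlgebra.
Variables (R : realType) (V : vectType R[i]) (A : hcoalg V) (hA : is_hcoalgebroid A).
Notation C := R[i].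
Notation D := (diffop V).
Implicit Types (phi psi chi : A -> D).

Let pA := hcoalg_prealg hA.
Let wA := hprealgebra_wpre pA.

Lemma Delta_sum al be (a : A) : hdeg al be a -> exists s : seq (V * A * A),
  (forall t, t \in s -> hdeg al t.1.1 t.1.2 /\ hdeg t.1.1 be t.2) /\
  hDelta a = \sum_(t <- s) mtens al t.1.1 be t.1.2 t.2.
Proof. exact: prehom_deg (hDelta_hom hA) _ _ _. Qed.

Lemma linear_ext phi psi : linear phi -> linear psi ->
  (forall al be (a : A), hdeg al be a -> phi a = psi a) -> phi = psi.
Proof.
move=> lphi lpsi e; apply/funext => a; have [s [sd ->]] := hdeg_sum pA a.
rewrite (lin_sum lphi) (lin_sum lpsi) big_seq [RHS]big_seq.
by apply: eq_bigr => t /sd /e.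
Qed.

Lemma dual_mulE phi psi a : dual_mul phi psi a = mconv phi psi (hDelta a).
Proof. by []. Qed.

Lemma dual_mul_linl (c : C) phi phi' psi :
  dual_mul (c *: phi + phi') psi = c *: dual_mul phi psi + dual_mul phi' psi.
Proof. by apply/funext => a; rewrite dual_mulE mconv_linl. Qed.

Lemma dual_mul_linr (c : C) phi psi psi' :
  dual_mul phi (c *: psi + psi') = c *: dual_mul phi psi + dual_mul phi psi'.
Proof. by apply/funext => a; rewrite dual_mulE mconv_linr. Qed.

Lemma dual_mul_dualfun phi psi : dualfun phi -> dualfun psi -> dualfun (dual_mul phi psi).
Proof. by move=> dphi dpsi; exact: dualfun_comp (hDelta_hom hA) (mconv_dualfun wA wA dphi dpsi). Qed.

Lemma dual_mulA phi psi chi : dualfun phi -> dualfun psi -> dualfun chi ->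
  dual_mul phi (dual_mul psi chi) = dual_mul (dual_mul phi psi) chi.
Proof.
move=> dphi dpsi dchi; apply/funext => a; rewrite !dual_mulE.
have wAA := wpre_tpre wA wA.
have d1 := mconv_dualfun wA wA dphi dpsi; have d2 := mconv_dualfun wA wA dpsi dchi.
have hD := prehom_whom (hDelta_hom hA).
have -> : mconv phi (dual_mul psi chi) (hDelta a) =
    mconv phi (mconv psi chi : tpre A A -> D) (tmap id (@hDelta _ _ A) (hDelta a)).
  by rewrite /mconv (mtlift_tmap wA wA wA wAA (whom_id A) hD (mconv_balanced dphi d2)).
have -> : mconv (dual_mul phi psi) chi (hDelta a) =
    mconv (mconv phi psi : tpre A A -> D) chi (tmap (@hDelta _ _ A) id (hDelta a)).
  by rewrite /mconv (mtlift_tmap wA wAA wA wA hD (whom_id A) (mconv_balanced d1 dchi)).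
by rewrite -(hDelta_coassoc hA) (mconv_tassoc wA wA wA).
Qed.

Lemma heps_dualfun : dualfun (@heps _ _ A : A -> D).
Proof. exact: dualfun_comp (heps_hom hA) (@dualfun_Dh R V). Qed.

Lemma dual_mul1 phi : dualfun phi -> dual_mul (@heps _ _ A) phi = phi.
Proof.
move=> dphi; apply: linear_ext; [exact: df_lin (dual_mul_dualfun heps_dualfun dphi)|exact: df_lin|].
move=> al be a da; rewrite dual_mulE.
have wD := @dhdeg_Dh R V; have he := prehom_whom (heps_hom hA).
transitivity (mconv (id : Dh V -> D) phi (tmap (@heps _ _ A) id (hDelta a))).
  by rewrite /mconv (mtlift_tmap wA wD wA wA he (whom_id A) (mconv_balanced (@dualfun_Dh R V) dphi)).
rewrite (heps_counitl hA da) (mconv_mtens wD wA (@dualfun_Dh R V) dphi) //; last exact: dhdeg_dop.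
by rewrite -/(tau _) tauNK mul1r.
Qed.

Lemma dual_mulr1 phi : dualfun phi -> dual_mul phi (@heps _ _ A) = phi.
Proof.
move=> dphi; apply: linear_ext; [exact: df_lin (dual_mul_dualfun dphi heps_dualfun)|exact: df_lin|].
move=> al be a da; rewrite dual_mulE.
have wD := @dhdeg_Dh R V; have he := prehom_whom (heps_hom hA).
transitivity (mconv phi (id : Dh V -> D) (tmap id (@heps _ _ A) (hDelta a))).
  by rewrite /mconv (mtlift_tmap wA wA wA wD (whom_id A) he (mconv_balanced dphi (@dualfun_Dh R V))).
rewrite (heps_counitr hA da) (mconv_mtens wA wD dphi (@dualfun_Dh R V)) //; last exact: dhdeg_dop.
by rewrite -/(tau _) -mulrA tauK mulr1.
Qed.

Lemma dual_mul_muml f phi : dualfun phi ->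
  dual_mul (@dual_muml R V A f) phi = fun a => mop f * phi a.
Proof.
move=> dphi; apply/funext => a; rewrite dual_mulE mconv_mull -dual_mulE.
by rewrite dual_mul1.
Qed.

(** In each term of the coproduct of a the first factor has left degree al, so f passes to the left
    of its counit as T_{-al} f, with the same shift for all terms. *)
Lemma dual_mul_mumr f phi al be (a : A) : dualfun phi -> hdeg al be a ->
  dual_mul (@dual_mumr R V A f) phi a = mop (shift (- al) f) * phi a.
Proof.
move=> dphi da; have [s [sok Ds]] := Delta_sum da.
have dm : dualfun (@dual_mumr R V A f).
  have [l ml mr] := heps_dualfun; split=> [c p q|g al' be' p dp|g al' be' p dp]; rewrite /dual_mumr dcompE.
  - by rewrite l mulrDl -scalerAl.
  - by rewrite (ml _ _ _ _ dp) mulrA.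
  - by rewrite (mr _ _ _ _ dp) -!mulrA -/(mop f) -!rmorphM mulrC.
rewrite dual_mulE Ds (mconv_mtens_sum wA wA dm dphi sok).
rewrite -[in RHS](dual_mul1 dphi) dual_mulE Ds (mconv_mtens_sum wA wA heps_dualfun dphi sok).
rewrite mulr_sumr; apply: eq_big_seq => t /sok[dp dq].
rewrite /dual_mumr dcompE -/(mop f).
by rewrite (dhdeg_mop_commute _ (prehom_deg (heps_hom hA) dp)) !mulrA.
Qed.

End DualAlgebra.

(** * Bidegrees in the dual *)

Section DualDegree.
Variables (R : realType) (V : vectType R[i]) (A : hcoalg V) (hA : is_hcoalgebroid A).
Notation D := (diffop V).
Implicit Types (phi psi : A -> D).

Let pA := hcoalg_prealg hA.
Let wA := hprealgebra_wpre pA.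

Lemma dual_deg_dualfun al be phi : dual_deg al be phi -> dualfun phi.
Proof.
move=> [lin ml mr _]; split=> // f ga de a da.
by rewrite -[in LHS](shiftNK de f) (mr _ _ _ _ da).
Qed.

Lemma dual_deg_dhdeg al be phi ga de a : dual_deg al be phi -> hdeg ga de a ->
  dhdeg (ga + be) (de + al) (phi a).
Proof. by move=> dphi da; exact: dual_degP dphi _ _ _ da. Qed.

Lemma dualfun_ml f a phi : dualfun phi -> phi (hml f a) = mop f * phi a.
Proof.
move=> dphi; have lin := action_linear (hml_action pA) f.
suff /(congr1 (@^~ a)) : phi \o hml f = (fun a => mop f * phi a) by [].
apply: (linear_ext hA) => [c p q|c p q|ga de b db] /=.
- by rewrite lin (df_lin dphi).
- by rewrite (df_lin dphi) mulrDr scalerAr.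
- exact: df_ml db.
Qed.

Lemma dual_degI al be phi : dualfun phi -> (forall ga de a, hdeg ga de a ->
  dhdeg (ga + be) (de + al) (phi a)) -> dual_deg al be phi.
Proof.
move=> dphi d; split=> [|f a|f ga de a da|//]; first exact: df_lin.
- exact: dualfun_ml.
- by rewrite (df_mr dphi _ da) shiftK.
Qed.

(** Right multiplication by f becomes left multiplication by a shift in which the degree of a
    cancels; the formula therefore extends to inhomogeneous a. *)
Lemma dual_deg_mr al be phi f a : dual_deg al be phi ->
  phi (hmr f a) = mop (shift (- al) f) * phi a.
Proof.
move=> dphi; have lin := action_linear (hmr_action pA) f.
have dl := dual_linear dphi.
suff /(congr1 (@^~ a)) : phi \o hmr f = (fun a => mop (shift (- al) f) * phi a) by [].
apply: (linear_ext hA) => [c p q|c p q|ga de b db] /=.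
- by rewrite lin dl.
- by rewrite dl mulrDr scalerAr.
- rewrite (df_mr (dual_deg_dualfun dphi) _ db) (dhdeg_mop_commuter _ (dual_deg_dhdeg dphi db)).
  by rewrite shift_shift opprD addrAC addNr add0r.
Qed.

Lemma dual_deg0 al be : dual_deg al be (0 : A -> D).
Proof. by apply: dual_degI => [|ga de a _]; [exact: dualfun0|exact: dhdeg0]. Qed.

Lemma dual_deg_lin al be c phi psi : dual_deg al be phi -> dual_deg al be psi ->
  dual_deg al be (c *: phi + psi).
Proof.
move=> dphi dpsi; apply: dual_degI => [|ga de a da].
  by apply: dualfun_lin; [exact: dual_deg_dualfun dphi|exact: dual_deg_dualfun dpsi].
exact: dhdegD (dhdegZ c (dual_deg_dhdeg dphi da)) (dual_deg_dhdeg dpsi da).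
Qed.

Lemma dual_degM al be ga de phi psi : dual_deg al be phi -> dual_deg ga de psi ->
  dual_deg (al + ga) (be + de) (dual_mul phi psi).
Proof.
move=> dphi dpsi; have fphi := dual_deg_dualfun dphi; have fpsi := dual_deg_dualfun dpsi.
apply: dual_degI => [|ka la a da]; first exact: (dual_mul_dualfun hA).
have [s [sok Ds]] := Delta_sum hA da.
rewrite dual_mulE Ds (mconv_mtens_sum wA wA fphi fpsi sok) big_seq.
apply: dhdeg_sum => t /sok[dp dq].
have := dhdegM (dhdegM (dual_deg_dhdeg dphi dp) (dhdeg_tau t.1.1)) (dual_deg_dhdeg dpsi dq).
congr dhdeg; vring.
Qed.

Lemma heps_deg : dual_deg 0 0 (@heps R V A).
Proof.
apply: dual_degI => [|ga de a da]; first exact: heps_dualfun.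
rewrite !addr0; exact: (prehom_deg (heps_hom hA)).
Qed.

Lemma dual_muml1 f : dual_mul (@dual_muml R V A f) (@heps R V A) = @dual_muml R V A f.
Proof. exact: (dual_mul_muml hA f (heps_dualfun hA)). Qed.

Lemma muml_deg f : dual_deg 0 0 (@dual_muml R V A f).
Proof.
have [l ml mr] := heps_dualfun hA.
apply: dual_degI => [|ga de a da].
  split=> [c p q|g al' be' p dp|g al' be' p dp]; rewrite /dual_muml dcompE -/(mop f).
  - by rewrite l mulrDr -scalerAr.
  - by rewrite (ml _ _ _ _ dp) !mulrA -!rmorphM mulrC.
  - by rewrite (mr _ _ _ _ dp) mulrA.
have := dhdegM (dhdeg_mop f) (dual_deg_dhdeg heps_deg da).
by congr dhdeg; vring.
Qed.

Lemma mumr_deg f : dual_deg 0 0 (@dual_mumr R V A f).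
Proof.
have [l ml mr] := heps_dualfun hA.
apply: dual_degI => [|ga de a da].
  split=> [c p q|g al' be' p dp|g al' be' p dp]; rewrite /dual_mumr dcompE -/(mop f).
  - by rewrite l mulrDl -scalerAl.
  - by rewrite (ml _ _ _ _ dp) mulrA.
  - by rewrite (mr _ _ _ _ dp) -!mulrA -!rmorphM mulrC.
have := dhdegM (dual_deg_dhdeg heps_deg da) (dhdeg_mop f).
by congr dhdeg; vring.
Qed.

Lemma wpre_dual : wpre (dual_pre A).
Proof.
have ext al be (phi psi : dual_pre A) : dual_deg al be phi -> dual_deg al be psi ->
    (forall ga de a, hdeg ga de a -> phi a = psi a) -> phi = psi.
  by move=> dphi dpsi; apply: (linear_ext hA); [exact: dual_linear dphi|exact: dual_linear dpsi].
have dl f al be (phi : dual_pre A) : dual_deg al be phi -> @dual_deg R V A al be (hml f phi).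
  by move=> dphi; have := dual_degM (muml_deg f) dphi; rewrite !add0r.
have dr f al be (phi : dual_pre A) : dual_deg al be phi -> @dual_deg R V A al be (hmr f phi).
  by move=> dphi; have := dual_degM (mumr_deg f) dphi; rewrite !add0r.
have lE f al be (phi : dual_pre A) a : dual_deg al be phi -> hml f phi a = mop f * phi a.
  by move=> dphi; rewrite /hml /= (dual_mul_muml hA f (dual_deg_dualfun dphi)).
have rE f al be (phi : dual_pre A) ga de a : dual_deg al be phi -> hdeg ga de a ->
    hmr f phi a = mop (shift (- ga) f) * phi a.
  by move=> dphi da; rewrite /hmr /= (dual_mul_mumr hA f (dual_deg_dualfun dphi) da).
split=> [al be|al be c p q dp dq|f al be p dp|f al be p dp|f al be c p q _ _|f al be c p q _ _
  |f g al be p dp|f g al be p dp|f g al be p dp|f g al be p dp|c al be p dp|c al be p dp|f g al be p dp].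
- exact: dual_deg0.
- exact: dual_deg_lin.
- exact: dl.
- exact: dr.
- exact: dual_mul_linr.
- exact: dual_mul_linr.
- by apply/funext => a; rewrite (lE _ _ _ _ _ dp) raddfD mulrDl -!(lE _ _ _ _ _ dp).
- have dfp := dr f _ _ _ dp; have dgp := dr g _ _ _ dp; apply: (ext al be); [exact: dr| |].
    by have := dual_deg_lin 1 dfp dgp; rewrite scale1r.
  move=> ga de a da.
  by rewrite (rE _ _ _ _ _ _ _ dp da) !raddfD mulrDl -!(rE _ _ _ _ _ _ _ dp da).
- by apply/funext => a; rewrite !(lE _ al be) ?rmorphM ?mulrA //; exact: dl.
- have dgp := dr g _ _ _ dp; apply: (ext al be); [exact: dr|exact: dr|].
  move=> ga de a da.
  rewrite (rE _ _ _ _ _ _ _ dp da) (rE _ _ _ _ _ _ _ dgp da) (rE _ _ _ _ _ _ _ dp da).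
  by rewrite shiftM rmorphM mulrA.
- by apply/funext => a; rewrite (lE _ _ _ _ _ dp) mopZ rmorph1 -scalerAl mul1r.
- apply: (ext al be); [exact: dr| |].
    by have := dual_deg_lin c dp (dual_deg0 al be); rewrite addr0.
  move=> ga de a da; rewrite (rE _ _ _ _ _ _ _ dp da) shiftZ rmorph1 mopZ rmorph1.
  by rewrite -scalerAl mul1r.
- have dgp := dr g _ _ _ dp; have dfp := dl f _ _ _ dp.
  apply: (ext al be); [exact: dl|exact: dr|]; move=> ga de a da.
  rewrite (lE _ _ _ _ _ dgp) (rE _ _ _ _ _ _ _ dp da) (rE _ _ _ _ _ _ _ dfp da) (lE _ _ _ _ _ dp).
  by rewrite !mulrA -!rmorphM mulrC.
Qed.

End DualDegree.

Section Homogeneous.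
Variables (R : realType) (V : vectType R[i]) (A : hpre V).

(** The indices of evaluations on the dual. The bidegree is recorded because the element 0 has all
    of them. *)
Record homel := Homel { hk : V; hl : V; hel :> A; homelP : hdeg hk hl hel }.

End Homogeneous.

Section DualSeparated.
Variables (R : realType) (V : vectType R[i]) (A : hcoalg V) (hA : is_hcoalgebroid A).
Notation D := (diffop V).

Definition evd (i : homel A) (phi : dual_pre A) : D := phi i.

Lemma dual_separated : separated (@hk R V A) (@hl R V A) evd.
Proof.
split=> [|i c phi psi //|i al be phi dphi|i f al be phi dphi|i f al be phi dphi|al be phi dphi h].
- exact: wpre_dual.
- exact: dual_deg_dhdeg dphi (homelP i).
- by rewrite /evd /hml /= (dual_mul_muml hA f (dual_deg_dualfun dphi)).
- by rewrite /evd /hmr /= (dual_mul_mumr hA f (dual_deg_dualfun dphi) (homelP i)).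
- apply: (linear_ext hA); [exact: dual_linear dphi|by move=> c p q; rewrite scaler0 addr0|].
  by move=> ga de a da; exact: (h (Homel da)).
Qed.

Lemma in_dual_dualfun phi : @in_dual R V A phi -> dualfun phi.
Proof.
move=> [s [sd ->]]; rewrite big_seq; elim/big_ind: _ => [|p q dp dq|t /sd].
- exact: dualfun0.
- by rewrite -[p]scale1r; exact: dualfun_lin.
- move=> d; exact: dual_deg_dualfun d.
Qed.

Lemma dual_deg_in_dual al be phi : @dual_deg R V A al be phi -> in_dual phi.
Proof.
by move=> d; exists [:: (al, be, phi)]; rewrite big_seq1; split=> // t; rewrite inE => /eqP ->.
Qed.

Lemma in_dual_lin c phi psi : @in_dual R V A phi -> in_dual psi -> in_dual (c *: phi + psi).
Proof.
move=> [s [sd ->]] [t [td ->]]; exists ([seq (u.1, c *: u.2) | u <- s] ++ t); split.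
  move=> u; rewrite mem_cat => /orP[/mapP[v /sd dv ->]|/td //] /=.
  by have := dual_deg_lin hA c dv (dual_deg0 hA _ _); rewrite addr0.
by rewrite big_cat big_map scaler_sumr.
Qed.

Lemma in_dual0 : @in_dual R V A 0.
Proof. exact: dual_deg_in_dual (dual_deg0 hA 0 0). Qed.

Lemma in_dual_sum (T : eqType) (r : seq T) (F : T -> A -> D) :
  (forall t, t \in r -> in_dual (F t)) -> in_dual (\sum_(t <- r) F t).
Proof.
move=> h; rewrite big_seq; elim/big_ind: _ => [|p q dp dq|t /h //]; first exact: in_dual0.
by rewrite -[p]scale1r; exact: in_dual_lin.
Qed.

Lemma in_dual_components phi : @in_dual R V A phi -> exists (ks : seq (V * V)) (F : V * V -> A -> D),
  [/\ uniq ks, forall k, dual_deg k.1 k.2 (F k) & phi = \sum_(k <- ks) F k].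
Proof.
move=> [s [sd ->]]; exists (undup (map fst s)), (fun k => \sum_(t <- s | t.1 == k) t.2).
split; first exact: undup_uniq.
  move=> k; apply: (@wdeg_sum R V (dual_pre A) (wpre_dual hA) k.1 k.2 _ s (fun t => t.1 == k) snd).
  by move=> t ts /eqP <-; exact: sd.
exact: big_group.
Qed.

Lemma dual_mul_suml (T : Type) (r : seq T) (F : T -> A -> D) psi :
  dual_mul (\sum_(t <- r) F t) psi = \sum_(t <- r) dual_mul (F t) psi.
Proof.
have z : dual_mul 0 psi = 0 :> (A -> D).
  have := dual_mul_linl (A := A) (-1) 0 0 psi.
  by rewrite scaler0 addr0 scaleN1r addNr.
elim: r => [|t r IH]; first by rewrite !big_nil.
by rewrite !big_cons -IH -{1}[F t]scale1r dual_mul_linl scale1r.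
Qed.

Lemma dual_mul_sumr (T : Type) (r : seq T) (F : T -> A -> D) phi :
  dual_mul phi (\sum_(t <- r) F t) = \sum_(t <- r) dual_mul phi (F t).
Proof.
have z : dual_mul phi 0 = 0 :> (A -> D).
  have := dual_mul_linr (A := A) (-1) phi 0 0.
  by rewrite scaler0 addr0 scaleN1r addNr.
elim: r => [|t r IH]; first by rewrite !big_nil.
by rewrite !big_cons -IH -{1}[F t]scale1r dual_mul_linr scale1r.
Qed.

Lemma in_dualM phi psi : @in_dual R V A phi -> in_dual psi -> in_dual (dual_mul phi psi).
Proof.
move=> [s [sd ->]] [t [td ->]]; rewrite dual_mul_suml; apply: in_dual_sum => u us.
rewrite dual_mul_sumr; apply: in_dual_sum => v vt.
apply: dual_deg_in_dual; exact: (dual_degM hA (sd u us) (td v vt)).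
Qed.

End DualSeparated.

(** * The dual bialgebroid *)

Section HAlgebra.
Variables (R : realType) (V : vectType R[i]) (A : halg V) (hA : is_halgebra A).
Implicit Types (a b : A).
Local Notation ml := (@hml R V A).
Local Notation mr := (@hmr R V A).

Lemma mlM f a b : ml f (a * b) = ml f a * b.
Proof. by rewrite [LHS](halg_mlE hA) [ml f a](halg_mlE hA) mulrA. Qed.

Lemma mrM f a b : mr f (a * b) = mr f a * b.
Proof. by rewrite [LHS](halg_mrE hA) [mr f a](halg_mrE hA) mulrA. Qed.

Lemma mul_ml f al be a b : @hdeg R V A al be a -> a * ml f b = ml (shift (- al) f) a * b.
Proof.
move=> da; rewrite [ml f b](halg_mlE hA) mulrA; congr (_ * _).
by rewrite [RHS](halg_mlr hA _ da) shiftK.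
Qed.

Lemma mul_mr f al be a b : @hdeg R V A al be a -> a * mr f b = mr (shift (- be) f) a * b.
Proof.
move=> da; rewrite [mr f b](halg_mrE hA) mulrA; congr (_ * _).
by rewrite [RHS](halg_mrr hA _ da) shiftK.
Qed.

Lemma hdegM al be ga de a b : @hdeg R V A al be a -> @hdeg R V A ga de b ->
  @hdeg R V A (al + ga) (be + de) (a * b).
Proof. exact: halg_degM. Qed.

End HAlgebra.

Section TMul.
Variables (R : realType) (V : vectType R[i]) (A B : halg V).
Hypotheses (hA : is_halgebra A) (hB : is_halgebra B).

Let wA := hprealgebra_wpre (halg_prealg hA).
Let wB := hprealgebra_wpre (halg_prealg hB).
Let bm := mtens_balanced wA wB.

Lemma tmul_inner al ga be (a : A) (b : B) : @hdeg R V A al ga a -> @hdeg R V B ga be b ->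
  @balanced R V A B (mtensor A B) (fun (al' ga' be' : V) (c : A) (d : B) =>
    @mtens R V A B (al + al') (ga + ga') (be + be') (a * c) (b * d)).
Proof.
move=> da db; split=> [al' ga' be' z c c' d dc dc' dd|al' ga' be' z c d d' dc dd dd'
  |f al' ga' be' c d dc dd].
- rewrite mulrDr -scalerAr (bal_l bm) //; exact: hdegM.
- rewrite mulrDr -scalerAr (bal_r bm) //; exact: hdegM.
- rewrite (mul_mr hA _ _ da) -(mrM hA) (mul_ml hB _ _ db) -(mlM hB) (bal_m bm) //; exact: hdegM.
Qed.

Lemma tmul_balanced (y : mtensor A B) : @balanced R V A B (mtensor A B)
  (fun (al ga be : V) (a : A) (b : B) => @mtlift R V A B _ (fun al' ga' be' (c : A) (d : B) =>
    @mtens R V A B (al + al') (ga + ga') (be + be') (a * c) (b * d)) y).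
Proof.
have [s [sok ->]] := mtensor_sum wA wB y.
have E al ga be (a : A) (b : B) : @hdeg R V A al ga a -> @hdeg R V B ga be b ->
    @mtlift R V A B _ (fun al' ga' be' (c : A) (d : B) =>
    @mtens R V A B (al + al') (ga + ga') (be + be') (a * c) (b * d))
    (\sum_(t <- s) @tapp R V A B _ (@mtens R V A B) t) =
    \sum_(t <- s) @tapp R V A B _ (fun al' ga' be' (c : A) (d : B) =>
      @mtens R V A B (al + al') (ga + ga') (be + be') (a * c) (b * d)) t.
  move=> da db; rewrite (mtlift_sum wA wB (tmul_inner da db)).
  apply: eq_big_seq => -[[[[al' ga'] be'] c] d] /sok[dc dd].
  exact: (mtlift_mtens wA wB (tmul_inner da db)).
split=> [al ga be z a a' b da da' db|al ga be z a b b' da db db'|f al ga be a b da db].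
- have daa := wdeg_lin wA z da da'.
  rewrite !E // scaler_sumr -big_split.
  apply: eq_big_seq => -[[[[al' ga'] be'] c] d] /sok[dc dd] /=.
  by rewrite mulrDl -scalerAl (bal_l bm) //; exact: hdegM.
- have dbb := wdeg_lin wB z db db'.
  rewrite !E // scaler_sumr -big_split.
  apply: eq_big_seq => -[[[[al' ga'] be'] c] d] /sok[dc dd] /=.
  by rewrite mulrDl -scalerAl (bal_r bm) //; exact: hdegM.
- have dfa := wmr_deg wA f da; have dfb := wml_deg wB f db.
  rewrite !E //.
  apply: eq_big_seq => -[[[[al' ga'] be'] c] d] /sok[dc dd] /=.
  by rewrite -(mrM hA) -(mlM hB) (bal_m bm) //; exact: hdegM.
Qed.

Lemma tmul_mtens_sum (T U : eqType) (s : seq T) (r : seq U) (al ga be : T -> V)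
    (al' ga' be' : U -> V) (a : T -> A) (b : T -> B) (c : U -> A) (d : U -> B) :
  (forall t, t \in s -> @hdeg R V A (al t) (ga t) (a t) /\ @hdeg R V B (ga t) (be t) (b t)) ->
  (forall u, u \in r -> @hdeg R V A (al' u) (ga' u) (c u) /\ @hdeg R V B (ga' u) (be' u) (d u)) ->
  tmul (\sum_(t <- s) @mtens R V A B (al t) (ga t) (be t) (a t) (b t))
    (\sum_(u <- r) @mtens R V A B (al' u) (ga' u) (be' u) (c u) (d u)) =
  \sum_(t <- s) \sum_(u <- r) @mtens R V A B (al t + al' u) (ga t + ga' u) (be t + be' u)
    (a t * c u) (b t * d u).
Proof.
move=> sok rok; rewrite /tmul (mtlift_mtens_sum wA wB (tmul_balanced _) sok).
apply: eq_big_seq => t /sok[da db].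
by rewrite (mtlift_mtens_sum wA wB (tmul_inner da db) rok).
Qed.

End TMul.

(** * Functionals on products and their splittings *)

Section Astar.
Variables (R : realType) (V : vectType R[i]) (A : hbialg V) (hA : is_hbialgebroid A).
Notation D := (diffop V).
Implicit Types (phi psi : A -> D) (i j : homel A).

Let hH := hbialg_halg hA.
Let hC := hbialg_hcoalg hA.
Let pA : is_hprealgebra A := hcoalg_prealg hC.
Let wA := hprealgebra_wpre pA.
Let sD := dual_separated hC.
Let wD := sep_wpre sD.

Definition homelM i j : homel A := Homel (hdegM hH (homelP i) (homelP j)).

Local Notation el i := (hel i : halg_car A).

(** Translates of phi under multiplication by an element of A. Moving a moment map past that element
    shifts its argument; the factors [tau (hk i)] and, in [trr], [tau (hl j)] undo the shift, so
    that the translates are again functionals. *)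
Definition trl i phi : A -> D := fun y => tau (hk i) * phi (el i * y).
Definition trr j phi : A -> D := fun x => phi (x * el j) * tau (hl j).

Lemma trl_deg i al be phi : @dual_deg R V A al be phi ->
  @dual_deg R V A (hl i + al - hk i) be (trl i phi).
Proof.
move=> dphi; have [lin ml mr] := dual_deg_dualfun dphi.
apply: (dual_degI hC) => [|ga de a da].
  split=> [c p q|f ga de p dp|f ga de p dp]; rewrite /trl.
  - by rewrite mulrDr -scalerAr lin mulrDr scalerAr.
  - rewrite (mul_ml hH _ _ (homelP i)) -(mlM hH) (ml _ _ _ _ (hdegM hH (homelP i) dp)).
    by rewrite mulrA tau_mop shiftK mulrA.
  - rewrite (mul_mr hH _ _ (homelP i)) -(mrM hH) (mr _ _ _ _ (hdegM hH (homelP i) dp)).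
    by rewrite shift_shift addrAC subrr add0r mulrA.
have := dhdegM (dhdeg_tau (hk i)) (dual_deg_dhdeg dphi (hdegM hH (homelP i) da)).
by congr dhdeg; vring.
Qed.

Lemma trr_deg j al be phi : @dual_deg R V A al be phi ->
  @dual_deg R V A al (hk j + be - hl j) (trr j phi).
Proof.
move=> dphi; have [lin ml mr] := dual_deg_dualfun dphi.
apply: (dual_degI hC) => [|ga de a da].
  split=> [c p q|f ga de p dp|f ga de p dp]; rewrite /trr.
  - by rewrite mulrDl -scalerAl lin mulrDl scalerAl.
  - by rewrite -(mlM hH) (ml _ _ _ _ (hdegM hH dp (homelP j))) mulrA.
  - rewrite -(mrM hH) (mr _ _ _ _ (hdegM hH dp (homelP j))).
    by rewrite -!mulrA tau_mop shift_shift addrC.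
have := dhdegM (dual_deg_dhdeg dphi (hdegM hH da (homelP j))) (dhdeg_tau (hl j)).
by congr dhdeg; vring.
Qed.

Local Notation DD := (tpre (dual_pre A) (dual_pre A)).
Local Notation ev2 i j := (evt (@evd R V A) (@evd R V A) (i, j)).

(** The equation [iota x = mdual phi] tested on homogeneous pairs; see [iota_mdual] for the
    equivalence. *)
Definition splits phi (x : DD) : Prop := forall i j, phi (el i * el j) = ev2 i j x.

Definition astar phi : Prop := exists x, splits phi x.

Let ev2_linear i j : linear (ev2 i j) := ev_linear (separated_tpre sD sD) (i, j).
Let ev2_sum i j := ev_sum (separated_tpre sD sD) (i, j).

Lemma astar_lin c phi psi : astar phi -> astar psi -> astar (c *: phi + psi).
Proof.
move=> [x sx] [y sy]; exists (c *: x + y) => i j; rewrite ev2_linear -sx -sy.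
by [].
Qed.

Lemma astar0 : astar 0.
Proof. by exists 0 => i j; rewrite (ev0 (separated_tpre sD sD)). Qed.

Lemma astar1 : astar (@heps R V A).
Proof.
have dh := heps_deg hC.
exists (mtens 0 0 0 (@heps R V A : dual_pre A) (@heps R V A : dual_pre A)) => i j.
rewrite (evt_mtens sD sD) // tau0 mulr1; exact: (hbialg_epsM hA).
Qed.

Lemma astar_muml f : astar (@dual_muml R V A f).
Proof.
have dh := heps_deg hC; have dm := muml_deg hC f.
exists (mtens 0 0 0 (@dual_muml R V A f : dual_pre A) (@heps R V A : dual_pre A)) => i j.
rewrite (evt_mtens sD sD) // tau0 mulr1 /evd /dual_muml !dcompE -mulrA; congr (_ * _).
exact: (hbialg_epsM hA).
Qed.

Lemma astar_mumr f : astar (@dual_mumr R V A f).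
Proof.
have dh := heps_deg hC; have dm := mumr_deg hC f.
exists (mtens 0 0 0 (@heps R V A : dual_pre A) (@dual_mumr R V A f : dual_pre A)) => i j.
rewrite (evt_mtens sD sD) // tau0 mulr1 /evd /dual_mumr !dcompE mulrA; congr (_ * _).
exact: (hbialg_epsM hA).
Qed.

Lemma DD_sum (x : DD) : exists s : seq (V * V * V * dual_pre A * dual_pre A),
  (forall t, t \in s -> @dual_deg R V A t.1.1.1.1 t.1.1.1.2 t.1.2 /\
                        @dual_deg R V A t.1.1.1.2 t.1.1.2 t.2) /\
  x = \sum_(t <- s) mtens t.1.1.1.1 t.1.1.1.2 t.1.1.2 t.1.2 t.2.
Proof.
have [s [sok ->]] := mtensor_sum wD wD x; exists s; split.
  by move=> [[[[al ga] be] p] q] /sok.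
by apply: eq_bigr => -[[[[al ga] be] p] q].
Qed.

(* The two middle factors t_g p(b') t_nu and t_mu q(a'') t_d are multiplication
   operators, hence commute. *)
Lemma splitsM_sum phi psi (s r : seq (V * V * V * dual_pre A * dual_pre A)) :
  @dualfun R V A phi -> @dualfun R V A psi ->
  (forall t, t \in s -> @dual_deg R V A t.1.1.1.1 t.1.1.1.2 t.1.2 /\
                        @dual_deg R V A t.1.1.1.2 t.1.1.2 t.2) ->
  (forall t, t \in r -> @dual_deg R V A t.1.1.1.1 t.1.1.1.2 t.1.2 /\
                        @dual_deg R V A t.1.1.1.2 t.1.1.2 t.2) ->
  splits phi (\sum_(u <- s) mtens u.1.1.1.1 u.1.1.1.2 u.1.1.2 u.1.2 u.2) ->
  splits psi (\sum_(v <- r) mtens v.1.1.1.1 v.1.1.1.2 v.1.1.2 v.1.2 v.2) ->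
  splits (@dual_mul R V A phi psi)
    (\sum_(u <- s) \sum_(v <- r) mtens (u.1.1.1.1 + v.1.1.1.1) (u.1.1.1.2 + v.1.1.1.2)
      (u.1.1.2 + v.1.1.2) (@dual_mul R V A u.1.2 v.1.2 : dual_pre A)
      (@dual_mul R V A u.2 v.2 : dual_pre A)).
Proof.
move=> dphi dpsi sok rok sx sy i j.
have [c [cok Di]] := Delta_sum hC (homelP i).
have [d [dok Dj]] := Delta_sum hC (homelP j).
have DM : @hDelta R V A (el i * el j) = \sum_(t <- c) \sum_(w <- d)
    @mtens R V A A (hk i + hk j) (t.1.1 + w.1.1) (hl i + hl j) (t.1.2 * w.1.2) (t.2 * w.2).
  rewrite [LHS](hbialg_DeltaM hA) -[hbialg_Delta (el i)]/(@hDelta R V A i).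
  rewrite -[hbialg_Delta (el j)]/(@hDelta R V A j) Di Dj.
  exact: (@tmul_mtens_sum _ _ _ _ hH hH _ _ c d (fun=> hk i) (fun t => t.1.1) (fun=> hl i)
    (fun=> hk j) (fun t => t.1.1) (fun=> hl j) (fun t => t.1.2) snd (fun t => t.1.2) snd).
rewrite dual_mulE DM /mconv (mtlift_sum wA wA (mconv_balanced dphi dpsi)) ev2_sum.
under [RHS]eq_bigr => u _ do rewrite ev2_sum.
transitivity (\sum_(t <- c) \sum_(w <- d) \sum_(u <- s) \sum_(v <- r)
   u.1.2 t.1.2 * tau u.1.1.1.2 * u.2 w.1.2 * tau (t.1.1 + w.1.1) *
   (v.1.2 t.2 * tau v.1.1.1.2 * v.2 w.2)).
  apply: eq_big_seq => t /cok[dt1 dt2].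
  rewrite (mtlift_sum wA wA (mconv_balanced dphi dpsi)).
  apply: eq_big_seq => w /dok[dw1 dw2].
  rewrite (mtlift_mtens wA wA (mconv_balanced dphi dpsi)); last 2 first.
  - exact: (hdegM hH).
  - exact: (hdegM hH).
  rewrite (sx (Homel dt1) (Homel dw1)) (sy (Homel dt2) (Homel dw2)).
  rewrite (evt_mtens_sum sD sD _ _ sok) (evt_mtens_sum sD sD _ _ rok) !mulr_suml.
  by apply: eq_bigr => u _; rewrite mulr_sumr.
transitivity (\sum_(u <- s) \sum_(v <- r) \sum_(t <- c) \sum_(w <- d)
   u.1.2 t.1.2 * tau u.1.1.1.2 * u.2 w.1.2 * tau (t.1.1 + w.1.1) *
   (v.1.2 t.2 * tau v.1.1.1.2 * v.2 w.2)).
  under eq_bigr => t _ do rewrite exchange_big.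
  rewrite exchange_big; apply: eq_bigr => u _.
  under eq_bigr => t _ do rewrite exchange_big.
  by rewrite exchange_big.
apply: eq_big_seq => u /sok[du1 du2].
apply: eq_big_seq => v /rok[dv1 dv2].
rewrite (evt_mtens sD sD _ _ (dual_degM hC du1 dv1) (dual_degM hC du2 dv2)).
rewrite /evd !dual_mulE Di Dj.
rewrite (mconv_mtens_sum wA wA (dual_deg_dualfun du1) (dual_deg_dualfun dv1) cok).
rewrite (mconv_mtens_sum wA wA (dual_deg_dualfun du2) (dual_deg_dualfun dv2) dok).
rewrite !mulr_suml; apply: eq_big_seq => t /cok[dt1 dt2].
rewrite mulr_sumr; apply: eq_big_seq => w /dok[dw1 dw2].
have m1 : dhdeg 0 0 (tau u.1.1.1.2 * u.2 w.1.2 * tau w.1.1 : D).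
  have := dhdegM (dhdegM (dhdeg_tau u.1.1.1.2) (dual_deg_dhdeg du2 dw1)) (dhdeg_tau w.1.1).
  (* The value 0 has every bidegree; a nonzero value has two equal degrees, and the translations
     around it then cancel. *)
  have [->|nz] := pselect (u.2 w.1.2 = 0); first by rewrite mulr0 mul0r => _; exact: dhdeg0.
  have e := dhdeg_neq0 (dual_deg_dhdeg du2 dw1) nz.
  by rewrite e; congr dhdeg; vring.
have m2 : dhdeg 0 0 (tau t.1.1 * v.1.2 t.2 * tau v.1.1.1.2 : D).
  have := dhdegM (dhdegM (dhdeg_tau t.1.1) (dual_deg_dhdeg dv1 dt2)) (dhdeg_tau v.1.1.1.2).
  have [->|nz] := pselect (v.1.2 t.2 = 0); first by rewrite mulr0 mul0r => _; exact: dhdeg0.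
  have e := dhdeg_neq0 (dual_deg_dhdeg dv1 dt2) nz.
  by rewrite -e; congr dhdeg; vring.
transitivity (u.1.2 t.1.2 * ((tau u.1.1.1.2 * u.2 w.1.2 * tau w.1.1) *
    (tau t.1.1 * v.1.2 t.2 * tau v.1.1.1.2)) * v.2 w.2).
  by rewrite [t.1.1 + _]addrC tauD !mulrA.
by rewrite (dhdeg00_commute m1 m2) [u.1.1.1.2 + _]addrC tauD !mulrA.
Qed.

Lemma splitsM phi psi : @dualfun R V A phi -> @dualfun R V A psi -> astar phi -> astar psi ->
  astar (@dual_mul R V A phi psi).
Proof.
move=> dphi dpsi [x sx] [y sy].
have [s [sok xs]] := DD_sum x; have [r [rok yr]] := DD_sum y; rewrite xs in sx; rewrite yr in sy.
by eexists; exact: splitsM_sum dphi dpsi sok rok sx sy.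
Qed.

End Astar.

(** * Splittings with both factors in the dual bialgebroid *)

Section AstarCoproduct.
Variables (R : realType) (V : vectType R[i]) (A : hbialg V) (hA : is_hbialgebroid A).
Notation D := (diffop V).
Implicit Types (phi psi : A -> D) (i j : homel A).

Let hH := hbialg_halg hA.
Let hC := hbialg_hcoalg hA.
Let sD := dual_separated hC.
Let wD := sep_wpre sD.

Local Notation el i := (hel i : halg_car A).
Local Notation DD := (tpre (dual_pre A) (dual_pre A)).
Local Notation ev2 i j := (evt (@evd R V A) (@evd R V A) (i, j)).

Lemma astar_trl i phi : astar phi -> astar (trl i phi).
Proof.
move=> [x sx]; have [s [sok xs]] := DD_sum hA x.
exists (\sum_(t <- s) mtens (hl i + t.1.1.1.1 - hk i) t.1.1.1.2 t.1.1.2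
  (trl i t.1.2 : dual_pre A) t.2) => a b.
rewrite (evt_mtens_sum sD sD) => [|t /sok[dp dq]]; last by split=> //; exact: trl_deg.
rewrite /trl mulrA (sx (homelM hA i a) b) xs (evt_mtens_sum sD sD _ _ sok) mulr_sumr.
by apply: eq_bigr => t _; rewrite /evd /trl /= !mulrA.
Qed.

Lemma astar_trr j phi : astar phi -> astar (trr j phi).
Proof.
move=> [x sx]; have [s [sok xs]] := DD_sum hA x.
exists (\sum_(t <- s) mtens t.1.1.1.1 t.1.1.1.2 (hk j + t.1.1.2 - hl j)
  t.1.2 (trr j t.2 : dual_pre A)) => a b.
rewrite (evt_mtens_sum sD sD) => [|t /sok[dp dq]]; last by split=> //; exact: trr_deg.
rewrite /trr -mulrA (sx a (homelM hA b j)) xs (evt_mtens_sum sD sD _ _ sok) mulr_suml.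
by apply: eq_bigr => t _; rewrite /evd /trr /= !mulrA.
Qed.

Definition astar_deg al be phi : Prop := @dual_deg R V A al be phi /\ astar phi.

Lemma astar_hml f al be (phi : dual_pre A) : astar_deg al be phi -> astar_deg al be (hml f phi).
Proof.
move=> [dp ap]; split; first exact: (wml_deg wD f dp).
apply: (splitsM hA) => //; [|exact: dual_deg_dualfun dp|exact: astar_muml].
exact: dual_deg_dualfun (muml_deg hC f).
Qed.

Lemma astar_hmr f al be (phi : dual_pre A) : astar_deg al be phi -> astar_deg al be (hmr f phi).
Proof.
move=> [dp ap]; split; first exact: (wmr_deg wD f dp).
apply: (splitsM hA) => //; [|exact: dual_deg_dualfun dp|exact: astar_mumr].
exact: dual_deg_dualfun (mumr_deg hC f).
Qed.

Lemma astar_degD al be phi psi : astar_deg al be phi -> astar_deg al be psi ->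
  astar_deg al be (phi + psi).
Proof.
move=> [dp ap] [dq aq]; split; first exact: (wdegD wD dp dq).
by have := astar_lin hA 1 ap aq; rewrite scale1r.
Qed.

Lemma astar_deg0 al be : astar_deg al be 0.
Proof. by split; [exact: (wdeg0 wD)|exact: astar0]. Qed.

Lemma msub_astar_ml al be : msub (@hml R V (dual_pre A)) (astar_deg al be).
Proof. by split; [exact: astar_deg0|exact: astar_degD|move=> f p; exact: astar_hml]. Qed.

Lemma msub_astar_mr al be : msub (@hmr R V (dual_pre A)) (astar_deg al be).
Proof. by split; [exact: astar_deg0|exact: astar_degD|move=> f p; exact: astar_hmr]. Qed.

(* Let g be a middle degree of the tensor x splitting phi. The left slice of the component of
   x of middle degree g by i is the translate of phi by i, or 0, hence lies in A^*;
   similarly on the right. *)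
Lemma coproduct_astar_mid al g be phi (s : seq (dual_pre A * dual_pre A)) :
  @dual_deg R V A al be phi -> astar phi ->
  (forall t, t \in s -> @dual_deg R V A al g t.1 /\ @dual_deg R V A g be t.2) ->
  (forall i j, hk i + g = hl i + al \/ hk j + be = hl j + g ->
    phi (el i * el j) = ev2 i j (\sum_(t <- s) mtens al g be t.1 t.2)) ->
  exists s' : seq (dual_pre A * dual_pre A),
    (forall t, t \in s' -> astar_deg al g t.1 /\ astar_deg g be t.2) /\
    \sum_(t <- s) mtens al g be t.1 t.2 = \sum_(t <- s') mtens al g be t.1 t.2.
Proof.
move=> dphi aphi sok sl; have [lphi _ _ _] := dphi.
(* Left slices first bring the second factors into A^*, while the first ones are merely functionals
   of bidegree (al, g). *)
have [||||||s1 [s1ok e1]] := @slice_left _ _ _ _ _ _ _ _ _ _ _ _ sD sD al g be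
  (@dual_deg R V A al g) (astar_deg g be) s.
- exact: mmod_sub (mmod_mr wD al g).
- by [].
- exact: msub_astar_ml.
- by move=> p [].
- exact: sok.
- move=> i; pose eta := \sum_(t <- s) (hml (lcoef (@hk R V A) (@evd R V A) i t.1) t.2 : A -> D).
  have deta : @dual_deg R V A g be eta.
    by apply: (wdeg_sum wD) => t /sok[_ dq] _; exact: (wml_deg wD).
  split=> //; rewrite -/eta.
  have etaE (j : homel A) : eta (el j) = tau (hk i) * ev2 i j (\sum_(t <- s) mtens al g be t.1 t.2).
    rewrite (evt_mtens_sum sD sD i j (al := fun=> al) (ga := fun=> g) (be := fun=> be) sok).
    rewrite -[eta (el j)]/(@evd R V A j eta) (ev_sum sD) mulr_sumr.
    apply: eq_big_seq => t /sok[dp dq]; rewrite (ev_ml sD _ _ dq) (ev_lcoef sD i dp) !mulrA.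
    by rewrite tauK mul1r -(mulrA _ (tau (- g))) tauNK mulr1.
  (* If the equation fails, evaluation at i kills all functionals of bidegree (al, g) and the slice
     is 0. *)
  have [kl|kl] := pselect (hk i + g = hl i + al).
    have -> : eta = trl i phi.
      apply: (linear_ext hC); [exact: dual_linear deta| |].
        by move=> c p q; rewrite /trl mulrDr -scalerAr lphi mulrDr scalerAr.
      move=> ga de a da; rewrite (etaE (Homel da)) -sl //; by left.
    exact: astar_trl.
  have -> : eta = 0 by [apply: (linear_ext hC); [exact: dual_linear deta|
      by move=> c p q; rewrite scaler0 addr0|move=> ga de a da; rewrite (etaE (Homel da));
      rewrite (evt_mtens_sum sD sD _ _ (al := fun=> al) (ga := fun=> g) (be := fun=> be) sok);
      rewrite big_seq big1 ?mulr0 // => t /sok[dp dq];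
      rewrite (_ : @evd R V A i t.1 = 0) ?mul0r //; apply: contrapT;
      move=> /(dhdeg_neq0 (ev_deg sD i dp))]].
  exact: astar0.
have s1ok' t : t \in s1 -> @dual_deg R V A al g t.1 /\ @dual_deg R V A g be t.2.
  by move=> /s1ok[? []].
(* Right slices now treat the first factors; taking [astar_deg g be] for N2 preserves what was
   gained for the second ones. *)
rewrite e1; have [||||||s2 [s2ok e2]] := @slice_right _ _ _ _ _ _ _ _ _ _ _ _ sD sD al g be
  (astar_deg al g) (astar_deg g be) s1.
- exact: msub_astar_mr.
- by move=> p [].
- exact: msub_astar_ml.
- by move=> p [].
- exact: s1ok.
- move=> j; pose eta := \sum_(t <- s1) (hmr (@evd R V A j t.2 1) t.1 : A -> D).
  have deta : @dual_deg R V A al g eta.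
    by apply: (wdeg_sum wD) => t /s1ok'[dp _] _; exact: (wmr_deg wD).
  split=> //; rewrite -/eta.
  have etaE (i : homel A) : eta (el i) =
      ev2 i j (\sum_(t <- s) mtens al g be t.1 t.2) * tau (hk j + be - g).
    rewrite e1 (evt_mtens_sum sD sD i j (al := fun=> al) (ga := fun=> g) (be := fun=> be) s1ok').
    rewrite -[eta (el i)]/(@evd R V A i eta) (ev_sum sD) mulr_suml.
    apply: eq_big_seq => t /s1ok'[dp dq]; rewrite (ev_mr sD _ _ dp).
    rewrite {2}(dhdegEl (ev_deg sD j dq)) mulrA (ev_tau_mop sD i _ dp) -!mulrA -!tauD.
    by rewrite (_ : _ + _ = 0) ?tau0 ?mulr1 //; vring.
  have [kl|kl] := pselect (hk j + be = hl j + g).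
    have -> : eta = trr j phi.
      apply: (linear_ext hC); [exact: dual_linear deta| |].
        by move=> c p q; rewrite /trr mulrDl -scalerAl lphi mulrDl scalerAl.
      move=> ga de a da; rewrite (etaE (Homel da)) -sl; last by right.
      by rewrite /trr kl addrK.
    exact: astar_trr.
  have -> : eta = 0 by [apply: (linear_ext hC); [exact: dual_linear deta|
      by move=> c p q; rewrite scaler0 addr0|move=> ga de a da; rewrite (etaE (Homel da)) e1;
      rewrite (evt_mtens_sum sD sD _ _ (al := fun=> al) (ga := fun=> g) (be := fun=> be) s1ok');
      rewrite big_seq big1 ?mul0r // => t /s1ok'[dp dq];
      rewrite (_ : @evd R V A j t.2 = 0) ?mulr0 //; apply: contrapT;
      move=> /(dhdeg_neq0 (ev_deg sD j dq))]].
  exact: astar0.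
by exists s2.
Qed.

(** Middle degrees can be treated one at a time, because evaluation at a given pair sees at most one
    of them. *)
Lemma coproduct_astar al be phi (x : DD) : @dual_deg R V A al be phi -> hdeg al be x -> splits phi x ->
  exists s : seq (V * dual_pre A * dual_pre A),
    (forall t, t \in s -> astar_deg al t.1.1 t.1.2 /\ astar_deg t.1.1 be t.2) /\
    x = \sum_(t <- s) mtens al t.1.1 be t.1.2 t.2.
Proof.
move=> dphi [s [sok ->]] sx; have aphi : astar phi by exists (\sum_(t <- s) mtens al t.1.1 be t.1.2 t.2).
rewrite (big_group (fun t => t.1.1)) /=; set ks := undup _.
have comp g : exists s' : seq (V * dual_pre A * dual_pre A),
    (forall t, t \in s' -> astar_deg al t.1.1 t.1.2 /\ astar_deg t.1.1 be t.2) /\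
    \sum_(t <- s | t.1.1 == g) mtens al t.1.1 be t.1.2 t.2 =
    \sum_(t <- s') mtens al t.1.1 be t.1.2 t.2.
  pose sg := [seq (t.1.2, t.2) | t <- s & t.1.1 == g].
  have sgE : \sum_(t <- s | t.1.1 == g) mtens al t.1.1 be t.1.2 t.2 =
      \sum_(t <- sg) mtens al g be t.1 t.2.
    by rewrite big_map big_filter; apply: eq_bigr => t /eqP ->.
  have [||s' [s'ok e]] := @coproduct_astar_mid al g be phi sg dphi aphi.
  - move=> t /mapP[u]; rewrite mem_filter => /andP[/eqP <- /sok[dp dq]] ->; by split.
  (* Under either degree equation the terms of middle degree other than g evaluate to 0, so the
     component of degree g alone computes phi on the product. *)
  - move=> i j kl; rewrite -sgE (sx i j) (bigID (fun t => t.1.1 == g)) /=.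
    rewrite (evD (separated_tpre sD sD)) -[RHS]addr0; congr (_ + _).
    rewrite (ev_sum (separated_tpre sD sD)) big_seq_cond big1 // => t /andP[/sok[dp dq] tg].
    rewrite (evt_mtens sD sD) //.
    case: kl => kl.
      rewrite (_ : @evd R V A i _ = 0) ?mul0r //; apply: contrapT => /(dhdeg_neq0 (ev_deg sD i dp)).
      by rewrite -kl => /addrI e; rewrite e eqxx in tg.
    rewrite (_ : @evd R V A j _ = 0) ?mulr0 //; apply: contrapT => /(dhdeg_neq0 (ev_deg sD j dq)).
    by rewrite kl => /addrI e; rewrite e eqxx in tg.
  exists [seq (g, t.1, t.2) | t <- s']; split; last by rewrite sgE e big_map.
  by move=> _ /mapP[t /s'ok ? ->].
elim: ks => [|g ks [s' [s'ok e]]]; first by exists [::]; rewrite !big_nil.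
have [sg [sgok eg]] := comp g; exists (sg ++ s'); rewrite big_cons big_cat e eg; split=> // t.
by rewrite mem_cat => /orP[/sgok|/s'ok].
Qed.

(** Evaluation at a fixed pair sends distinct bidegrees to distinct bidegrees of operators, where
    nonzero values are independent; the splitting can be compared component by component. *)
Lemma splits_graded (ks : seq (V * V)) (F : V * V -> A -> D) (x : DD) : uniq ks ->
  (forall k, k \in ks -> @dual_deg R V A k.1 k.2 (F k)) -> splits (\sum_(k <- ks) F k) x ->
  forall k, k \in ks -> exists2 y : DD, hdeg k.1 k.2 y & splits (F k) y.
Proof.
move=> us dF; have [s [sok ->]] := DD_sum hA x => sx k kks.
pose comp k := \sum_(t <- s | (t.1.1.1.1, t.1.1.2) == k)
  (mtens t.1.1.1.1 t.1.1.1.2 t.1.1.2 t.1.2 t.2 : DD).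
have wDD := sep_wpre (separated_tpre sD sD).
have dcomp k' : hdeg k'.1 k'.2 (comp k').
  apply: (wdeg_sum wDD) => t /sok[dp dq] /eqP <- /=.
  exact: (@tdeg_mtens R V (dual_pre A) (dual_pre A) _ _ _ _ _ dp dq).
exists (comp k) => [|i j]; first exact: dcomp.
pose G k' := (if k' \in ks then F k' (el i * el j) else 0) - ev2 i j (comp k').
(* The tensor may have bidegrees absent from [ks]; there [G] counts the functional as 0. *)
pose ks' := undup (ks ++ [seq (t.1.1.1.1, t.1.1.2) | t <- s]).
have G0 : \sum_(k' <- ks') G k' = 0.
  rewrite /G sumrB -big_mkcond /= -big_filter.
  have -> : \sum_(k' <- [seq k' <- ks' | k' \in ks]) F k' (el i * el j) =
      \sum_(k' <- ks) F k' (el i * el j).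
    apply: perm_big; apply: uniq_perm => //; first by rewrite filter_uniq ?undup_uniq.
    by move=> k'; rewrite mem_filter mem_undup mem_cat; case: (k' \in ks).
  have -> : \sum_(k' <- ks') ev2 i j (comp k') = \sum_(k' <- undup [seq (t.1.1.1.1, t.1.1.2) | t <- s]) ev2 i j (comp k').
    apply: big_usub => [||k'|k' _]; [exact: undup_uniq|exact: undup_uniq| |].
      by rewrite !mem_undup mem_cat orbC => ->.
    rewrite mem_undup => k's; rewrite /comp big_seq_cond big1 ?(ev0 (separated_tpre sD sD)) //.
    by move=> t /andP[ts /eqP e]; rewrite -e map_f in k's.
  rewrite -(ev_sum (separated_tpre sD sD)) -big_group -sx.
  by apply/eqP; rewrite subr_eq0; apply/eqP; elim: (ks) => [|a r IH]; rewrite ?big_nil // big_cons IH [in RHS]big_cons.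
have := @dhdeg_direct R V (hk i + hk j) (hl i + hl j) G ks' (undup_uniq _) _ G0 k.
rewrite /G kks => h; apply/eqP; rewrite -subr_eq0; apply/eqP; apply: h.
  move=> k' _; apply: dhdegD.
    case: ifP => [/dF d|_]; last exact: dhdeg0.
    exact: (dual_deg_dhdeg d (hdegM hH (homelP i) (homelP j))).
  rewrite -scaleN1r; apply: dhdegZ; exact: (ev_deg (separated_tpre sD sD) (i, j) (dcomp k')).
by rewrite mem_undup mem_cat kks.
Qed.

End AstarCoproduct.

(** * Functionals on the second tensor product and the map iota *)

Section HatLift.
Variables (R : realType) (V : vectType R[i]) (A B : hpre V) (Z : lmodType R[i]).

Record hbalanced (F : A -> B -> Z) : Prop := HBalanced {
  hbal_l : forall c a a' b, F (c *: a + a') b = c *: F a b + F a' b;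
  hbal_r : forall c a b b', F a (c *: b + b') = c *: F a b + F a b';
  hbal_ml : forall f al be a b, hdeg al be a -> F (hml (shift (- al) f) a) b = F a (hml f b);
  hbal_mr : forall f al be a b, hdeg al be a -> F (hmr (shift (- be) f) a) b = F a (hmr f b) }.

Definition hten (a : A) (b : B) : htensor A B := toquot (@htensor_rel R V A B) << (a, b) >>.

Variables (F : A -> B -> Z) (bF : hbalanced F).

Lemma htlift_rel u : @htensor_rel R V A B u -> fglift (fun g : (A * B)%type => F g.1 g.2) u = 0.
Proof.
have F0l b : F 0 b = 0.
  by have := hbal_l bF (-1) 0 0 b; rewrite scaler0 addr0 scaleN1r addNr.
have F0r a : F a 0 = 0.
  by have := hbal_r bF (-1) a 0 0; rewrite scaler0 addr0 scaleN1r addNr.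
case=> [a a' b|a b b'|c a b|c a b|f al be a b da|f al be a b da];
  rewrite ?fgliftB ?fglift_scalable ?liftU ?scale1r /=.
- by have := hbal_l bF 1 a a' b; rewrite !scale1r => ->; rewrite addrAC addrK subrr.
- by have := hbal_r bF 1 a b b'; rewrite !scale1r => ->; rewrite addrAC addrK subrr.
- by rewrite -[c *: a]addr0 (hbal_l bF) F0l addr0 subrr.
- by rewrite -[c *: b]addr0 (hbal_r bF) F0r addr0 subrr.
- by rewrite (hbal_ml bF _ _ da) subrr.
- by rewrite (hbal_mr bF _ _ da) subrr.
Qed.

Lemma htlift_hten a b : htlift F (hten a b) = F a b.
Proof. by rewrite /htlift /hten (fglift_toquot htlift_rel) liftU scale1r. Qed.

Lemma htlift_linear : linear (htlift F).
Proof.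
move=> c x y; rewrite -(toquotK x) -(toquotK y) -toquot_is_linear.
by rewrite /htlift !(fglift_toquot htlift_rel) linearP.
Qed.

End HatLift.

Lemma htensor_ext (R : realType) (V : vectType R[i]) (A B : hpre V) (Z : lmodType R[i])
    (F G : htensor A B -> Z) : linear F -> linear G ->
  (forall a b, F (hten a b) = G (hten a b)) -> F = G.
Proof.
move=> lF lG FG; apply/funext => x; rewrite -(toquotK x) -[repr x]freeg_sumE.
rewrite raddf_sum (lin_sum lF) (lin_sum lG); apply: eq_bigr => -[a b] _ /=.
have -> : << coeff (a, b) (repr x) *g (a, b) >> = coeff (a, b) (repr x) *: << (a, b) >>.
  by apply/eqP/freeg_eqP => l; rewrite coeffZ !coeffU mul1r.
by rewrite toquotZ (linZ lF) (linZ lG); congr (_ *: _); exact: FG.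
Qed.

Section AstarHat.
Variables (R : realType) (V : vectType R[i]) (A : hbialg V) (hA : is_hbialgebroid A).
Notation D := (diffop V).
Implicit Types (phi psi : A -> D).

Let hH := hbialg_halg hA.
Let hC := hbialg_hcoalg hA.
Let sD := dual_separated hC.
Let wD := sep_wpre sD.

Local Notation DD := (tpre (dual_pre A) (dual_pre A)).

Lemma mdual_hbalanced phi : @dualfun R V A phi ->
  @hbalanced R V A A D (fun x y : A => phi (x * y)).
Proof.
move=> dphi; split=> [c a a' b|c a b b'|f al be a b da|f al be a b da].
- by rewrite mulrDl -scalerAl (df_lin dphi).
- by rewrite mulrDr -scalerAr (df_lin dphi).
- by rewrite (mul_ml hH _ _ da).
- by rewrite (mul_mr hH _ _ da).
Qed.

Lemma iota_hbalanced al ga be phi psi : @dual_deg R V A al ga phi -> @dual_deg R V A ga be psi ->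
  @hbalanced R V A A D (fun a b => phi a * tau ga * psi b).
Proof.
move=> dphi dpsi; split=> [c a a' b|c a b b'|f ka la a b da|f ka la a b da].
- by rewrite (dual_linear dphi) !mulrDl !scalerAl.
- by rewrite (dual_linear dpsi) mulrDr scalerAr.
- rewrite (dual_ml dphi) (dual_ml dpsi) !dcompE -!/(mop _) [RHS]mulrA.
  by rewrite (ev_tau_mop sD (Homel da) _ dphi) !mulrA.
- rewrite (dual_mr dphi _ da) (dual_deg_mr hC _ _ dpsi) dcompE -/(mop f).
  by rewrite -(mulrA (phi a)) mop_tau !mulrA.
Qed.

Lemma iota_hten (x : DD) (a b : A) :
  iota x (@hten R V A A a b) = mconv (fun phi : dual_pre A => phi a) (fun psi : dual_pre A => psi b) x.
Proof.
have [L [Lok Le]] := mtlift_expand x; rewrite /iota /mconv !Le fct_sumE.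
apply: eq_big_seq => -[c [[[[al ga] be] phi] psi]] /Lok[/= dphi dpsi].
by congr (_ *: _); rewrite (htlift_hten (iota_hbalanced dphi dpsi)).
Qed.

Lemma iota_linear (x : DD) : linear (iota x).
Proof.
have [L [Lok Le]] := mtlift_expand x => c p q; rewrite /iota !Le !fct_sumE scaler_sumr -big_split.
apply: eq_big_seq => -[d [[[[al ga] be] phi] psi]] /Lok[/= dphi dpsi].
have E p' : (d *: htlift (fun a b => dcomp (dcomp (phi a) (dop 1 ga)) (psi b))) p' =
  d *: htlift (fun a b => dcomp (dcomp (phi a) (dop 1 ga)) (psi b)) p' by [].
rewrite !E (htlift_linear (iota_hbalanced dphi dpsi)) scalerDr !scalerA [c * d]mulrC.
by [].
Qed.

(** Both sides are bilinear in the pair of elements of A, and A is spanned by homogeneous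
    elements. *)
Lemma iota_mdual phi (x : DD) : @in_dual R V A phi ->
  iota x = mdual phi <-> splits phi x.
Proof.
move=> /in_dual_dualfun dphi; have bphi := mdual_hbalanced dphi.
split=> [e i j|sx].
  have /(congr1 (@^~ (@hten R V A A (hel i) (hel j)))) := e.
  by rewrite iota_hten /mdual htlift_hten.
apply: htensor_ext; [exact: iota_linear|exact: (htlift_linear bphi)|].
move=> a b; rewrite iota_hten /mdual htlift_hten //.
have [L [Lok Le]] := mtlift_expand x; rewrite /mconv Le.
pose G (a b : A) := \sum_(t <- L) t.1 *: @tapp R V (dual_pre A) (dual_pre A) _
  (fun al ga be (phi psi : dual_pre A) => phi a * tau ga * psi b) t.2.
rewrite -/(G a b).
have Gb (b' : A) : linear (G^~ b').
  move=> c p q; rewrite /G scaler_sumr -big_split.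
  apply: eq_big_seq => -[d [[[[al ga] be] u] v]] /Lok[/= du dv].
  by rewrite (dual_linear du) !mulrDl -!scalerAl scalerDr !scalerA [c * d]mulrC.
have Ga (a' : A) : linear (G a').
  move=> c p q; rewrite /G scaler_sumr -big_split.
  apply: eq_big_seq => -[d [[[[al ga] be] u] v]] /Lok[/= du dv].
  by rewrite (dual_linear dv) !mulrDr -!scalerAr scalerDr !scalerA [c * d]mulrC.
have lphi := df_lin dphi.
suff /(congr1 (@^~ a)) : G^~ b = (fun a : A => phi (a * b)) by [].
apply: (linear_ext hC) => [//|c p q|al be p dp]; first by rewrite mulrDl -scalerAl lphi.
suff /(congr1 (@^~ b)) : G p = (fun b : A => phi ((p : halg_car A) * b)) by [].
apply: (linear_ext hC) => [//|c q r|ga de q dq]; first by rewrite mulrDr -scalerAr lphi.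
by rewrite (sx (Homel dp) (Homel dq)) /evt Le.
Qed.

Lemma in_AstarP phi : in_Astar phi <-> @in_dual R V A phi /\ astar phi.
Proof.
by split=> -[dphi [x]]; move=> /(iota_mdual x dphi) h; split=> //; exists x.
Qed.

(** The condition defining A^* ignores the grading; each component inherits a splitting from the
    corresponding component of the tensor. *)
Lemma in_Astar_components phi : in_Astar phi ->
  exists (ks : seq (V * V)) (F : V * V -> A -> D),
  [/\ uniq ks, forall k, k \in ks -> @dual_deg R V A k.1 k.2 (F k) /\ in_Astar (F k)
    & phi = \sum_(k <- ks) F k].
Proof.
move=> /in_AstarP[/(in_dual_components hC)[ks [F [us dF ->]]] [x sx]].
exists ks, F; split=> // k kks; split; first exact: dF.
have [y _ sy] := splits_graded hA us (fun k _ => dF k) sx kks.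
by apply/in_AstarP; split; [exact: dual_deg_in_dual (dF k)|exists y].
Qed.

Section Embedding.
Variables (B : hpre V) (j : B -> A -> D).
Hypotheses (jl : linear j) (jinj : injective j).
Hypotheses (jdeg : forall al be (b : B), hdeg al be b <-> @dual_deg R V A al be (j b)).
Hypotheses (jml : forall f b, j (hml f b) = @dual_mul R V A (@dual_muml R V A f) (j b)).
Hypotheses (jmr : forall f b, j (hmr f b) = @dual_mul R V A (@dual_mumr R V A f) (j b)).

(** Only the prealgebra data of B and the embedding j enter, so that this applies both to the model
    under construction, which has no coproduct yet, and to a given dual. *)
Lemma embedding_wpre : wpre B.
Proof.
have j0 : j 0 = 0 := lin0 jl.
have jD b c : j (b + c) = j b + j c := linD jl b c.
have jZ c b : j (c *: b) = c *: j b := linZ jl c b.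
have jml' f b : j (hml f b) = (hml f (j b : dual_pre A)) := jml f b.
have jmr' f b : j (hmr f b) = (hmr f (j b : dual_pre A)) := jmr f b.
split=> [al be|al be c p q /jdeg dp /jdeg dq|f al be p /jdeg dp|f al be p /jdeg dp
  |f al be c p q /jdeg dp /jdeg dq|f al be c p q /jdeg dp /jdeg dq|f g al be p /jdeg dp
  |f g al be p /jdeg dp|f g al be p /jdeg dp|f g al be p /jdeg dp
  |c al be p /jdeg dp|c al be p /jdeg dp|f g al be p /jdeg dp]; try apply/jdeg; try apply: jinj.
- by rewrite j0; exact: (wdeg0 wD).
- by rewrite jl; exact: (wdeg_lin wD).
- by rewrite jml'; exact: (wml_deg wD).
- by rewrite jmr'; exact: (wmr_deg wD).
- by rewrite jml' !jl jml' jml'; exact: (wml_lin wD f c dp dq).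
- by rewrite jmr' !jl jmr' jmr'; exact: (wmr_lin wD f c dp dq).
- by rewrite jD !jml'; exact: (wmlD wD f g dp).
- by rewrite jD !jmr'; exact: (wmrD wD f g dp).
- by rewrite !jml'; exact: (wmlM wD f g dp).
- by rewrite !jmr'; exact: (wmrM wD f g dp).
- by rewrite jZ !jml'; exact: (wml_cst wD c dp).
- by rewrite jZ !jmr'; exact: (wmr_cst wD c dp).
- by rewrite !(jml', jmr'); exact: (wcomm wD f g dp).
Qed.

Lemma embedding_whom : @whom R V B (dual_pre A) j.
Proof.
split=> [al be c p q _ _|al be p /jdeg //|f al be p _|f al be p _]; [exact: jl|exact: jml|exact: jmr].
Qed.

(** A splitting with all factors in A^* lifts through j factor by factor. This is where the
    coproduct of the dual comes from. *)
Lemma embedding_coproduct phi : (forall phi, in_Astar phi -> exists b, j b = phi) ->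
  in_Astar phi -> exists y : mtensor B B, splits phi (@tmap R V B (dual_pre A) B (dual_pre A) j j y).
Proof.
move=> jsurj /in_AstarP[/(in_dual_components hC)[ks [F [us dF ->]]] [x sx]].
have wB := embedding_wpre; have hj := embedding_whom.
have tl := tmap_linear wB wD wB wD hj hj.
have comp k : k \in ks -> exists y : mtensor B B,
    splits (F k) (@tmap R V B (dual_pre A) B (dual_pre A) j j y).
  move=> kks; have [z dz sz] := splits_graded hA us (fun k _ => dF k) sx kks.
  have [s [sok zs]] := coproduct_astar hA (dF k) dz sz.
  have lift al be (p : A -> D) : astar_deg al be p -> exists2 b : B, j b = p & hdeg al be b.
    move=> [dp ap]; have [|b jb] := jsurj p.
      by apply/in_AstarP; split=> //; exact: dual_deg_in_dual dp.
    by exists b => //; apply/jdeg; rewrite jb.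
  suff [y ye] : exists y : mtensor B B, @tmap R V B (dual_pre A) B (dual_pre A) j j y = z.
    by exists y; rewrite ye.
  rewrite zs; elim: s sok {z dz sz zs} => [|t s IH] sok.
    exists 0; rewrite big_nil; have := tl (-1) 0 0.
    by rewrite scaler0 addr0 scaleN1r addNr.
  have [|y ye] := IH; first by move=> t' t's; apply: sok; rewrite inE t's orbT.
  have /sok[/lift[p jp dp] /lift[q jq dq]] : t \in t :: s by rewrite inE eqxx.
  exists (1 *: mtens k.1 t.1.1 k.2 p q + y).
  by rewrite tl ye (tmap_mtens wB wD wB wD hj hj) // jp jq scale1r big_cons.
elim: ks {us sx x} comp => [|k ks IH] comp.
  exists 0 => a b; rewrite big_nil; have := tl (-1) 0 0.
  rewrite scaler0 addr0 scaleN1r addNr => ->.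
  by rewrite (ev0 (separated_tpre sD sD)).
have [|y sy] := IH; first by move=> k' k's; apply: comp; rewrite inE k's orbT.
have /comp[z sz] : k \in k :: ks by rewrite inE eqxx.
exists (1 *: z + y) => a b; rewrite tl big_cons.
by rewrite (ev_linear (separated_tpre sD sD)) -sz -sy scale1r.
Qed.

End Embedding.
End AstarHat.

Section DualBialgebroidCarrier.
Variables (R : realType) (V : vectType R[i]) (A : hbialg V) (hA : is_hbialgebroid A).

Let hC := hbialg_hcoalg hA.

Lemma in_AstarM phi psi : in_Astar phi -> in_Astar psi -> in_Astar (@dual_mul R V A phi psi).
Proof.
move=> /(in_AstarP hA)[du au] /(in_AstarP hA)[dv av].
apply/(in_AstarP hA); split; first exact: (in_dualM hC).
by apply: (splitsM hA) => //; [exact: in_dual_dualfun du|exact: in_dual_dualfun dv].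
Qed.

End DualBialgebroidCarrier.

(** * A model of the dual bialgebroid *)

Section DualCarrier.
Variables (R : realType) (V : vectType R[i]) (A : hbialg V) (hA : is_hbialgebroid A).
Notation C := R[i].
Notation D := (diffop V).

Let hC := hbialg_hcoalg hA.

(* The argument hA only lets the algebra structure, which depends on it, be found by
   unification. *)
Definition astar_pred (_ : is_hbialgebroid A) : {pred A -> D} := fun phi => `[< in_Astar phi >].

Lemma astar_pred_submod : submod_closed (astar_pred hA).
Proof.
split; first by apply/asboolP/(in_AstarP hA); split; [exact: (in_dual0 hC)|exact: astar0].
move=> c u v /asboolP/(in_AstarP hA)[du au] /asboolP/(in_AstarP hA)[dv av].
by apply/asboolP/(in_AstarP hA); split; [exact: (in_dual_lin hC)|exact: (astar_lin hA)].
Qed.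
HB.instance Definition _ :=
  GRing.isSubmodClosed.Build C (A -> D) (astar_pred hA) astar_pred_submod.

Record dualB := DualB { dval : A -> D; _ : dval \in astar_pred hA }.
HB.instance Definition _ := [isSub for dval].
HB.instance Definition _ := [Choice of dualB by <:].
HB.instance Definition _ := [SubChoice_isSubLmodule of dualB by <:].

Lemma dvalP (x : dualB) : in_Astar (dval x).
Proof. by have /asboolP := valP x. Qed.

Let dualfunP (x : dualB) : @dualfun R V A (dval x).
Proof. by have /(in_AstarP hA)[/in_dual_dualfun] := dvalP x. Qed.

Lemma dual_one_proof : @heps R V A \in astar_pred hA.
Proof.
apply/asboolP/(in_AstarP hA); split; last exact: astar1.
exact: dual_deg_in_dual (heps_deg hC).
Qed.

Lemma dual_muml_proof f : @dual_muml R V A f \in astar_pred hA.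
Proof.
apply/asboolP/(in_AstarP hA); split; last exact: astar_muml.
exact: dual_deg_in_dual (muml_deg hC f).
Qed.

Lemma dual_mumr_proof f : @dual_mumr R V A f \in astar_pred hA.
Proof.
apply/asboolP/(in_AstarP hA); split; last exact: astar_mumr.
exact: dual_deg_in_dual (mumr_deg hC f).
Qed.

Lemma dual_mul_proof (x y : dualB) : @dual_mul R V A (dval x) (dval y) \in astar_pred hA.
Proof. by apply/asboolP; apply: (in_AstarM hA); exact: dvalP. Qed.

Definition dualB_mul x y := DualB (dual_mul_proof x y).
Definition dualB_one := DualB dual_one_proof.

Fact dualB_mulA : associative dualB_mul.
Proof. by move=> x y z; apply: val_inj; exact: (dual_mulA hC). Qed.
Fact dualB_mul1l : left_id dualB_one dualB_mul.
Proof. by move=> x; apply: val_inj; exact: (dual_mul1 hC (dualfunP x)). Qed.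
Fact dualB_mul1r : right_id dualB_one dualB_mul.
Proof. by move=> x; apply: val_inj; exact: (dual_mulr1 hC (dualfunP x)). Qed.
Fact dualB_mulDl : left_distributive dualB_mul +%R.
Proof.
move=> x y z; apply: val_inj => /=.
by have := @dual_mul_linl R V A 1 (dval x) (dval y) (dval z); rewrite !scale1r.
Qed.
Fact dualB_mulDr : right_distributive dualB_mul +%R.
Proof.
move=> x y z; apply: val_inj => /=.
by have := @dual_mul_linr R V A 1 (dval x) (dval y) (dval z); rewrite !scale1r.
Qed.
Fact dualB_one_neq0 : dualB_one != 0.
Proof.
apply/eqP => /(congr1 dval)/(congr1 (@^~ (1 : A))).
by rewrite [LHS](hbialg_eps1 hA) => /eqP; rewrite (negPf (oner_neq0 _)).
Qed.
HB.instance Definition _ := GRing.Zmodule_isNzRing.Build dualB dualB_mulA dualB_mul1l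
  dualB_mul1r dualB_mulDl dualB_mulDr dualB_one_neq0.
Fact dualB_scaleAl (c : C) (x y : dualB) : c *: (x * y) = c *: x * y.
Proof.
apply: val_inj => /=; have := @dual_mul_linl R V A c (dval x) 0 (dval y).
have := @dual_mul_linl R V A (-1) 0 0 (dval y).
by rewrite scaler0 addr0 scaleN1r addNr => ->; rewrite !addr0.
Qed.
HB.instance Definition _ := GRing.Lmodule_isLalgebra.Build C dualB dualB_scaleAl.
Fact dualB_scaleAr (c : C) (x y : dualB) : c *: (x * y) = x * (c *: y).
Proof.
apply: val_inj => /=; have := @dual_mul_linr R V A c (dval x) (dval y) 0.
have := @dual_mul_linr R V A (-1) (dval x) 0 0.
by rewrite scaler0 addr0 scaleN1r addNr => ->; rewrite !addr0.
Qed.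
HB.instance Definition _ := GRing.Lalgebra_isAlgebra.Build C dualB dualB_scaleAr.

Definition dual_halg : halg V := @Halg R V dualB (fun al be x => @dual_deg R V A al be (dval x))
  (fun f x => dualB_mul (DualB (dual_muml_proof f)) x)
  (fun f x => dualB_mul (DualB (dual_mumr_proof f)) x).

Lemma exists_dual : exists (B : hbialg V) (j : B -> A -> D), is_dual j.
Proof.
have cop (x : dual_halg) : exists y : mtensor dual_halg dual_halg, splits (dval x)
    (@tmap R V dual_halg (dual_pre A) dual_halg (dual_pre A) dval dval y).
  apply: (@embedding_coproduct R V A hA dual_halg dval) => //; last exact: dvalP.
  - exact: val_inj.
  - move=> phi dphi; have h : phi \in astar_pred hA by apply/asboolP.
    by exists (DualB h).
(* [is_dual] asks only for the compatibility of the coproduct with [iota], so arbitrary splittings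
   may be chosen; linearity and the other axioms will follow from separation. *)
have [De Dp] := choice cop.
exists (@Hbialg R V dual_halg De (fun x => dval x 1)), dval; split=> //.
- exact: val_inj.
- apply/seteqP; split=> [_ [x _ <-]|phi dphi]; first exact: dvalP.
  have h : phi \in astar_pred hA by apply/asboolP.
  by exists (DualB h).
- move=> x; apply/(iota_mdual hA); last exact: Dp.
  by have /(in_AstarP hA)[] := dvalP x.
Qed.

End DualCarrier.

(** * The antipode reverses bidegrees and products *)

Section Coassoc.
Variables (R : realType) (V : vectType R[i]) (A : hcoalg V) (hA : is_hcoalgebroid A).
Variables (Z : lmodType R[i]).
Notation C := R[i].

Let pA := hcoalg_prealg hA.
Let wA := hprealgebra_wpre pA.
Let wAA := wpre_tpre wA wA.

Lemma lift_lin (P Q : hpre V) (c : C) (F G K : V -> V -> V -> P -> Q -> Z) x :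
  (forall al ga be p q, hdeg al ga p -> hdeg ga be q ->
    K al ga be p q = c *: F al ga be p q + G al ga be p q) ->
  mtlift K x = c *: mtlift F x + mtlift G x.
Proof.
have [L [Lok Le]] := mtlift_expand x; rewrite !Le => h; rewrite scaler_sumr -big_split /=.
apply: eq_big_seq => -[d [[[[al ga] be] p] q]] /Lok[/= dp dq].
by rewrite h // scalerDr !scalerA [d * c]mulrC.
Qed.

(* The first two arguments of H are the bidegree of its first element. *)
Record trilin (H : V -> V -> A -> A -> A -> Z) : Prop := Trilin {
  tl1 : forall al de q e, linear (fun p => H al de p q e);
  tl2 : forall al de p e, linear (fun q => H al de p q e);
  tl3 : forall al de p q, linear (H al de p q);
  tb1 : forall f al de p q e, hdeg al de p -> H al de (hmr f p) q e = H al de p (hml f q) e;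
  tb2 : forall f al de de' ga be p q e, hdeg de' ga q -> hdeg ga be e ->
    H al de p (hmr f q) e = H al de p q (hml f e) }.

Variables (H : V -> V -> A -> A -> A -> Z) (tH : trilin H).

Lemma trilin_right al de p : balanced (fun (_ _ _ : V) (q e : A) => H al de p q e).
Proof.
split=> [*|*|f de' ga be q e dq dee]; [exact: (tl2 tH)|exact: (tl3 tH)|exact: (tb2 tH f _ _ _ dq dee)].
Qed.

Lemma trilin_left e : balanced (fun (al de _ : V) (p q : A) => H al de p q e).
Proof.
split=> [al de ga c p p' q _ _ _|*|f al de ga p q dp _]; [|exact: (tl2 tH)|exact: (tb1 tH)].
exact: (tl1 tH al de q e).
Qed.

Lemma trilin_outer_right : balanced (fun (al de _ : V) (p : A) (w : tpre A A) =>
  mtlift (fun _ _ _ q e => H al de p q e) w).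
Proof.
split=> [al de be c p p' w _ _ _|al de be c p w w' _ _ _|f al de be p w dp [s [sok ->]]].
- by apply: lift_lin => _ _ _ q e _ _; exact: (tl1 tH al de q e).
- exact: (mtlift_linear wA wA (trilin_right al de p)).
- rewrite [hml f _](mtlift_mtens_sum wA wA (tml_balanced wA wA f) sok).
  rewrite (mtlift_mtens_sum wA wA (trilin_right _ _ _) sok).
  rewrite (mtlift_mtens_sum wA wA (trilin_right _ _ _)) => [|t /sok[dq de']].
    by apply: eq_bigr => t _; rewrite (tb1 tH _ _ _ dp).
  by split=> //; exact: wml_deg.
Qed.

Lemma trilin_outer_left : balanced (fun (_ _ _ : V) (w : tpre A A) (e : A) =>
  mtlift (fun al de _ p q => H al de p q e) w).
Proof.
split=> [_ _ _ c w w' e _ _ _|_ _ _ c w e e' _ _ _|f al ga be w e [s [sok ->]] de'].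
- exact: (mtlift_linear wA wA (trilin_left e)).
- by apply: lift_lin => al de _ p q _ _; exact: (tl3 tH).
- rewrite [hmr f _](mtlift_mtens_sum wA wA (tmr_balanced wA wA f) sok).
  rewrite (mtlift_mtens_sum wA wA (trilin_left _) sok).
  rewrite (mtlift_mtens_sum wA wA (trilin_left _)) => [|t /sok[dp dq]].
    apply: eq_big_seq => t /sok[dp dq].
    by rewrite (tb2 tH _ _ _ _ dq de').
  by split=> //; exact: wmr_deg.
Qed.

Lemma trilin_tassoc (x : mtensor (tpre A A) A) :
  mtlift (fun (al de _ : V) (p : A) (w : tpre A A) => mtlift (fun _ _ _ q e => H al de p q e) w)
    (tassoc x) =
  mtlift (fun (_ _ _ : V) (w : tpre A A) (e : A) => mtlift (fun al de _ p q => H al de p q e) w) x.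
Proof.
have lR := mtlift_linear wA wAA trilin_outer_right.
have lL := mtlift_linear wAA wA trilin_outer_left.
move: x; apply: (@mtensor_ext _ _ _ _ wAA wA Z (fun x => mtlift
   (fun (al de _ : V) (p : A) (w : tpre A A) => mtlift (fun _ _ _ q e => H al de p q e) w)
    (tassoc x)) (mtlift (fun (_ _ _ : V) (w : tpre A A) (e : A) =>
     mtlift (fun al de _ p q => H al de p q e) w))).
- by move=> c x y; rewrite (tassoc_linear wA wA wA) lR.
- exact: lL.
move=> al ga be w e [s [sok ->]] de.
have ok' t : t \in s -> hdeg al t.1.1 t.1.2 /\
    hdeg t.1.1 be (mtens t.1.1 ga be t.2 e : tpre A A).
  by move=> /sok[dp dq]; split=> //; exact: tdeg_mtens.
have -> : tassoc (mtens al ga be (\sum_(t <- s) mtens al t.1.1 ga t.1.2 t.2 : tpre A A) e)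
  = \sum_(t <- s) mtens al t.1.1 be t.1.2 (mtens t.1.1 ga be t.2 e : tpre A A).
  rewrite /tassoc (mtlift_mtens wAA wA (tassoc_balanced wA wA wA)) //; last by exists s.
  by rewrite (mtlift_mtens_sum wA wA (tassoc_inner wA wA wA _ _) sok).
rewrite (mtlift_mtens_sum wA wAA trilin_outer_right ok').
rewrite (mtlift_mtens wAA wA trilin_outer_left) //; last by exists s.
rewrite (mtlift_mtens_sum wA wA (trilin_left _) sok).
apply: eq_big_seq => t /sok[dp dq].
by rewrite (mtlift_mtens wA wA (trilin_right _ _ _)).
Qed.

(** Coassociativity as a computation rule: a sum of H(a', a'', a''') may be bracketed either way. *)
Lemma coassoc_lift (a : A) :
  mtlift (fun _ _ _ w e => mtlift (fun al de _ p q => H al de p q e) (hDelta w)) (hDelta a) =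
  mtlift (fun al de _ p w => mtlift (fun _ _ _ q e => H al de p q e) (hDelta w)) (hDelta a).
Proof.
have hD := prehom_whom (hDelta_hom hA).
rewrite -(mtlift_tmap wA wAA wA wA hD (whom_id A) trilin_outer_left).
rewrite -(mtlift_tmap wA wA wA wAA (whom_id A) hD trilin_outer_right).
by rewrite -(hDelta_coassoc hA) trilin_tassoc.
Qed.

Lemma coassoc_balanced_left : balanced (fun (_ _ _ : V) (w e : A) =>
  mtlift (fun al de _ p q => H al de p q e) (hDelta w)).
Proof. exact: (balanced_comp (prehom_whom (hDelta_hom hA)) (whom_id A) trilin_outer_left). Qed.

Lemma coassoc_balanced_right : balanced (fun (al de _ : V) (p w : A) =>
  mtlift (fun _ _ _ q e => H al de p q e) (hDelta w)).
Proof. exact: (balanced_comp (whom_id A) (prehom_whom (hDelta_hom hA)) trilin_outer_right). Qed.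

End Coassoc.

Section Projection.
Variables (R : realType) (V : vectType R[i]) (A : hpre V) (pA : is_hprealgebra A).

Lemma hdeg_components_uniq (s s' : seq (V * V * A)) :
  (forall t, t \in s -> hdeg t.1.1 t.1.2 t.2) -> (forall t, t \in s' -> hdeg t.1.1 t.1.2 t.2) ->
  \sum_(t <- s) t.2 = \sum_(t <- s') t.2 ->
  forall k, \sum_(t <- s | t.1 == k) t.2 = \sum_(t <- s' | t.1 == k) t.2.
Proof.
have wA := hprealgebra_wpre pA => sd sd' e k.
pose F k := \sum_(t <- s | t.1 == k) t.2 - \sum_(t <- s' | t.1 == k) t.2.
have dF k' : hdeg k'.1 k'.2 (F k').
  apply: (wdegD wA); last apply: (wdegN wA).
    by apply: (wdeg_sum wA) => t /sd dt /eqP <-.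
  by apply: (wdeg_sum wA) => t /sd' dt /eqP <-.
pose ks := undup (map fst (s ++ s') ++ [:: k]).
have E (r : seq (V * V * A)) : {subset r <= s ++ s'} ->
    \sum_(k' <- ks) \sum_(t <- r | t.1 == k') t.2 = \sum_(t <- r) t.2.
  move=> rs; rewrite [RHS](big_group fst).
  apply: big_usub; [exact: undup_uniq|exact: undup_uniq| |].
    move=> k'; rewrite !mem_undup mem_cat => /mapP[t /rs tr ->].
    by rewrite map_f.
  move=> k' _; rewrite mem_undup => nk; rewrite big_seq_cond big1 // => t /andP[tr /eqP tk].
  by rewrite -tk map_f in nk.
have := @hdeg_direct R V A pA F ks (undup_uniq _) dF.
rewrite sumrB !E => [|t ts|t ts]; rewrite ?mem_cat ?ts ?orbT // e subrr => /(_ erefl k) h.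
by apply/eqP; rewrite -subr_eq0; apply/eqP/h; rewrite mem_undup mem_cat inE eqxx orbT.
Qed.

(** Needed because the antipode is not assumed to respect bidegrees: its components have to be
    isolated before they can be compared with it. *)
Lemma exists_projection : exists P : V * V -> A -> A,
  [/\ forall k, linear (P k), forall k a, hdeg k.1 k.2 (P k a),
      forall k a, hdeg k.1 k.2 a -> P k a = a &
      forall k k' a, k' != k -> hdeg k'.1 k'.2 a -> P k a = 0].
Proof.
have wA := hprealgebra_wpre pA; have [s sP] := choice (hdeg_sum pA).
have sd a : forall t, t \in s a -> hdeg t.1.1 t.1.2 t.2 by have [] := sP a.
have se a : a = \sum_(t <- s a) t.2 by have [] := sP a.
have single (k : V * V) (a : A) : hdeg k.1 k.2 a -> forall t, t \in [:: (k, a)] -> hdeg t.1.1 t.1.2 t.2.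
  by move=> da t; rewrite inE => /eqP ->.
exists (fun k a => \sum_(t <- s a | t.1 == k) t.2); split=> [k c a b|k a|k a da|k k' a kk da].
- pose r := [seq (t.1, c *: t.2) | t <- s a] ++ s b.
  have rd t : t \in r -> hdeg t.1.1 t.1.2 t.2.
    rewrite mem_cat => /orP[/mapP[u /sd du ->]|/sd //] /=; exact: (wdegZ wA).
  rewrite (hdeg_components_uniq (s' := r) (@sd _) rd); first by rewrite big_cat big_map scaler_sumr.
  by rewrite -se [RHS]big_cat big_map /= -scaler_sumr -!se.
- by apply: (wdeg_sum wA) => t /sd dt /eqP <-.
- rewrite (hdeg_components_uniq (@sd a) (single _ _ da)); last by rewrite -se big_seq1.
  by rewrite big_mkcond big_seq1 eqxx.
- rewrite (hdeg_components_uniq (@sd a) (single _ _ da)); last by rewrite -se big_seq1.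
  by rewrite big_mkcond big_seq1 (negPf kk).
Qed.

End Projection.

Section AntipodeBalanced.
Variables (R : realType) (V : vectType R[i]) (A : halg V) (hA : is_halgebra A) (S : A -> A).
Hypotheses (SL : linear S) (Smr : forall f a, S (halg_mr f a) = S a * halg_ml f 1)
  (Sml : forall f a, S (a * halg_ml f 1) = halg_mr f (S a)).

(** Derived from the moment map identities alone, so that it also applies to the candidate antipode
    of the dual before the antipode axioms are known. *)
Lemma antipode_mull f x y : S x * halg_ml f y = S (halg_mr f x) * y.
Proof. by rewrite (halg_mlE hA) Smr mulrA. Qed.

Lemma antipode_mulr f al ga be x y : halg_deg al ga x -> halg_deg ga be y ->
  halg_mr f x * S y = x * S (halg_ml f y).
Proof.
move=> dx dy; rewrite (halg_mrr hA _ dx) (halg_mlr hA _ dy) Sml.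
by rewrite [in RHS](halg_mrE hA) mulrA.
Qed.

Lemma antipode_l_balanced : @balanced R V A A A (fun _ _ _ x y => S x * y).
Proof.
split=> [al ga be c x x' y dx dx' dy|al ga be c x y y' dx dy dy'|f al ga be x y dx dy].
- by rewrite SL mulrDl -scalerAl.
- by rewrite mulrDr -scalerAr.
- exact/esym/antipode_mull.
Qed.

Lemma antipode_r_balanced : @balanced R V A A A (fun _ _ _ x y => x * S y).
Proof.
split=> [al ga be c x x' y dx dx' dy|al ga be c x y y' dx dy dy'|f al ga be x y dx dy].
- by rewrite mulrDl -scalerAl.
- by rewrite SL mulrDr -scalerAr.
- exact: antipode_mulr dx dy.
Qed.

End AntipodeBalanced.

(** * The antipode of A *)

Section AntipodeA.
Variables (R : realType) (V : vectType R[i]) (A : hbialg V) (S : A -> A).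
Hypothesis hS : is_hHopf_algebroid S.
Notation M := (mero V).
Notation D := (diffop V).

Let hA := hHopf_bialg hS.
Let aS := hHopf_antipode hS.
Let hH := hbialg_halg hA.
Let hC := hbialg_hcoalg hA.
Let pA : is_hprealgebra A := hcoalg_prealg hC.
Let wA := hprealgebra_wpre pA.
Let wDh := @dhdeg_Dh R V.

Local Notation ml := (@hml R V A).
Local Notation mr := (@hmr R V A).
Local Notation deg := (@hdeg R V A).
Local Notation Dl := (@hDelta R V A).
Local Notation lift F x := (@mtlift R V A A A F x).

Lemma hmlE f a : ml f a = ml f 1 * a. Proof. exact: (halg_mlE hH). Qed.
Lemma hmrE f a : mr f a = mr f 1 * a. Proof. exact: (halg_mrE hH). Qed.
Lemma hml_right f al be a : deg al be a -> ml f a = a * ml (shift al f) 1.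
Proof. exact: (halg_mlr hH). Qed.
Lemma hmr_right f al be a : deg al be a -> mr f a = a * mr (shift be f) 1.
Proof. exact: (halg_mrr hH). Qed.
Lemma S_hmr f a : S (mr f a) = S a * ml f 1. Proof. exact: (antipode_mr aS). Qed.
Lemma S_hml f a : S (a * ml f 1) = mr f (S a). Proof. exact: (antipode_ml aS). Qed.
Lemma deg1 : deg 0 0 1. Proof. exact: (halg_deg1 hH). Qed.

(** The function eps(a)1 of the antipode axioms. On homogeneous elements it vanishes unless the two
    degrees agree. *)
Definition epsv (a : A) : M := (@heps R V A a : D) 1.

Lemma epsv_deg al be a : deg al be a -> al <> be -> epsv a = 0.
Proof.
move=> da ab; rewrite /epsv (_ : @heps R V A a = 0) //; apply: contrapT => nz.
exact: ab (dhdeg_neq0 (prehom_deg (heps_hom hC) da) nz).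
Qed.

Lemma epsv_lin c x y : epsv (c *: x + y) = c *: epsv x + epsv y.
Proof. by rewrite /epsv (prehom_linear (heps_hom hC)). Qed.

Lemma epsv_ml f x : epsv (ml f x) = f * epsv x.
Proof. by rewrite /epsv [heps _](prehom_ml (heps_hom hC)) [LHS]dopE shift0. Qed.

Lemma epsv_mr f x : epsv (mr f x) = f * epsv x.
Proof. by rewrite /epsv [heps _](prehom_mr (heps_hom hC)) [LHS]dopE shift0. Qed.

Lemma lift_Sl al be a : deg al be a ->
  lift (fun _ _ _ x y => S x * y) (Dl a) = mr (shift al (epsv a)) 1.
Proof. exact: (antipode_l aS). Qed.

Lemma lift_Sr a : lift (fun _ _ _ x y => x * S y) (Dl a) = ml (epsv a) 1.
Proof. exact: (antipode_r aS). Qed.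

Lemma SL : linear S. Proof. exact: antipode_linear aS. Qed.

Let S_ml f x y : S x * ml f y = S (mr f x) * y := antipode_mull hH S_hmr f x y.
Let S_mr f al ga be x y : deg al ga x -> deg ga be y -> mr f x * S y = x * S (ml f y).
Proof. exact: (antipode_mulr hH S_hml). Qed.
Let bl := antipode_l_balanced hH SL S_hmr.

(** The counit axiom read through the map x (x) d -> mu_r(d 1) x, which inverts the canonical
    identification of A with its product with D_h. *)
Lemma counitr_lift al be a : deg al be a ->
  lift (fun _ _ _ x y => mr (epsv y) x) (Dl a) = a.
Proof.
move=> da; have b : @balanced R V A (Dh V) A (fun (_ _ _ : V) (x : A) (d : Dh V) =>
    mr ((d : D) 1) x : A).
  split=> [al' ga be' c x x' d dx dx' dd|al' ga be' c x d d' dx dd dd'|f al' ga be' x d dx dd].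
  - exact: (wmr_lin wA _ c dx dx').
  - rewrite -[dfun _ _]/(c *: dfun d 1 + dfun d' 1) (wmrD wA _ _ dx) -mulr_algl (wmrM wA _ _ dx).
    by rewrite (wmr_cst wA _ (wmr_deg wA _ dx)).
  - rewrite -(wmrM wA _ _ dx) mulrC -[dfun (hml f d) 1]/(dop f 0 (dfun d 1)).
    by rewrite dopE shift0.
have he := prehom_whom (heps_hom hC).
have := mtlift_tmap wA wA wA wDh (whom_id A) he b (Dl a); rewrite (heps_counitr hC da).
rewrite (mtlift_mtens wA wDh b) //; last exact: dhdeg_dop.
by rewrite dop_at1 (wmr1 wA da) => <-.
Qed.

Lemma counitl_lift al be a : deg al be a ->
  lift (fun _ _ _ x y => ml (epsv x) y) (Dl a) = a.
Proof.
move=> da; have b : @balanced R V (Dh V) A A (fun (_ _ _ : V) (d : Dh V) (x : A) =>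
    ml ((d : D) 1) x : A).
  split=> [al' ga be' c d d' x dd dd' dx|al' ga be' c d x x' dd dx dx'|f al' ga be' d x dd dx].
  - rewrite -[dfun _ _]/(c *: dfun d 1 + dfun d' 1) (wmlD wA _ _ dx) -mulr_algl (wmlM wA _ _ dx).
    by rewrite (wml_cst wA _ (wml_deg wA _ dx)).
  - exact: (wml_lin wA _ c dx dx').
  - rewrite -(wmlM wA _ _ dx) mulrC -[dfun (hmr f d) 1]/(dop f 0 (dfun d 1)).
    by rewrite dopE shift0.
have he := prehom_whom (heps_hom hC).
have := mtlift_tmap wA wDh wA wA he (whom_id A) b (Dl a); rewrite (heps_counitl hC da).
rewrite (mtlift_mtens wDh wA b) //; last exact: dhdeg_dop.
by rewrite dop_at1 (wml1 wA da) => <-.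
Qed.

Section DeltaList.
Variables (al be : V) (a : A) (s : seq (V * A * A)).
Hypotheses (da : deg al be a)
  (sok : forall t, t \in s -> deg al t.1.1 t.1.2 /\ deg t.1.1 be t.2)
  (Ds : Dl a = \sum_(t <- s) @mtens R V A A al t.1.1 be t.1.2 t.2).

Lemma Delta_lift (F : V -> V -> V -> A -> A -> A) : @balanced R V A A A F ->
  lift F (Dl a) = \sum_(t <- s) F al t.1.1 be t.1.2 t.2.
Proof. by move=> bF; rewrite Ds; exact: (mtlift_mtens_sum wA wA bF sok). Qed.

Lemma counitr_list : \sum_(t <- s) mr (epsv t.2) t.1.2 = a.
Proof.
rewrite -[RHS](counitr_lift da) Delta_lift //.
split=> [al' ga be' c x x' y dx dx' dy|al' ga be' c x y y' dx dy dy'|f al' ga be' x y dx dy].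
- exact: (wmr_lin wA _ c dx dx').
- rewrite epsv_lin (wmrD wA _ _ dx).
  by rewrite -mulr_algl (wmrM wA _ _ dx) (wmr_cst wA _ (wmr_deg wA _ dx)).
- by rewrite -(wmrM wA _ _ dx) mulrC epsv_ml.
Qed.

Lemma counitl_list : \sum_(t <- s) ml (epsv t.1.2) t.2 = a.
Proof.
rewrite -[RHS](counitl_lift da) Delta_lift //.
split=> [al' ga be' c x x' y dx dx' dy|al' ga be' c x y y' dx dy dy'|f al' ga be' x y dx dy].
- rewrite epsv_lin (wmlD wA _ _ dy).
  by rewrite -mulr_algl (wmlM wA _ _ dy) (wml_cst wA _ (wml_deg wA _ dy)).
- exact: (wml_lin wA _ c dy dy').
- by rewrite -(wmlM wA _ _ dy) mulrC epsv_mr.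
Qed.

Lemma antipode_l_list : \sum_(t <- s) S t.1.2 * t.2 = mr (shift al (epsv a)) 1.
Proof. by rewrite -(lift_Sl da) -(Delta_lift bl). Qed.

(** S is applied to the left counit identity. The shift appears when the left action is turned into
    a right multiplication, which S carries to the right moment map; terms whose middle degree is
    not [al] have counit 0. *)
Lemma antipode_counit : \sum_(t <- s) mr (shift al (epsv t.1.2)) 1 * S t.2 = S a.
Proof.
rewrite -[in RHS]counitl_list (lin_sum SL); apply: eq_big_seq => t /sok[dx dy].
have [e|ne] := eqVneq al t.1.1; last first.
  by rewrite (epsv_deg dx (elimN eqP ne)) raddf0 [mr 0 _](wmr0 wA deg1)
    [ml 0 _](wml0 wA dy) (lin0 SL) mul0r.
by rewrite -hmrE -S_hml e -(hml_right _ dy).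
Qed.

Lemma coassoc_list (H : V -> V -> A -> A -> A -> A) : @trilin R V A A H ->
  \sum_(t <- s) lift (fun ka la _ p q => H ka la p q t.2) (Dl t.1.2) =
  \sum_(t <- s) lift (fun _ _ _ q e => H al t.1.1 t.1.2 q e) (Dl t.2).
Proof.
move=> tH; rewrite -(Delta_lift (coassoc_balanced_left hC tH)).
rewrite -(Delta_lift (coassoc_balanced_right hC tH)); exact: (coassoc_lift hC tH).
Qed.

End DeltaList.

Lemma lift_mull (c : A) (F : V -> V -> V -> A -> A -> A) x :
  lift (fun al ga be p q => c * F al ga be p q) x = c * lift F x.
Proof.
have [L [_ Le]] := mtlift_expand x; rewrite !Le mulr_sumr.
by apply: eq_bigr => -[d [[[[al ga] be] p] q]] _ /=; rewrite scalerAr.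
Qed.

Lemma lift_mulr (c : A) (F : V -> V -> V -> A -> A -> A) x :
  lift (fun al ga be p q => F al ga be p q * c) x = lift F x * c.
Proof.
have [L [_ Le]] := mtlift_expand x; rewrite !Le mulr_suml.
by apply: eq_bigr => -[d [[[[al ga] be] p] q]] _ /=; rewrite scalerAl.
Qed.

Lemma lift_antipode_r (c : A) (a : A) :
  lift (fun _ _ _ q e => c * q * S e) (Dl a) = c * ml (epsv a) 1.
Proof.
rewrite -(lift_Sr a) -lift_mull; apply: eq_mtlift => al ga be p q _ _.
by rewrite mulrA.
Qed.

(* S is a convolution inverse of the identity, and so is its part of the expected
   bidegree; the two coincide. *)
Lemma S_deg al be a : deg al be a -> deg (- be) (- al) (S a).
Proof.
move=> da; have [P [PL Pd Pid P0]] := exists_projection pA.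
(* Multiplication by a homogeneous b shifts bidegrees, hence commutes with the projections up to
   that shift. *)
have P_mulr ga de z b k : deg ga de b -> P k (z * b) = P (k.1 - ga, k.2 - de) z * b.
  move=> db; have [s [sd ->]] := hdeg_sum pA z.
  rewrite mulr_suml !(lin_sum (PL _)) mulr_suml.
  apply: eq_big_seq => -[k' x] /sd /= dx.
  have dxb : deg (k'.1 + ga) (k'.2 + de) (x * b) := hdegM hH dx db.
  have [e|ne] := eqVneq k' (k.1 - ga, k.2 - de).
    rewrite Pid; last by rewrite e /= !subrK in dxb.
    by rewrite Pid // -e.
  rewrite (P0 _ _ _ ne dx) mul0r (P0 _ (k'.1 + ga, k'.2 + de)) //.
  by apply: contra ne => /eqP <- /=; rewrite !addrK -surjective_pairing.
have [s [sok Ds]] := Delta_sum hC da.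
(* Coassociativity is applied to P(S a') a'' S(a'''), where P projects to the bidegree expected of S
   a'. Contracting the first two factors yields S a, contracting the last two yields P(S a). *)
pose H ka la (p q e : A) := P (- la, - ka) (S p) * q * S e.
have P_ml f k z : P k (z * ml f 1) = P k z * ml f 1.
  by rewrite (P_mulr _ _ _ _ _ (wml_deg wA f deg1)) !subr0; case: k.
have tH : @trilin R V A A H.
  split=> [ka la q e c p p'|ka la p e c q q'|ka la p q c e e'|f ka la p q e dp
    |f ka la de' ga be' p q e dq de]; rewrite /H.
  - by rewrite SL PL !mulrDl -!scalerAl.
  - by rewrite mulrDr !mulrDl -scalerAr -scalerAl.
  - by rewrite SL mulrDr -scalerAr.
  - by rewrite S_hmr P_ml [hml f q]hmlE !mulrA.
  - by rewrite -!mulrA (S_mr _ dq de).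
have := coassoc_list sok Ds tH.
have -> : \sum_(t <- s) lift (fun ka la _ p q => H ka la p q t.2) (Dl t.1.2) = S a.
  rewrite -[RHS](antipode_counit da sok Ds).
  apply: eq_big_seq => t /sok[dx dy]; rewrite /H lift_mulr; congr (_ * _).
  have [u [uok Du]] := Delta_sum hC dx.
  have b : @balanced R V A A A (fun ka la _ p q => P (- la, - ka) (S p) * q).
    split=> [ka la m c p p' q dp dp' dq|ka la m c p q q' dp dq dq'|f ka la m p q dp dq].
    - by rewrite SL PL mulrDl -scalerAl.
    - by rewrite mulrDr -scalerAr.
    - by rewrite S_hmr P_ml [hml f q]hmlE !mulrA.
  rewrite (Delta_lift uok Du b).
  (* Each P(S p) q is the same component of S p q, so the antipode axiom can be applied before
     projecting. Its right-hand side has bidegree (0, 0) and vanishes unless [al] is the middle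
     degree. *)
  transitivity (P (0, t.1.1 - al) (\sum_(v <- u) S v.1.2 * v.2)).
    rewrite (lin_sum (PL _)); apply: eq_big_seq => v /uok[dv dw].
    rewrite [RHS](P_mulr _ _ _ _ _ dw) /= sub0r.
    by congr (P (_, _) _ * _); vring.
  rewrite (antipode_l_list dx uok Du).
  have [e|/eqP ne] := eqVneq al t.1.1; last first.
    rewrite (epsv_deg dx ne) raddf0 [mr 0 _](wmr0 wA deg1).
    by rewrite Pid //; exact: (wdeg0 wA).
  by rewrite -e subrr Pid //; exact: (wmr_deg wA _ deg1).
move=> ->; suff -> : \sum_(t <- s) lift (fun _ _ _ q e => H al t.1.1 t.1.2 q e) (Dl t.2) =
  P (- be, - al) (S a) by exact: (Pd (- be, - al)).
rewrite -[in RHS](counitr_list da sok Ds) (lin_sum SL) (lin_sum (PL _)).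
apply: eq_big_seq => t /sok[dx dy].
rewrite /H lift_antipode_r S_hmr P_ml.
(* The counit kills all terms except those of middle degree [be], for which the projection is the
   expected one. *)
have [->|/eqP ne] := eqVneq t.1.1 be; first by [].
by rewrite (epsv_deg dy ne) [ml 0 _](wml0 wA deg1) !mulr0.
Qed.

(* Both sides are convolution inverse to the multiplication. *)
Lemma S_mul al be rh sg a b : deg al be a -> deg rh sg b -> S (a * b) = S b * S a.
Proof.
move=> da db; have [s [sok Ds]] := Delta_sum hC da; have [r [rok Dr]] := Delta_sum hC db.
have slice1 ga w : deg al ga w ->
    lift (fun _ _ _ p q => S (p * b) * q) (Dl w) = mr (shift (al + rh) (epsv w)) 1 * S b.
  move=> dw; have [u [uok Du]] := Delta_sum hC dw.
  rewrite (Delta_lift uok Du); last first.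
    split=> [al' m be' c x x' y dx dx' dy|al' m be' c x y y' dx dy dy'|f al' m be' x y dx dy].
    - by rewrite mulrDl -scalerAl SL mulrDl -scalerAl.
    - by rewrite mulrDr -scalerAr.
    - by rewrite S_ml -[hmr f x * b](mrM hH).
  (* Inserting b'' S(b''') turns S(w' b) w'' into S(w' b') w'' b'' S(b'''), whose first part will
     contract to the counit of w b'. *)
  transitivity (\sum_(x <- u) \sum_(v <- r)
      lift (fun _ _ _ p q => S (x.1.2 * p) * x.2 * q) (Dl v.1.2) * S v.2).
    apply: eq_big_seq => x /uok[dx1 dx2].
    pose H (_ _ : V) (p q e : A) := S (x.1.2 * p) * x.2 * q * S e.
    have step f v : S (x.1.2 * mr f v) * x.2 = S (x.1.2 * v) * x.2 * ml f 1.
      rewrite [_ * mr f v](mul_mr hH _ _ dx1) -(mrM hH) -S_ml (hml_right _ dx2).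
      by rewrite shiftK mulrA.
    have tH : @trilin R V A A H.
      split=> [ka la q e c p p'|ka la p e c q q'|ka la p q c e e'|f ka la p q e dp
        |f ka la de' m be' p q e dq de]; rewrite /H.
      - by rewrite mulrDr -scalerAr SL !mulrDl -!scalerAl.
      - by rewrite mulrDr !mulrDl -scalerAr -scalerAl.
      - by rewrite SL mulrDr -scalerAr.
      - by rewrite [hmr f p]/(mr f p) step [hml f q]hmlE !mulrA.
      - by rewrite -!mulrA (S_mr _ dq de).
    under [RHS]eq_bigr do rewrite -lift_mulr.
    rewrite (coassoc_list rok Dr tH) -[in LHS](counitr_list db rok Dr).
    rewrite mulr_sumr (lin_sum SL) mulr_suml; apply: eq_bigr => v _.
    by rewrite /H lift_antipode_r step.
  rewrite exchange_big /= -[in RHS](antipode_counit db rok Dr) mulr_sumr.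
  apply: eq_big_seq => v /rok[dv1 dv2].
  rewrite -mulr_suml mulrA; congr (_ * _).
  have [z [zok Dz]] := Delta_sum hC dv1.
  (* Multiplicativity of the coproduct recognizes the double sum as the left antipode axiom for a
     product. *)
  transitivity (lift (fun _ _ _ x y => S x * y) (Dl (w * v.1.2))).
    have -> : Dl (w * v.1.2) = \sum_(x <- u) \sum_(y <- z) @mtens R V A A (al + rh)
        (x.1.1 + y.1.1) (ga + v.1.1) (x.1.2 * y.1.2) (x.2 * y.2).
      rewrite [Dl _](hbialg_DeltaM hA) -[hbialg_Delta w]/(Dl w) -[hbialg_Delta v.1.2]/(Dl v.1.2).
      rewrite Du Dz.
      exact: (@tmul_mtens_sum _ _ _ _ hH hH _ _ u z (fun=> al) (fun t => t.1.1) (fun=> ga)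
        (fun=> rh) (fun t => t.1.1) (fun=> v.1.1) (fun t => t.1.2) snd (fun t => t.1.2) snd uok zok).
    rewrite (mtlift_sum wA wA bl).
    apply: eq_big_seq => x /uok[dx1 dx2].
    rewrite (mtlift_sum wA wA bl) (Delta_lift zok Dz); last first.
      split=> [al' m be' c p p' q dp dp' dq|al' m be' c p q q' dp dq dq'|f al' m be' p q dp dq].
      - by rewrite mulrDr -scalerAr SL !mulrDl -!scalerAl.
      - by rewrite mulrDr -scalerAr.
      - rewrite [_ * hmr f p](mul_mr hH _ _ dx1) -(mrM hH) -S_ml -!mulrA; congr (_ * _).
        by rewrite [RHS](mul_ml hH _ _ dx2).
    apply: eq_big_seq => y /zok[dy1 dy2].
    rewrite (mtlift_mtens wA wA bl) ?mulrA //; exact: (hdegM hH).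
  (* The counit of the product, applied to 1, is that of w times the translate by - al of that of
     b', because eps(w) has left degree al. *)
  rewrite (lift_Sl (hdegM hH dw dv1)) {1}/epsv [heps _](hbialg_epsM hA) dcompE dmulE.
  rewrite -[hbialg_eps w]/(@heps R V A w) (dhdegEl (prehom_deg (heps_hom hC) dw)).
  rewrite dmulE dopE shift0 dopE mul1r shiftM shift_shift addrAC subrr add0r.
  rewrite -[mr _ 1 * mr _ 1]hmrE; exact: (wmrM wA _ _ deg1).
(* S(a' b) a'' S(a''') is computed in two ways: contracting the last two factors gives S(a b),
   contracting the first two by [slice1] gives S b S a. *)
pose H (_ _ : V) (p q e : A) := S (p * b) * q * S e.
have tH : @trilin R V A A H.
  split=> [ka la q e c p p'|ka la p e c q q'|ka la p q c e e'|f ka la p q e dp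
    |f ka la de' m be' p q e dq de]; rewrite /H.
  - by rewrite mulrDl -scalerAl SL !mulrDl -!scalerAl.
  - by rewrite mulrDr !mulrDl -scalerAr -scalerAl.
  - by rewrite SL mulrDr -scalerAr.
  - by rewrite -[hmr f p * b](mrM hH) -S_ml.
  - by rewrite -!mulrA (S_mr _ dq de).
transitivity (\sum_(t <- s) lift (fun _ _ _ q e => H al t.1.1 t.1.2 q e) (Dl t.2)).
  rewrite -[in LHS](counitr_list da sok Ds) mulr_suml (lin_sum SL); apply: eq_bigr => t _.
  by rewrite /H lift_antipode_r -(mrM hH) S_hmr.
rewrite -(coassoc_list sok Ds tH) -[in RHS](antipode_counit da sok Ds) mulr_sumr.
apply: eq_big_seq => t /sok[dx dy].
rewrite /H lift_mulr (slice1 _ _ dx) mulrA; congr (_ * _).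
(* S b has right degree - rh, so moving the right moment map past it removes the shift by rh. *)
rewrite -hmrE (hmr_right _ (S_deg db)) shift_shift; congr (_ * mr (shift _ _) 1).
vring.
Qed.

End AntipodeA.

(** * Duals are bialgebroids *)

Section SeparatedTheory.
Variables (R : realType) (V : vectType R[i]).
Notation D := (diffop V).

Section One.
Variables (P : hpre V) (I : Type) (k l : I -> V) (ev : I -> P -> D).
Hypothesis sP : separated k l ev.

Definition graded (Q : hpre V) (q : Q) : Prop := exists s : seq (V * V * Q),
  (forall t, t \in s -> hdeg t.1.1 t.1.2 t.2) /\ q = \sum_(t <- s) t.2.

(** A component of another bidegree would contribute values of another bidegree, which independence
    of operators forces to vanish. *)
Lemma sep_deg al be (p : P) : graded p -> (forall i, dhdeg (k i + be) (l i + al) (ev i p)) ->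
  hdeg al be p.
Proof.
have wP := sep_wpre sP; move=> [s [sd ->]] dp.
pose F k := \sum_(t <- s | t.1 == k) t.2.
have dF k' : hdeg k'.1 k'.2 (F k').
  by apply: (wdeg_sum wP) => t /sd dt /eqP <-.
have F0 k' : k' \notin map fst s -> F k' = 0.
  move=> nk; rewrite /F big_seq_cond big1 // => t /andP[ts /eqP tk].
  by rewrite -tk map_f in nk.
have sE : \sum_(t <- s) t.2 = \sum_(k' <- undup ((al, be) :: map fst s)) F k'.
  rewrite (big_group fst); apply/esym/big_usub => [||k'|k' _]; [exact: undup_uniq|exact: undup_uniq| |].
    by rewrite !mem_undup inE orbC => ->.
  by rewrite mem_undup => /F0.
have F1 k' : k' != (al, be) -> F k' = 0.
  move=> nk; have [kin|] := boolP (k' \in map fst s); last exact: F0.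
  apply: (ev_sep sP (dF k')) => i.
  (* Subtracting the whole value at the expected bidegree makes the sum of the [G k'] zero without
     changing them at the other bidegrees. *)
  pose G k' := ev i (F k') - (if k' == (al, be) then ev i (\sum_(t <- s) t.2) else 0).
  have -> : ev i (F k') = G k' by rewrite /G (negPf nk) subr0.
  apply: (@dhdeg_direct R V (k i) (l i) G (undup ((al, be) :: map fst s)) (undup_uniq _)).
  - move=> m _; apply: dhdegD; first exact: ev_deg sP _ _ _ _ (dF m).
    rewrite -scaleN1r; apply: dhdegZ; case: eqP => [->|_]; [exact: dp|exact: dhdeg0].
  - rewrite /G sumrB -(ev_sum sP) -sE -big_mkcond -big_filter.
    rewrite (_ : [seq m <- _ | m == (al, be)] = [:: (al, be)]) ?big_seq1 ?subrr //.
    by apply: filter_pred1_uniq; rewrite ?undup_uniq // mem_undup inE eqxx.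
  - by rewrite mem_undup inE kin orbT.
rewrite sE; apply: (wdeg_sum wP) => k' _ _.
by have [->|/F1 ->] := eqVneq k' (al, be); [exact: (dF (al, be))|exact: wdeg0].
Qed.

Lemma sep_ext (p q : P) : graded p -> graded q -> (forall i, ev i p = ev i q) -> p = q.
Proof.
move=> [s [sd ps]] [r [rd qr]] e; apply/eqP; rewrite -subr_eq0; apply/eqP.
have g : graded (p - q).
  exists (s ++ [seq (t.1, - t.2) | t <- r]); split.
    move=> t; rewrite mem_cat => /orP[/sd //|/mapP[u /rd du ->]]; exact: (wdegN (sep_wpre sP)).
  by rewrite big_cat big_map ps qr sumrN.
have ev0' i : ev i (p - q) = 0 by rewrite (linB (ev_linear sP i)) e subrr.
have d : hdeg 0 0 (p - q) by apply: sep_deg => // i; rewrite ev0'; exact: dhdeg0.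
exact: (ev_sep sP d).
Qed.

Lemma ev_dualfun i : dualfun (ev i).
Proof.
split=> [|f al be p dp|f al be p dp]; first exact: ev_linear sP i.
  exact: ev_ml sP _ _ _ _ _ dp.
rewrite (ev_mr sP _ _ dp) (dhdeg_mop_commute _ (ev_deg sP i dp)) shift_shift.
by rewrite opprD -addrA addNr addr0.
Qed.

End One.

Lemma mtensor_graded (P Q : hpre V) (wP : wpre P) (wQ : wpre Q) (x : tpre P Q) : graded x.
Proof.
have [s [sok ->]] := mtensor_sum wP wQ x.
exists [seq (t.1.1.1.1, t.1.1.2, tapp (@mtens R V P Q) t) | t <- s]; split; last by rewrite big_map.
by move=> _ /mapP[[[[[al ga] be] p] q] /sok[dp dq] ->]; exact: tdeg_mtens.
Qed.

Section Two.
Variables (P Q : hpre V) (I J : Type) (k l : I -> V) (k' l' : J -> V).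
Variables (ev : I -> P -> D) (ev' : J -> Q -> D).
Hypotheses (sP : separated k l ev) (sQ : separated k' l' ev').
Let wP := sep_wpre sP.
Let wQ := sep_wpre sQ.

(** For functionals on A this is the injectivity of [iota], for tensors that need not be
    homogeneous. *)
Lemma evt_ext (x y : tpre P Q) : (forall i j, evt ev ev' (i, j) x = evt ev ev' (i, j) y) -> x = y.
Proof.
move=> e; apply: (sep_ext (separated_tpre sP sQ)); try exact: mtensor_graded.
by move=> [i j]; exact: e.
Qed.

Lemma evt_ml i j f (x : tpre P Q) : evt ev ev' (i, j) (hml f x) = mop f * evt ev ev' (i, j) x.
Proof.
have sPQ := separated_tpre sP sQ.
have [s [sd ->]] := mtensor_graded wP wQ x.
rewrite (lin_sum (tml_linear wP wQ f)) !(ev_sum sPQ) mulr_sumr; apply: eq_big_seq => t /sd dt.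
exact: (ev_ml sPQ _ _ dt).
Qed.

Lemma evt_mr i j f (x : tpre P Q) :
  evt ev ev' (i, j) (hmr f x) = mop (shift (- (k i + k' j)) f) * evt ev ev' (i, j) x.
Proof.
have sPQ := separated_tpre sP sQ.
have [s [sd ->]] := mtensor_graded wP wQ x.
rewrite (lin_sum (tmr_linear wP wQ f)) !(ev_sum sPQ) mulr_sumr; apply: eq_big_seq => t /sd dt.
exact: (ev_mr sPQ _ _ dt).
Qed.

End Two.

(** Operators are separated by the single evaluation at themselves, so counit identities in products
    with D_h can be tested like the others. *)
Lemma Dh_separated : @separated R V (Dh V) unit (fun=> 0) (fun=> 0) (fun _ d => d).
Proof.
split=> [|i c p q //|i al be p dp|i f al be p dp|i f al be p dp|al be p dp h].
- exact: dhdeg_Dh.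
- rewrite !add0r; have [->|nz] := pselect (p = 0); first exact: dhdeg0.
  by have e := dhdeg_neq0 dp nz; rewrite e in dp *.
- by [].
- by rewrite oppr0 shift0.
- exact: (h tt).
Qed.

End SeparatedTheory.

(** * Bialgebroid axioms for the dual *)

Section DualIsBialgebroid.
Variables (R : realType) (V : vectType R[i]) (A : hbialg V) (hA : is_hbialgebroid A).
Variables (B : hbialg V) (j : B -> A -> diffop V) (dj : is_dual j).
Notation D := (diffop V).

Let hH := hbialg_halg hA.
Let hC := hbialg_hcoalg hA.
Let pA : is_hprealgebra A := hcoalg_prealg hC.
Let wA := hprealgebra_wpre pA.
Let sD := dual_separated hC.
Let wD := sep_wpre sD.

Local Notation el i := (hel i : halg_car A).

Let jl : linear j := is_dual_linear dj.
Let jinj : injective j := is_dual_inj dj.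
Let jdeg := is_dual_deg dj.

Lemma j_Astar b : in_Astar (j b).
Proof. by rewrite -(is_dual_range dj); exists b. Qed.

Lemma j_onto phi : in_Astar phi -> exists b, j b = phi.
Proof. by rewrite -(is_dual_range dj) => -[b _ <-]; exists b. Qed.

Lemma j_dualfun b : @dualfun R V A (j b).
Proof. by have /(in_AstarP hA)[/in_dual_dualfun] := j_Astar b. Qed.

Let wB : wpre B := @embedding_wpre R V A hA B j jl jinj jdeg (is_dual_ml dj) (is_dual_mr dj).
Let hj : @whom R V B (dual_pre A) j := @embedding_whom R V A B j jl jdeg (is_dual_ml dj) (is_dual_mr dj).

Definition evj (i : homel A) (b : B) : D := j b (hel i).

Lemma j_ml f b a : j (@hml R V B f b) a = mop f * j b a.
Proof. by rewrite [j _](is_dual_ml dj) (dual_mul_muml hC f (j_dualfun b)). Qed.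

Lemma j_mr f b (i : homel A) : j (@hmr R V B f b) (hel i) = mop (shift (- hk i) f) * j b (hel i).
Proof.
by rewrite [j _](is_dual_mr dj) (dual_mul_mumr hC f (j_dualfun b) (homelP i)).
Qed.

Lemma j_ext b c : (forall i : homel A, j b (hel i) = j c (hel i)) -> b = c.
Proof.
move=> e; apply: jinj; apply: (linear_ext hC); [exact: df_lin (j_dualfun b)|
  exact: df_lin (j_dualfun c)|].
by move=> al be a da; exact: (e (Homel da)).
Qed.

Lemma j_sum (T : Type) (r : seq T) (F : T -> B) :
  j (\sum_(t <- r) F t) = \sum_(t <- r) j (F t).
Proof.
exact: lin_sum jl _ _ _ _.
Qed.

Lemma jD b c a : j (b + c) a = j b a + j c a.
Proof. by rewrite -[b]scale1r jl !scale1r. Qed.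

Lemma jL c a b x : j (c *: a + b) x = c *: j a x + j b x.
Proof. by rewrite jl. Qed.

Lemma jZ c a x : j (c *: a) x = c *: j a x.
Proof.
by rewrite (linZ jl).
Qed.

Lemma B_separated : @separated R V B (homel A) (@hk R V A) (@hl R V A) evj.
Proof.
split=> [|i c p q|i al be p /jdeg dp|i f al be p _|i f al be p _|al be p _ h].
- exact: wB.
- by rewrite /evj jl.
- exact: dual_deg_dhdeg dp (homelP i).
- exact: j_ml.
- exact: j_mr.
- apply: j_ext => i; rewrite [LHS](h i).
  by have := jl (-1) 0 0; rewrite scaler0 addr0 scaleN1r addNr => ->.
Qed.
Let sB := B_separated.
Let sBB := separated_tpre sB sB.

Local Notation ev2 i l := (@evt R V B B _ _ evj evj (i, l)).
Local Notation Dl := (@hDelta R V B).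

(** The working form of the characterization of the coproduct: axioms about it become properties of
    the product of A. *)
Lemma ev2_Delta b i l : ev2 i l (Dl b) = j b (el i * el l).
Proof.
have dj' : @in_dual R V A (j b) by have /(in_AstarP hA)[] := j_Astar b.
have := is_dual_Delta dj b; move/(iota_mdual hA _ dj') => ->.
by rewrite /evt (mtlift_tmap wB wD wB wD hj hj (evt_balanced sD sD i l)).
Qed.

Lemma B_graded (b : B) : @graded R V B b.
Proof.
have [ks [F [uks dF e]]] := in_Astar_components hA (j_Astar b).
have /choice[c ce] : forall k, exists c, k \in ks -> j c = F k.
  move=> k; have [/dF[_ /j_onto[c <-]]|] := boolP (k \in ks); by [exists c|exists 0].
exists [seq (k, c k) | k <- ks]; split.
  by move=> _ /mapP[k kks ->] /=; apply/jdeg; rewrite ce //; have [] := dF k kks.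
apply: jinj; rewrite e big_map j_sum.
by apply: eq_big_seq => k kks; rewrite [RHS]ce.
Qed.

Lemma B_prealgebra : is_hprealgebra B.
Proof.
split=> [al be|al be c a b da db|a|F s us dF|||f al be a da|f al be a da|f g a].
- exact: (wdeg0 wB).
- exact: (wdeg_lin wB).
- exact: B_graded.
- apply: (separated_direct sB us) => i _; exact: dF.
- split=> [f c a b|f g a|f g a|c a]; apply: j_ext => i.
  + by rewrite jL !j_ml jL mulrDr scalerAr.
  + by rewrite jD !j_ml raddfD mulrDl.
  + by rewrite !j_ml rmorphM mulrA.
  + by rewrite j_ml mopZ rmorph1 -scalerAl mul1r jZ.
- split=> [f c a b|f g a|f g a|c a]; apply: j_ext => i.
  + by rewrite jL !j_mr jL mulrDr scalerAr.
  + by rewrite jD !j_mr !raddfD mulrDl.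
  + by rewrite !j_mr shiftM rmorphM mulrA.
  + by rewrite j_mr shiftZ rmorph1 mopZ rmorph1 -scalerAl mul1r jZ.
- exact: (wml_deg wB).
- exact: (wmr_deg wB).
- by apply: j_ext => i; rewrite j_ml !j_mr j_ml !mulrA -!rmorphM mulrC.
Qed.

Lemma dual_mul_right_ml phi f al be (a : A) : @dualfun R V A phi -> @hdeg R V A al be a ->
  @dual_mul R V A phi (@dual_muml R V A f) a = phi a * mop (shift be f).
Proof.
move=> dphi da; have [s [sok Ds]] := Delta_sum hC da; have he := heps_dualfun hC.
rewrite -[in RHS](dual_mulr1 hC dphi) !dual_mulE Ds.
rewrite (mconv_mtens_sum wA wA dphi he sok).
rewrite (mconv_mtens_sum wA wA dphi (dual_deg_dualfun (muml_deg hC f)) sok).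
rewrite mulr_suml; apply: eq_big_seq => t /sok[dx dy].
rewrite /dual_muml dcompE -/(mop f) -[RHS]mulrA.
by rewrite (dhdeg_mop_commuter _ (prehom_deg (heps_hom hC) dy)) shiftNK.
Qed.

Lemma dual_mul_right_mr phi f (a : A) : @dualfun R V A phi ->
  @dual_mul R V A phi (@dual_mumr R V A f) a = phi a * mop f.
Proof. by move=> dphi; rewrite dual_mulE mconv_mulr -dual_mulE (dual_mulr1 hC dphi). Qed.

Let jM b c : j (b * c) = @dual_mul R V A (j b) (j c) := is_dual_M dj b c.

Lemma j_ml1 f : j (halg_ml f 1) = @dual_muml R V A f.
Proof. by rewrite (is_dual_ml dj) (is_dual_1 dj) (dual_muml1 hC). Qed.

Lemma j_mr1 f : j (halg_mr f 1) = @dual_mumr R V A f.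
Proof.
rewrite (is_dual_mr dj) (is_dual_1 dj); exact: (dual_mulr1 hC (dual_deg_dualfun (mumr_deg hC f))).
Qed.

Let heps1 : @heps R V A (1 : A) = 1. Proof. exact: (hbialg_eps1 hA). Qed.

(** Evaluation at this index is the counit of B, which reduces the counit axioms to multiplication
    by 1 in A. *)
Definition hone : homel A := @Homel R V A 0 0 (1 : A) (halg_deg1 hH).

Lemma B_halgebra : is_halgebra B.
Proof.
have degA1 := halg_deg1 hH.
split=> [||al be ga de a b /jdeg da /jdeg db|f a|f a|f g /(congr1 j)|f g /(congr1 j)
  |f al be a da|f al be a da].
- exact: B_prealgebra.
- by apply/jdeg; rewrite (is_dual_1 dj); exact: heps_deg.
- by apply/jdeg; rewrite jM; exact: dual_degM.
- by apply: jinj; rewrite jM j_ml1; exact: (is_dual_ml dj).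
- by apply: jinj; rewrite jM j_mr1; exact: (is_dual_mr dj).
- rewrite !j_ml1 => /(congr1 (@^~ (1 : A))); rewrite /dual_muml !dcompE !heps1 !mulr1.
  by move/(congr1 (fun d : D => d 1)); rewrite !dop_at1.
- rewrite !j_mr1 => /(congr1 (@^~ (1 : A))); rewrite /dual_mumr !dcompE !heps1 !mul1r.
  by move/(congr1 (fun d : D => d 1)); rewrite !dop_at1.
- apply: j_ext => i; rewrite jM j_ml1 (dual_mul_right_ml _ (j_dualfun a) (homelP i)) [LHS]j_ml.
  rewrite (dhdeg_mop_commuter _ (ev_deg sB i da)) shift_shift shift_shift.
  by congr (mop _ * _); rewrite -[LHS]shift0; congr Defs.shift; vring.
- apply: j_ext => i; rewrite jM j_mr1 (dual_mul_right_mr _ _ (j_dualfun a)) [LHS]j_mr.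
  rewrite (dhdeg_mop_commute _ (ev_deg sB i da)) shift_shift.
  by congr (mop (Defs.shift _ _) * _); vring.
Qed.

Lemma B_Delta_hom : is_prehom Dl.
Proof.
split=> [c a b|f a|f a|al be a /jdeg da].
- apply: (evt_ext sB sB) => i l; rewrite (ev_linear sBB) !ev2_Delta jl.
  by [].
- by apply: (evt_ext sB sB) => i l; rewrite (evt_ml sB sB) !ev2_Delta j_ml.
- apply: (evt_ext sB sB) => i l; rewrite (evt_mr sB sB) !ev2_Delta.
  exact: (j_mr f a (homelM hA i l)).
- apply: (sep_deg sBB); first exact: (mtensor_graded wB wB).
  move=> [i l]; rewrite ev2_Delta; exact: dual_deg_dhdeg da (homelP (homelM hA i l)).
Qed.

Lemma B_epsE b : @heps R V B b = j b (1 : A). Proof. exact: is_dual_eps. Qed.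

Lemma B_eps_hom : is_prehom (@heps R V B).
Proof.
split=> [c a b|f a|f a|al be a /jdeg da]; rewrite ?B_epsE.
- by rewrite jl.
- exact: j_ml.
- by have := j_mr f a hone; rewrite /= oppr0 shift0.
- have := dual_deg_dhdeg da (halg_deg1 hH); rewrite !add0r => d.
  have [->|nz] := pselect (j a (1 : A) = 0); first exact: dhdeg0.
  by have e := dhdeg_neq0 d nz; rewrite e in d *.
Qed.

Let hDB := prehom_whom B_Delta_hom.
Let heB := prehom_whom B_eps_hom.
Let wDh := @dhdeg_Dh R V.
Let wBB := wpre_tpre wB wB.
Let dB i := ev_dualfun sB i.

(** At a triple (i, l, m) the two sides are the values of [j b] at (i l) m and at i (l m). *)
Lemma B_coassoc b :
  tassoc (tmap Dl id (Dl b)) = tmap id Dl (Dl b).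
Proof.
apply: (evt_ext sB sBB) => i [l m].
have d2 i' l' := mconv_dualfun wB wB (dB i') (dB l').
rewrite -[LHS]/(@mconv R V B (tpre B B) (evj i) (@mconv R V B B (evj l) (evj m)) _).
rewrite -[RHS]/(@mconv R V B (tpre B B) (evj i) (@mconv R V B B (evj l) (evj m)) _).
rewrite (mconv_tassoc wB wB wB (dB i) (dB l) (dB m)).
rewrite /mconv (mtlift_tmap wB wBB wB wB hDB (whom_id B) (mconv_balanced (d2 i l) (dB m))).
rewrite (mtlift_tmap wB wB wB wBB (whom_id B) hDB (mconv_balanced (dB i) (d2 l m))).
transitivity (ev2 (homelM hA i l) m (Dl b)).
  apply: eq_mtlift => al ga be p q _ _.
  by rewrite -[X in X * _ * _]/(ev2 i l (Dl p)) ev2_Delta.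
transitivity (ev2 i (homelM hA l m) (Dl b)); first by rewrite !ev2_Delta /= mulrA.
apply: eq_mtlift => al ga be p q _ _.
by rewrite -[X in _ = _ * X]/(ev2 l m (Dl q)) ev2_Delta.
Qed.

Lemma B_hcoalgebroid : is_hcoalgebroid B.
Proof.
split=> [||||al be b db|al be b db].
- exact: B_prealgebra.
- exact: B_Delta_hom.
- exact: B_eps_hom.
- exact: B_coassoc.
- apply: (evt_ext (Dh_separated V) sB) => -[] i.
  rewrite (evt_mtens (Dh_separated V) sB) //; last exact: dhdeg_dop.
  rewrite -/(tau _) tauNK mul1r.
  rewrite -[LHS]/(@mconv R V (Dh V) B id (evj i) _) /mconv.
  rewrite (mtlift_tmap wB wDh wB wB heB (whom_id B) (mconv_balanced (@dualfun_Dh R V) (dB i))).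
  transitivity (ev2 hone i (Dl b)); last by rewrite ev2_Delta mul1r.
  by apply: eq_mtlift => al' ga' be' p q _ _; rewrite B_epsE.
- apply: (evt_ext sB (Dh_separated V)) => i -[].
  rewrite (evt_mtens sB (Dh_separated V)) //; last exact: dhdeg_dop.
  rewrite -/(tau _) -mulrA tauK mulr1.
  rewrite -[LHS]/(@mconv R V B (Dh V) (evj i) id _) /mconv.
  rewrite (mtlift_tmap wB wB wB wDh (whom_id B) heB (mconv_balanced (dB i) (@dualfun_Dh R V))).
  transitivity (ev2 i hone (Dl b)); last by rewrite ev2_Delta mulr1.
  by apply: eq_mtlift => al' ga' be' p q _ _; rewrite B_epsE.
Qed.

(** The explicit tensor of [splitsM_sum], formed from presentations of the two coproducts, has the
    same evaluations as their product in B. *)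
Lemma B_DeltaM b c : Dl (b * c) = @tmul R V B B (Dl b) (Dl c).
Proof.
have hB := B_halgebra.
have [s [sok Db]] := mtensor_sum wB wB (Dl b); have [r [rok Dc]] := mtensor_sum wB wB (Dl c).
pose J (t : V * V * V * B * B) : V * V * V * dual_pre A * dual_pre A :=
  (t.1.1.1.1, t.1.1.1.2, t.1.1.2, j t.1.2 : dual_pre A, j t.2 : dual_pre A).
have sok' t : t \in s -> @hdeg R V B t.1.1.1.1 t.1.1.1.2 t.1.2 /\ @hdeg R V B t.1.1.1.2 t.1.1.2 t.2.
  by move: t => [[[[? ?] ?] ?] ?] /sok.
have rok' t : t \in r -> @hdeg R V B t.1.1.1.1 t.1.1.1.2 t.1.2 /\ @hdeg R V B t.1.1.1.2 t.1.1.2 t.2.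
  by move: t => [[[[? ?] ?] ?] ?] /rok.
have mtE (q : seq (V * V * V * B * B)) : \sum_(t <- q) tapp (@mtens R V B B) t =
    \sum_(t <- q) @mtens R V B B t.1.1.1.1 t.1.1.1.2 t.1.1.2 t.1.2 t.2.
  by apply: eq_bigr => -[[[[? ?] ?] ?] ?].
rewrite mtE in Db; rewrite mtE in Dc.
have Jok (q : seq (V * V * V * B * B)) : (forall t, t \in q -> @hdeg R V B t.1.1.1.1 t.1.1.1.2 t.1.2 /\
    @hdeg R V B t.1.1.1.2 t.1.1.2 t.2) -> forall t, t \in map J q ->
    @dual_deg R V A t.1.1.1.1 t.1.1.1.2 t.1.2 /\ @dual_deg R V A t.1.1.1.2 t.1.1.2 t.2.
  by move=> qok _ /mapP[t /qok[/jdeg d1 /jdeg d2] ->].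
have spl a (q : seq (V * V * V * B * B)) : (forall t, t \in q -> @hdeg R V B t.1.1.1.1 t.1.1.1.2 t.1.2 /\
    @hdeg R V B t.1.1.1.2 t.1.1.2 t.2) ->
    Dl a = \sum_(t <- q) @mtens R V B B t.1.1.1.1 t.1.1.1.2 t.1.1.2 t.1.2 t.2 ->
    splits (j a) (\sum_(u <- map J q) mtens u.1.1.1.1 u.1.1.1.2 u.1.1.2 u.1.2 u.2).
  move=> qok Da i l; rewrite -ev2_Delta Da (evt_mtens_sum sB sB _ _ qok).
  by rewrite (evt_mtens_sum sD sD _ _ (Jok q qok)) big_map.
apply: (evt_ext sB sB) => i l; rewrite [LHS]ev2_Delta jM.
rewrite (splitsM_sum hA (j_dualfun b) (j_dualfun c) (Jok s sok') (Jok r rok') (spl b s sok' Db)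
  (spl c r rok' Dc) i l).
have -> : @tmul R V B B (Dl b) (Dl c) = \sum_(u <- s) \sum_(v <- r)
    @mtens R V B B (u.1.1.1.1 + v.1.1.1.1) (u.1.1.1.2 + v.1.1.1.2) (u.1.1.2 + v.1.1.2)
     (u.1.2 * v.1.2) (u.2 * v.2).
  rewrite Db Dc.
  exact: (@tmul_mtens_sum _ _ _ _ hB hB _ _ s r (fun t => t.1.1.1.1) (fun t => t.1.1.1.2)
    (fun t => t.1.1.2) (fun t => t.1.1.1.1) (fun t => t.1.1.1.2) (fun t => t.1.1.2)
    (fun t => t.1.2) snd (fun t => t.1.2) snd sok' rok').
rewrite (ev_sum (separated_tpre sD sD)) (ev_sum sBB) big_map.
apply: eq_big_seq => u /sok'[du1 du2].
rewrite (ev_sum (separated_tpre sD sD)) (ev_sum sBB) big_map.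
apply: eq_big_seq => v /rok'[dv1 dv2].
rewrite (evt_mtens sD sD); last 2 first.
- by apply: (dual_degM hC); exact/jdeg.
- by apply: (dual_degM hC); exact/jdeg.
rewrite (evt_mtens sB sB); last 2 first.
- exact: (hdegM hB du1 dv1).
- exact: (hdegM hB du2 dv2).
by rewrite /evj !jM.
Qed.

Lemma B_hbialgebroid : is_hbialgebroid B.
Proof.
have d1 : @hdeg R V B 0 0 (1 : B) := halg_deg1 B_halgebra.
split=> [||||b c|].
- exact: B_halgebra.
- exact: B_hcoalgebroid.
- exact: B_DeltaM.
- apply: (evt_ext sB sB) => i l; rewrite [LHS]ev2_Delta (evt_mtens sB sB) // tau0 mulr1.
  rewrite /evj (is_dual_1 dj); exact: (hbialg_epsM hA).
- rewrite !(is_dual_eps dj) jM dual_mulE [hDelta _](hbialg_Delta1 hA).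
  rewrite (mconv_mtens wA wA (j_dualfun b) (j_dualfun c)); try exact: (halg_deg1 hH).
  by rewrite tau0 mulr1.
- by rewrite (is_dual_eps dj) (is_dual_1 dj) heps1.
Qed.

End DualIsBialgebroid.

(** * The antipode of the dual *)

Section Twist.
Variables (R : realType) (V : vectType R[i]) (A : hbialg V) (S : A -> A).
Hypothesis hS : is_hHopf_algebroid S.
Notation D := (diffop V).
Implicit Types (phi psi : A -> D) (i l : homel A).

Let hA := hHopf_bialg hS.
Let hC := hbialg_hcoalg hA.
Let sD := dual_separated hC.

Lemma antipodeD_dhdeg a b (x : D) : dhdeg a b x -> antipodeD x = tau b * x * tau a.
Proof.
move=> /dhdegP[->|[<- ->]]; first by rewrite raddf0 mulr0 mul0r.
by rewrite antipodeDM antipodeD_mop antipodeD_tau opprK -!mulrA tauNK mulr1.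
Qed.

Lemma dhdeg_antipodeD a b (x : D) : dhdeg a b x -> dhdeg (- b) (- a) (antipodeD x).
Proof.
move=> dx; rewrite (antipodeD_dhdeg dx).
by have := dhdegM (dhdegM (dhdeg_tau b) dx) (dhdeg_tau a); congr dhdeg; vring.
Qed.

Definition twist phi : A -> D := fun a => antipodeD (phi (S a)).

Definition homelS i : homel A := @Homel R V A (- hl i) (- hk i) (S (hel i)) (S_deg hS (homelP i)).

Lemma twist_dualfun phi : @dualfun R V A phi -> @dualfun R V A (twist phi).
Proof.
move=> dphi; split=> [c a b|f al be a da|f al be a da]; rewrite /twist.
- by rewrite (SL hS) (df_lin dphi) antipodeD_linear.
- rewrite (hml_right hS _ da) (S_hml hS) (df_mr dphi _ (S_deg hS da)) shift_shift addNr.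
  by rewrite shift0 antipodeDM antipodeD_mop.
- rewrite (S_hmr hS) -[f](shiftNK be) -(hml_right hS _ (S_deg hS da)).
  by rewrite (df_ml dphi _ (S_deg hS da)) antipodeDM antipodeD_mop shiftNK.
Qed.

Lemma twist_deg al be phi : @dual_deg R V A al be phi -> @dual_deg R V A (- be) (- al) (twist phi).
Proof.
move=> dphi; apply: (dual_degI hC) => [|ga de a da].
  exact: twist_dualfun (dual_deg_dualfun dphi).
have := dhdeg_antipodeD (dual_deg_dhdeg dphi (S_deg hS da)).
by congr dhdeg; vring.
Qed.

Lemma twist_sum (T : Type) (r : seq T) (F : T -> A -> D) :
  twist (\sum_(t <- r) F t) = \sum_(t <- r) twist (F t).
Proof.
elim/big_ind2: _ => [|phi phi' psi psi' <- <-|//].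
  by apply/funext => a; rewrite /twist raddf0.
by apply/funext => a; rewrite /twist raddfD.
Qed.

Lemma twist_Astar phi : in_Astar phi -> in_Astar (twist phi).
Proof.
move=> /(in_AstarP hA)[[s [sd ->]] [x]].
have [r [rok ->]] := DD_sum hA x => sx; apply/(in_AstarP hA); split.
  exists [seq (- t.1.2, - t.1.1, twist t.2) | t <- s]; split.
    by move=> _ /mapP[t /sd dt ->]; exact: twist_deg.
  by rewrite twist_sum big_map.
exists (\sum_(t <- r) @mtens R V (dual_pre A) (dual_pre A) (- t.1.1.2) (- t.1.1.1.2)
  (- t.1.1.1.1) (twist t.2) (twist t.1.2)) => i l.
rewrite (evt_mtens_sum sD sD); last first.
  by move=> t /rok[d1 d2]; split; exact: twist_deg.
rewrite {1}/twist (S_mul hS (homelP i) (homelP l)) [X in antipodeD X](sx (homelS l) (homelS i)).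
rewrite (evt_mtens_sum sD sD _ _ rok) raddf_sum; apply: eq_bigr => t _.
by rewrite -[LHS]/(antipodeD _) !antipodeDM antipodeD_tau mulrA.
Qed.

End Twist.

(** * Antipode axioms for the dual *)

Section DualAntipode.
Variables (R : realType) (V : vectType R[i]) (A : hbialg V) (S : A -> A).
Hypothesis hS : is_hHopf_algebroid S.
Variables (B : hbialg V) (j : B -> A -> diffop V) (dj : is_dual j).
Variables (SB : B -> B) (jS : forall b, j (SB b) = twist S (j b)).
Notation D := (diffop V).
Implicit Types (i : homel A).

Let hA := hHopf_bialg hS.
Let hC := hbialg_hcoalg hA.
Let pA : is_hprealgebra A := hcoalg_prealg hC.
Let wA := hprealgebra_wpre pA.
Let hB := B_hbialgebroid hA dj.
Let hHB := hbialg_halg hB.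
Let hCB := hbialg_hcoalg hB.
Let wB := hprealgebra_wpre (hcoalg_prealg hCB).
Let sB := B_separated hA dj.
Let jdf b := j_dualfun hA dj b.
Let jM b c : j (b * c) = @dual_mul R V A (j b) (j c) := is_dual_M dj b c.

Lemma SB_linear : linear SB.
Proof.
move=> c a b; apply: (is_dual_inj dj); apply/funext => x.
by rewrite (jL dj) !jS /twist (jL dj) antipodeD_linear.
Qed.

Lemma SB_hmr f b : SB (halg_mr f b) = SB b * halg_ml f 1.
Proof.
apply: (j_ext hA dj) => i; rewrite jM (j_ml1 hA dj).
rewrite (dual_mul_right_ml hA _ (jdf _) (homelP i)) !jS /twist.
have := j_mr hA dj f b (homelS hS i) => /= ->.
by rewrite antipodeDM antipodeD_mop opprK.
Qed.

Lemma SB_hml f b : SB (b * halg_ml f 1) = halg_mr f (SB b).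
Proof.
apply: (j_ext hA dj) => i; rewrite jS [RHS](j_mr hA dj) jS /twist jM (j_ml1 hA dj).
rewrite (dual_mul_right_ml hA _ (jdf b) (S_deg hS (homelP i))).
by rewrite antipodeDM antipodeD_mop.
Qed.

Let bl := antipode_l_balanced hHB SB_linear SB_hmr.
Let br := antipode_r_balanced hHB SB_linear SB_hml.

(** At a the left side is a sum of terms b'(a') T S^D(b''(S a'')). Writing S^D of a homogeneous
    operator as the operator between two translations reassembles b(a' S(a'')), to which the axiom
    of A applies. *)
Lemma antipode_r_homogeneous al be (b : B) : @hdeg R V B al be b ->
  @mtlift R V B B B (fun _ _ _ x y => x * SB y) (@hDelta R V B b) =
  halg_ml ((@heps R V B b : D) 1) 1.
Proof.
move=> db; have [s [sok Ds]] := Delta_sum hCB db.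
rewrite Ds (mtlift_mtens_sum wB wB br sok).
apply: (j_ext hA dj) => i; have [u [uok Du]] := Delta_sum hC (homelP i).
rewrite (j_ml1 hA dj) (B_epsE dj) /dual_muml dcompE -/(mop _) (j_sum dj) fct_sumE.
have dj1 := dual_deg_dhdeg ((is_dual_deg dj _ _ _).1 db) (halg_deg1 (hbialg_halg hA)).
rewrite !add0r in dj1.
have dS t y mu : t \in s -> @hdeg R V A mu (hl i) y ->
    dhdeg (be - hl i) (t.1.1 - mu) (j t.2 (S y)).
  move=> /sok[_ /(is_dual_deg dj)] dt dy.
  by have := dual_deg_dhdeg dt (S_deg hS dy); congr dhdeg; vring.
(* The inner translation combines with the middle degree of the coproduct of a into the middle
   degree of that of b; the outer one depends neither on the summand of b nor on that of a. *)
transitivity (\sum_(v <- u) j b (v.1.2 * S v.2) * tau (be - hl i)).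
  under eq_bigr do rewrite jM dual_mulE Du (mconv_mtens_sum wA wA (jdf _) (jdf _) uok).
  rewrite exchange_big /=; apply: eq_big_seq => v /uok[dx dy].
  have := ev2_Delta hA dj b (Homel dx) (homelS hS (Homel dy)).
  rewrite Ds (evt_mtens_sum sB sB _ _ sok) /= => <-.
  rewrite mulr_suml.
  apply: eq_big_seq => t ts; rewrite jS /twist (antipodeD_dhdeg (dS _ _ _ ts dy)).
  by rewrite !mulrA -(mulrA (j t.1.2 v.1.2)) -tauD addrC subrK.
have e : \sum_(v <- u) v.1.2 * S v.2 = @hml R V A (epsv (hel i)) 1.
  rewrite -(lift_Sr hS) (Delta_lift hS uok Du) //.
  exact: (antipode_r_balanced (hbialg_halg hA) (SL hS) (S_hml hS)).
rewrite -mulr_suml -(lin_sum (df_lin (jdf b))) e (df_ml (jdf b) _ (halg_deg1 (hbialg_halg hA))).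
(* In normal form both sides are the same two multiplication operators, which commute, followed by
   T_{-l}, where l is the right degree of a. *)
rewrite [in LHS](dhdegEl dj1) [in RHS](dhdegEr (prehom_deg (heps_hom hC) (homelP i))).
rewrite -!mulrA -tauD addrA addNr add0r !mulrA -!rmorphM /= mulrC.
by [].
Qed.

Lemma antipode_l_homogeneous al be (b : B) : @hdeg R V B al be b ->
  @mtlift R V B B B (fun _ _ _ x y => SB x * y) (@hDelta R V B b) =
  halg_mr (shift al ((@heps R V B b : D) 1)) 1.
Proof.
move=> db; have [s [sok Ds]] := Delta_sum hCB db.
rewrite Ds (mtlift_mtens_sum wB wB bl sok).
apply: (j_ext hA dj) => i; have [u [uok Du]] := Delta_sum hC (homelP i).
rewrite (j_mr1 hA dj) (B_epsE dj) /dual_mumr dcompE -/(mop _) (j_sum dj) fct_sumE.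
have dj1 := dual_deg_dhdeg ((is_dual_deg dj _ _ _).1 db) (halg_deg1 (hbialg_halg hA)).
rewrite !add0r in dj1.
have dS t x mu : t \in s -> @hdeg R V A (hk i) mu x ->
    dhdeg (t.1.1 - mu) (al - hk i) (j t.1.2 (S x)).
  move=> /sok[/(is_dual_deg dj) dt _] dx.
  by have := dual_deg_dhdeg dt (S_deg hS dx); congr dhdeg; vring.
(* Now S^D is applied to the first factor, so the translation common to all terms is left over on
   the left. *)
transitivity (\sum_(v <- u) tau (al - hk i) * j b (S v.1.2 * v.2)).
  under eq_bigr do rewrite jM dual_mulE Du (mconv_mtens_sum wA wA (jdf _) (jdf _) uok).
  rewrite exchange_big /=; apply: eq_big_seq => v /uok[dx dy].
  have := ev2_Delta hA dj b (homelS hS (Homel dx)) (Homel dy).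
  rewrite Ds (evt_mtens_sum sB sB _ _ sok) /= => <-.
  rewrite mulr_sumr.
  apply: eq_big_seq => t ts; rewrite jS /twist (antipodeD_dhdeg (dS _ _ _ ts dx)).
  by rewrite !mulrA -(mulrA _ (tau (t.1.1 - v.1.1))) -tauD subrK.
rewrite -mulr_sumr -(lin_sum (df_lin (jdf b))) (antipode_l_list hS (homelP i) uok Du).
rewrite (df_mr (jdf b) _ (halg_deg1 (hbialg_halg hA))) shift0.
rewrite [in LHS](dhdegEr dj1) [in RHS](dhdegEl (prehom_deg (heps_hom hC) (homelP i))).
rewrite -!mulrA (mulrA (tau (al - hk i)) (mop _)) tau_mop -!mulrA (mulrA (tau _) (tau _)) -tauD.
rewrite addrAC subrr add0r !tau_mop !shift_shift addNr shift0 !mulrA -!rmorphM mulrC [- _ + al]addrC.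
by [].
Qed.

Lemma is_antipode_SB : is_antipode SB.
Proof.
split=> [|f a|f a|b|al be b]; [exact: SB_linear|exact: SB_hmr|exact: SB_hml| |].
  have [s [sd ->]] := B_graded hA dj b.
  (* The right axiom is required for all b, unlike the left one; both of its sides are linear and b
     is a sum of homogeneous elements. *)
  have Ll : linear (fun c => @mtlift R V B B B (fun _ _ _ x y => x * SB y) (@hDelta R V B c)).
    move=> c x y; rewrite (prehom_linear (hDelta_hom hCB)); exact: (mtlift_linear wB wB br).
  have Lr : linear (fun c : B => halg_ml ((@heps R V B c : D) 1) 1 : B).
    move=> c x y; apply: (j_ext hA dj) => i; rewrite (jL dj) !(j_ml1 hA dj) !(B_epsE dj) (jL dj).
    rewrite /dual_muml !dcompE -[dfun (_ + _) _]/(c *: j x 1 1 + j y 1 1).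
    by rewrite -!/(mop _) raddfD -[X in X + _]/(mop _) mopZ mulrDl scalerAl.
  rewrite (lin_sum Ll) (lin_sum Lr); apply: eq_big_seq => t /sd dt.
  exact: antipode_r_homogeneous dt.
exact: antipode_l_homogeneous.
Qed.

End DualAntipode.

(** A^* is determined only up to the identification j, so the claim is made for every model; the
    existence of one shows that it is not vacuous. The bialgebroid axioms of a model are not part of
    [is_dual] and belong to what is proved. *)
Theorem proposition3p7 (R : realType) (V : vectType R[i])
    (A : hbialg V) (SA : A -> A) :
  is_hHopf_algebroid SA ->
  (exists (B : hbialg V) (j : B -> A -> diffop V), is_dual j) /\
  (forall (B : hbialg V) (j : B -> A -> diffop V), is_dual j ->
     exists SB : B -> B,
       is_hHopf_algebroid SB /\
       forall (b : B) (a : A), j (SB b) a = antipodeD (j b (SA a))).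
Proof.
move=> hS; have hA := hHopf_bialg hS; split=> [|B j dj]; first exact: exists_dual.
have /choice[SB jS] : forall b, exists c, j c = twist SA (j b).
  by move=> b; apply: (j_onto dj); exact/(twist_Astar hS)/j_Astar.
exists SB; split=> [|b a]; last by rewrite jS.
split; [exact: B_hbialgebroid dj|exact: is_antipode_SB jS].
Qed.
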